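(* For every $\epsilon\in(0,1/2)$, $$nC-\sqrt{nV}\,Q^{-1}(2\epsilon)+\mathcal O(n^{1/3}\log n)\ \le\ \log M^*_{\mathrm f}(n,\epsilon)\ \le\ nC+\mathcal O(\sqrt n)\qquad(n\to\infty),$$ i.e., there exist constants $K_1,K_2,n_0$ such that for all $n\ge n_0$: $\log M^*_{\mathrm f}(n,\epsilon)\ge nC-\sqrt{nV}Q^{-1}(2\epsilon)-K_1n^{1/3}\log n$ and $\log M^*_{\mathrm f}(n,\epsilon)\le nC+K_2\sqrt n$.
   Context: Setting (CM-DMBC): finite alphabets $\mathcal X=\{1,\dots,N\}$, $\mathcal Y$; transition matrices $W_1,W_2$; given input $x$ the outputs are $(y_1,y_2)$ with probability $W_1(y_1|x)W_2(y_2|x)$, memoryless. For a distribution $P$ on $\mathcal X$: $PW_k(y)=\sum_xP(x)W_k(y|x)$, $\imath_{P,W_k}(x;y)=\log\frac{W_k(y|x)}{PW_k(y)}$ (natural log), $I_k(P)=\sum_xP(x)D(W_k(\cdot|x)\|PW_k)$, $V_k(P)=\sum_xP(x)\mathrm{Var}[\imath_{P,W_k}(x;Y_k)]$ with $Y_k\sim W_k(\cdot|x)$. $C=\max_P\min_kI_k(P)$, $C_k=\max_PI_k(P)$. Standing assumptions: the maximizer $P^*$ of $\min_kI_k$ is unique, $P^*(x)>0$ for all $x$, $V_k:=V_k(P^* )>0$ and $C_k>C$ for $k=1,2$. $P^*_{Y_k}=P^*W_k$; for $\mathbf v\in\mathbb R^N$ with entries summing to zero, $\mathrm dI_k(\mathbf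 v)=\sum_xv_xD(W_k(\cdot|x)\|P^*_{Y_k})$; $\eta\in(0,1)$ is the unique constant with $\eta\,\mathrm dI_1(\mathbf v)+(1-\eta)\mathrm dI_2(\mathbf v)=0$ for all such $\mathbf v$. $V=\eta^2V_1+(1-\eta)^2V_2$. $Q(t)=\int_t^\infty\frac1{\sqrt{2\pi}}e^{-u^2/2}du$. An $(n,M,\epsilon)$-FLF code: encoders $f_i:\{1,\dots,M\}\times\mathcal Y^{i-1}\times\mathcal Y^{i-1}\to\mathcal X$ (possibly randomized), $X_i=f_i(J,Y_1^{i-1},Y_2^{i-1})$ with $J$ uniform on $\{1,\dots,M\}$; decoders $g_k:\mathcal Y^n\to\{1,\dots,M\}$ with $\mathbb P[g_k(Y_k^n)\ne J]\le\epsilon$, $k=1,2$. $M^*_{\mathrm f}(n,\epsilon)$ is the largest $M$ for which an $(n,M,\epsilon)$-FLF code exists. *)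

(* Defs.v *)
From Stdlib Require Import Reals Lra Lia List.
Open Scope R_scope.

(* Alphabets: X = {0,...,N-1}, Y = {0,...,L-1} (0-indexed relabelling of {1..N}).
   Messages: {0,...,M-1}. *)

Definition sumR (n : nat) (f : nat -> R) : R := fold_right Rplus 0 (map f (seq 0 n)).
Definition prodR (n : nat) (f : nat -> R) : R := fold_right Rmult 1 (map f (seq 0 n)).
Definition sumL {A : Type} (l : list A) (f : A -> R) : R :=
  fold_right (fun a acc => f a + acc) 0 l.

Fixpoint words (A n : nat) : list (list nat) :=
  match n with
  | O => nil :: nil
  | S m => flat_map (fun s => map (fun a => s ++ a :: nil) (seq 0 A)) (words A m)
  end.

Definition is_dist (N : nat) (P : nat -> R) : Prop :=
  (forall x, (x < N)%nat -> 0 <= P x) /\ sumR N P = 1.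

(* transition matrix: W y x = W(y|x) *)
Definition is_channel (N L : nat) (W : nat -> nat -> R) : Prop :=
  forall x, (x < N)%nat -> is_dist L (fun y => W y x).

Definition PW (N : nat) (P : nat -> R) (W : nat -> nat -> R) (y : nat) : R :=
  sumR N (fun x => P x * W y x).

(* D(W(.|x) || Q), natural log; terms with W(y|x)=0 vanish since they are multiplied by 0 *)
Definition KL (L : nat) (W : nat -> nat -> R) (x : nat) (Q : nat -> R) : R :=
  sumR L (fun y => W y x * ln (W y x / Q y)).

Definition idens (N : nat) (P : nat -> R) (W : nat -> nat -> R) (x y : nat) : R :=
  ln (W y x / PW N P W y).

Definition MI (N L : nat) (W : nat -> nat -> R) (P : nat -> R) : R :=
  sumR N (fun x => P x * KL L W x (PW N P W)).

Definition Vdisp (N L : nat) (W : nat -> nat -> R) (P : nat -> R) : R :=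
  sumR N (fun x => P x *
    (sumR L (fun y => W y x * (idens N P W x y) ^ 2)
     - (sumR L (fun y => W y x * idens N P W x y)) ^ 2)).

Definition minI (N L : nat) (W1 W2 : nat -> nat -> R) (P : nat -> R) : R :=
  Rmin (MI N L W1 P) (MI N L W2 P).

Definition dI (N L : nat) (W : nat -> nat -> R) (Pstar : nat -> R) (v : nat -> R) : R :=
  sumR N (fun x => v x * KL L W x (PW N Pstar W)).

Definition eta_prop (N L : nat) (W1 W2 : nat -> nat -> R) (Pstar : nat -> R) (eta : R) : Prop :=
  forall v : nat -> R, sumR N v = 0 ->
    eta * dI N L W1 Pstar v + (1 - eta) * dI N L W2 Pstar v = 0.

Definition gauss_pdf (u : R) : R := / sqrt (2 * PI) * exp (- (u ^ 2) / 2).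

(* Q_value t q  <->  Q(t) = integral_t^infty phi = q  (improper Riemann integral) *)
Definition Q_value (t q : R) : Prop :=
  exists pr : (forall m : nat, Riemann_integrable gauss_pdf t (t + INR m)),
    Un_cv (fun m => RiemannInt (pr m)) q.

(* A randomized encoder: enc i j y1 y2 x = P[X_{i+1} = x | J = j, Y1^i = y1, Y2^i = y2]
   (time index i = 0..n-1, prefixes of length i). *)
Definition valid_encoder (N L n M : nat) (enc : nat -> nat -> list nat -> list nat -> nat -> R) : Prop :=
  forall i j y1 y2, (i < n)%nat -> (j < M)%nat ->
    length y1 = i -> length y2 = i ->
    Forall (fun y => (y < L)%nat) y1 -> Forall (fun y => (y < L)%nat) y2 ->
    is_dist N (enc i j y1 y2).

Definition traj_prob (n : nat) (enc : nat -> nat -> list nat -> list nat -> nat -> R)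
  (W1 W2 : nat -> nat -> R) (j : nat) (xs y1 y2 : list nat) : R :=
  prodR n (fun i =>
    enc i j (firstn i y1) (firstn i y2) (nth i xs 0%nat)
    * W1 (nth i y1 0%nat) (nth i xs 0%nat) * W2 (nth i y2 0%nat) (nth i xs 0%nat)).

(* P[g(Y_k^n) <> J] with J uniform on {0,...,M-1}; [pick y1 y2] selects Y_k^n *)
Definition err_prob (N L n M : nat) (W1 W2 : nat -> nat -> R)
  (enc : nat -> nat -> list nat -> list nat -> nat -> R)
  (pick : list nat -> list nat -> list nat) (g : list nat -> nat) : R :=
  / INR M * sumR M (fun j =>
    sumL (words N n) (fun xs =>
    sumL (words L n) (fun y1 =>
    sumL (words L n) (fun y2 =>
      traj_prob n enc W1 W2 j xs y1 y2 * (if Nat.eqb (g (pick y1 y2)) j then 0 else 1))))).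

Definition FLF_code (N L : nat) (W1 W2 : nat -> nat -> R) (n M : nat) (eps : R) : Prop :=
  (1 <= M)%nat /\
  exists (enc : nat -> nat -> list nat -> list nat -> nat -> R) (g1 g2 : list nat -> nat),
    valid_encoder N L n M enc /\
    err_prob N L n M W1 W2 enc (fun a _ => a) g1 <= eps /\
    err_prob N L n M W1 W2 enc (fun _ b => b) g2 <= eps.

(* Main.v *)
Require Import Defs.
From Coquelicot Require Import Coquelicot.
From Stdlib Require Import Reals Lra Lia List ZArith Classical.
Open Scope R_scope.

(** Write [S_k] for the sum of the information densities of channel [k] at the maximiser
    [Pstar]. By the choice of [eta], the increments of [T = eta S_1 + (1 - eta) S_2] have
    conditional mean [C] for every input letter, so no encoder can influence the drift of [T].

    Converse: both decoders are correct with probability at least [1 - 2 eps]. By Chebyshev,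
    [T <= n C + O(sqrt n)] up to a small probability, hence one of the [S_k] is below that level,
    and a change of measure bounds the probability that this decoder is correct.

    Achievability: the first phase uses an i.i.d. [Pstar] codeword. In a second phase of length
    [m ~ n^(2/3) ln n] the input distribution is tilted by at most [n^(-1/6)], which transfers
    information density between the decoders at a cost of only [m n^(-1/3)]. A fair coin (fixed
    per message) selects one decoder, and the tilt, known through feedback, lifts this decoder
    exactly to the threshold. The other decoder then succeeds iff [T] is above the threshold, so
    each decoder fails with half the probability that [T] is low. The law of [T] is controlled by
    a Lindeberg argument with the heat kernel, smoothed at scale [m], and the decoders try all
    of the [n + 1] possible tilts. Codewords are chosen greedily, which handles both error
    probabilities at once. *)

(** * The Gaussian tail *)

(** The exponent 1/3 is a balance. A second phase of length m with tilt s has reach m s, which must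
    cover the first-phase fluctuation, about sqrt n up to logarithms. Its second-order loss of
    information is m s^2, and its own fluctuation, about sqrt m, can no longer be corrected. With m
    s near sqrt n the loss is n / m; it equals sqrt m when m is near n^(2/3), and both are then near
    n^(1/3). A direction that helps one decoder at first order exists because C_1 > C: moving
    towards a better input for channel 1 has positive derivative there, and [eta] forces the
    derivative for channel 2 to be negative. The error must be at most eps exactly, so every
    vanishing probability has to be paid for. Lowering the threshold by a further multiple of
    n^(1/3) ln n moves the normalised Gaussian argument by ln n / n^(1/6) and gains probability of
    that order. This beats all remainders, the largest being the smoothing error 1 / sqrt m, of
    order n^(-1/3); hence a one-sided central limit bound of modest precision is enough. *)

Definition gexp (t : R) : R := exp (- (t ^ 2) / 2).

Lemma exp_mono (x y : R) : x <= y -> exp x <= exp y.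
Proof. intros [H| ->]; [left; apply exp_increasing; exact H|right; reflexivity]. Qed.

Lemma gexp_continuous (t : R) : continuous gexp t.
Proof. apply (ex_derive_continuous gexp). unfold gexp. auto_derive. auto. Qed.

Lemma gexp_ex_RInt (a b : R) : ex_RInt gexp a b.
Proof. apply (ex_RInt_continuous gexp). intros; apply gexp_continuous. Qed.

Definition gint (x : R) : R := RInt gexp 0 x.

Lemma gint_derive (x : R) : is_derive gint x (gexp x).
Proof.
  apply (is_derive_RInt gexp gint 0 x).
  - exists (mkposreal 1 Rlt_0_1). intros y _. apply (RInt_correct gexp 0 y), gexp_ex_RInt.
  - apply gexp_continuous.
Qed.

(** The auxiliary integrand that evaluates the Gaussian integral without polar coordinates: its
    integral over [0,1] has derivative opposite to that of [gint x ^ 2], equals PI / 2 at x = 0 and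
    vanishes as x grows. *)
Definition gpolar (x t : R) : R := 2 * exp (- (x ^ 2 * (1 + t ^ 2)) / 2) / (1 + t ^ 2).

Lemma gpolar_derive (x t : R) :
  is_derive (fun x => gpolar x t) x (- (2 * x * exp (- (x ^ 2 * (1 + t ^ 2)) / 2))).
Proof.
  unfold gpolar. assert (0 < 1 + t ^ 2) by nra.
  auto_derive; [lra|]. simpl; unfold Rdiv; field. simpl in *; lra.
Qed.

Lemma gpolar_continuous (x t : R) : continuous (gpolar x) t.
Proof.
  apply (ex_derive_continuous (gpolar x)). unfold gpolar.
  assert (0 < 1 + t ^ 2) by nra. auto_derive. simpl in *; lra.
Qed.

Lemma gpolar_ex_RInt (x : R) : ex_RInt (gpolar x) 0 1.
Proof. apply (ex_RInt_continuous (gpolar x)). intros; apply gpolar_continuous. Qed.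

Lemma gpolar_int_derive (x : R) :
  is_derive (fun x => RInt (gpolar x) 0 1) x (- (2 * gexp x * gint x)).
Proof.
  assert (HD : forall u t, Derive (fun z => gpolar z t) u
             = - (2 * u * exp (- (u ^ 2 * (1 + t ^ 2)) / 2))).
  { intros; apply is_derive_unique, gpolar_derive. }
  replace (- (2 * gexp x * gint x))
    with (RInt (fun t => Derive (fun u => gpolar u t) x) 0 1).
  - apply (is_derive_RInt_param gpolar 0 1 x).
    + exists (mkposreal 1 Rlt_0_1). intros y _ t _. eexists; apply gpolar_derive.
    + intros t _.
      apply continuity_2d_pt_ext with
        (fun u v => - (2 * u * exp (- (u ^ 2 * (1 + v ^ 2)) / 2))).
      { intros; symmetry; apply HD. }
      apply continuity_2d_pt_opp, continuity_2d_pt_mult.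
      * apply continuity_2d_pt_mult; [apply continuity_2d_pt_const|apply continuity_2d_pt_id1].
      * apply (continuity_1d_2d_pt_comp exp).
        { apply derivable_continuous_pt, derivable_pt_exp. }
        unfold Rdiv. simpl.
        repeat first [apply continuity_2d_pt_mult | apply continuity_2d_pt_opp
          | apply continuity_2d_pt_plus | apply continuity_2d_pt_const
          | apply continuity_2d_pt_id1 | apply continuity_2d_pt_id2].
    + exists (mkposreal 1 Rlt_0_1). intros y _. apply gpolar_ex_RInt.
  - apply is_RInt_unique.
    (* The exponent splits into x^2 and (x t)^2: the factor [gexp x] leaves the integral and the
       substitution u = x t turns the rest into [gint x]. The summand 0 only fits the form of the
       linear substitution rule. *)
    apply (is_RInt_ext (fun t => scal (- (2 * gexp x)) (scal x (gexp (x * t + 0))))).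
    { intros t _. rewrite HD. unfold scal, mult, gexp. cbn -[pow].
      replace (- (x ^ 2 * (1 + t ^ 2)) / 2)
        with (- x ^ 2 / 2 + - (x * t + 0) ^ 2 / 2) by field.
      rewrite exp_plus. ring. }
    replace (- (2 * gexp x * gint x)) with (scal (- (2 * gexp x)) (gint x))
      by (change (- (2 * gexp x) * gint x = - (2 * gexp x * gint x)); ring).
    apply (is_RInt_scal (fun t => scal x (gexp (x * t + 0)))).
    apply (is_RInt_comp_lin gexp x 0 0 1).
    replace (x * 0 + 0) with 0 by ring. replace (x * 1 + 0) with x by ring.
    apply (RInt_correct gexp 0 x), gexp_ex_RInt.
Qed.

Lemma atan_int : RInt (gpolar 0) 0 1 = PI / 2.
Proof.
  apply is_RInt_unique.
  replace (PI / 2) with (minus (2 * atan 1) (2 * atan 0)).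
  - apply (is_RInt_derive (fun t => 2 * atan t) (gpolar 0)).
    + intros t _. unfold gpolar. assert (0 < 1 + t ^ 2) by nra.
      apply is_derive_Reals.
      replace (2 * exp (- (0 ^ 2 * (1 + t ^ 2)) / 2) / (1 + t ^ 2)) with (2 * (/ (1 + t ^ 2))).
      * apply derivable_pt_lim_scal.
        apply derivable_pt_lim_atan.
      * replace (- (0 ^ 2 * (1 + t ^ 2)) / 2) with 0 by field.
        rewrite exp_0. field. simpl in *; lra.
    + intros t _. apply gpolar_continuous.
  - unfold minus, plus, opp; simpl. rewrite atan_0, atan_1. field.
Qed.

Lemma gint_sqr (x : R) : gint x ^ 2 + RInt (gpolar x) 0 1 = PI / 2.
Proof.
  set (f := fun x => gint x ^ 2 + RInt (gpolar x) 0 1).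
  assert (Hd : forall y, is_derive f y 0).
  { intros y. unfold f.
    assert (H : is_derive f y (plus (INR 2 * gexp y * gint y ^ 1) (- (2 * gexp y * gint y)))).
    - apply (is_derive_plus (fun x => gint x ^ 2) (fun x => RInt (gpolar x) 0 1)).
      + apply (is_derive_pow gint 2 y), gint_derive.
      + apply gpolar_int_derive.
    - replace (plus (INR 2 * gexp y * gint y ^ 1) (- (2 * gexp y * gint y))) with 0 in H.
      + exact H.
      + unfold plus; simpl. ring. }
  assert (Hf0 : f 0 = PI / 2).
  { unfold f. rewrite atan_int. unfold gint. rewrite RInt_point. unfold zero; simpl; ring. }
  fold (f x). rewrite <- Hf0.
  destruct (MVT_gen f 0 x (fun _ => 0)) as [c [_ Hc]].
  - intros; apply Hd.
  - intros y _. apply continuity_pt_filterlim, (ex_derive_continuous f). eexists; apply Hd.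
  - lra.
Qed.

Lemma gpolar_int_bounds (x : R) : 0 <= RInt (gpolar x) 0 1 <= 2 * gexp x.
Proof.
  assert (H : forall t, 0 <= gpolar x t <= 2 * gexp x).
  { intros t. unfold gpolar, gexp. assert (0 < 1 + t ^ 2) by nra.
    assert (Hi : 0 < / (1 + t ^ 2) <= 1).
    { split; [apply Rinv_0_lt_compat; lra|].
      rewrite <- Rinv_1. apply Rinv_le_contravar; nra. }
    assert (0 < exp (- (x ^ 2 * (1 + t ^ 2)) / 2) <= exp (- x ^ 2 / 2)).
    { split; [apply exp_pos|]. apply exp_mono. nra. }
    unfold Rdiv at 1 4. split; [nra|].
    apply Rle_trans with (2 * exp (- (x ^ 2 * (1 + t ^ 2)) / 2) * 1); [|lra].
    apply Rmult_le_compat_l; lra. }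
  split.
  - apply RInt_ge_0; [lra|apply gpolar_ex_RInt|intros; apply H].
  - replace (2 * gexp x) with (RInt (fun _ => 2 * gexp x) 0 1).
    + apply RInt_le; [lra|apply gpolar_ex_RInt|apply ex_RInt_const|intros; apply H].
    + rewrite RInt_const. unfold scal; simpl; unfold mult; simpl. ring.
Qed.

Lemma gint_nonneg (x : R) : 0 <= x -> 0 <= gint x.
Proof.
  intros. apply RInt_ge_0; [lra|apply gexp_ex_RInt|].
  intros; left; apply exp_pos.
Qed.

Lemma sqrt_two_PI_pos : 0 < sqrt (2 * PI).
Proof. apply sqrt_lt_R0. pose proof PI_RGT_0; lra. Qed.

(** The Gaussian mass of the half line minus the mass between 0 and x, so no improper integral
    occurs. That 1/2 is the right constant follows from the decay in [Qtail_bounds];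
    [Qtail_of_Q_value] makes the link with [Q_value]. *)
Definition Qtail (x : R) : R := / 2 - gint x / sqrt (2 * PI).

Lemma gauss_pdf_gexp (x : R) : gauss_pdf x = gexp x / sqrt (2 * PI).
Proof. unfold gauss_pdf, gexp, Rdiv. ring. Qed.

Lemma Qtail_derive (x : R) : is_derive Qtail x (- gauss_pdf x).
Proof.
  rewrite gauss_pdf_gexp. unfold Qtail. pose proof (gint_derive x) as H.
  pose proof sqrt_two_PI_pos.
  auto_derive; [eexists; exact H|].
  rewrite (is_derive_unique (fun x0 : R => gint x0) _ _ H). field. lra.
Qed.

Lemma gauss_pdf_pos (x : R) : 0 < gauss_pdf x.
Proof.
  unfold gauss_pdf. apply Rmult_lt_0_compat; [|apply exp_pos].
  apply Rinv_0_lt_compat, sqrt_two_PI_pos.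
Qed.

Lemma exp_neg_le_inv (x : R) : 0 <= x -> exp (- x) <= / (1 + x).
Proof.
  intros. rewrite exp_Ropp. apply Rinv_le_contravar; [lra|apply exp_ineq1_le].
Qed.

(* The identity [gint_sqr] localises [Qtail x] between 0 and a multiple of [gexp x]. *)
Lemma Qtail_bounds (x : R) : 0 <= x -> 0 <= Qtail x <= gexp x.
Proof.
  intros Hx. pose proof (gint_sqr x) as H. pose proof (gpolar_int_bounds x) as [H1 H2].
  pose proof (gint_nonneg x Hx) as H3. pose proof sqrt_two_PI_pos as H4.
  assert (H5 : sqrt (2 * PI) ^ 2 = 2 * PI).
  { rewrite pow2_sqrt; [reflexivity|]. pose proof PI_RGT_0; lra. }
  set (r := sqrt (2 * PI)) in *. set (g := gint x) in *.
  assert (Hg : 4 * g ^ 2 <= r ^ 2) by nra.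
  assert (Hg2 : 2 * g <= r) by nra.
  assert (H6 : (r - 2 * g) * r <= 8 * gexp x).
  { apply Rle_trans with ((r - 2 * g) * (r + 2 * g)); [|nra].
    apply Rmult_le_compat_l; lra. }
  unfold Qtail. fold r g.
  replace (/ 2 - g / r) with ((r - 2 * g) / (2 * r)) by (field; lra).
  split; [apply Rdiv_le_0_compat; lra|].
  assert (Hr : 4 <= r ^ 2) by (pose proof PI2_3_2; unfold PI2 in *; lra).
  apply Rle_div_l; [lra|].
  apply Rmult_le_reg_r with r; [lra|].
  pose proof (exp_pos (- x ^ 2 / 2)) as He. fold (gexp x) in He. nra.
Qed.

Lemma gint_odd (x : R) : gint (- x) = - gint x.
Proof.
  unfold gint. apply is_RInt_unique.
  apply (is_RInt_ext (fun t => opp (opp (gexp (- t))))).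
  { intros t _. unfold opp; simpl. rewrite Ropp_involutive.
    unfold gexp. f_equal. field. }
  apply (is_RInt_opp (fun t => opp (gexp (- t)))).
  apply (is_RInt_comp_opp gexp). rewrite Ropp_0, Ropp_involutive.
  apply (RInt_correct gexp 0 x), gexp_ex_RInt.
Qed.

Lemma Qtail_opp (x : R) : Qtail (- x) = 1 - Qtail x.
Proof. unfold Qtail. rewrite gint_odd. pose proof sqrt_two_PI_pos. field. lra. Qed.

Lemma Qtail_nonneg (x : R) : 0 <= Qtail x.
Proof.
  destruct (Rle_or_lt 0 x) as [H|H]; [apply Qtail_bounds; exact H|].
  replace x with (- (- x)) by ring. rewrite Qtail_opp.
  assert (Hg : Qtail (- x) <= gexp (- x)) by (apply Qtail_bounds; lra).
  assert (gexp (- x) <= 1).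
  { unfold gexp. rewrite <- exp_0. apply exp_mono. nra. }
  lra.
Qed.

Lemma Qtail_of_Q_value (z q : R) : Q_value z q -> Qtail z = q.
Proof.
  intros [pr Hcv].
  assert (Hint : forall m, RiemannInt (pr m) = Qtail z - Qtail (z + INR m)).
  { intros m. rewrite <- RInt_Reals. apply is_RInt_unique.
    replace (Qtail z - Qtail (z + INR m))
      with (minus (- Qtail (z + INR m)) (- Qtail z)) by (unfold minus, plus, opp; simpl; ring).
    apply (is_RInt_derive (fun t => - Qtail t) gauss_pdf).
    - intros x _. pose proof (is_derive_opp Qtail x _ (Qtail_derive x)) as H.
      replace (gauss_pdf x) with (opp (- gauss_pdf x)) by (unfold opp; simpl; ring).
      exact H.
    - intros x _. apply (continuous_ext (fun x => / sqrt (2 * PI) * gexp x)).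
      { reflexivity. }
      apply (continuous_scal_r (/ sqrt (2 * PI)) gexp), gexp_continuous. }
  apply (UL_sequence (fun m => RiemannInt (pr m))); [|exact Hcv].
  intros e He.
  destruct (archimed (2 / e + Rabs z)) as [Hup _].
  (* From this index on x = z + m is at least 2 / e, and then [gexp x] is at most 1 / (1 + x^2 / 2),
     which is below 2 / x and hence below e. *)
  set (k := Z.to_nat (up (2 / e + Rabs z))).
  assert (Hpos : 0 < 2 / e) by (apply Rdiv_lt_0_compat; lra).
  assert (Hk : 2 / e + Rabs z <= INR k).
  { unfold k. rewrite INR_IZR_INZ, Z2Nat.id; [lra|].
    apply le_IZR. pose proof (Rabs_pos z). simpl. lra. }
  exists k. intros m Hm. unfold Rdist. rewrite Hint.
  assert (Hkm : INR k <= INR m) by (apply le_INR; lia).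
  assert (Habs : - z <= Rabs z) by (rewrite <- Rabs_Ropp; apply Rle_abs).
  assert (Hzm : 2 / e <= z + INR m) by lra.
  assert (H : 0 <= Qtail (z + INR m) <= gexp (z + INR m)) by (apply Qtail_bounds; lra).
  assert (Hg : gexp (z + INR m) < e).
  { set (x := z + INR m) in *. unfold gexp.
    replace (- x ^ 2 / 2) with (- (x ^ 2 / 2)) by field.
    apply Rle_lt_trans with (/ (1 + x ^ 2 / 2)); [apply exp_neg_le_inv; nra|].
    apply Rlt_le_trans with (/ (x / 2)).
    - apply Rinv_lt_contravar; nra.
    - rewrite <- (Rinv_inv e). apply Rinv_le_contravar; [apply Rinv_0_lt_compat; lra|].
      unfold Rdiv in Hzm. lra. }
  rewrite Rabs_left1; lra.
Qed.

Lemma gauss_pdf_antitone (x y : R) : Rabs x <= Rabs y -> gauss_pdf y <= gauss_pdf x.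
Proof.
  intros H. unfold gauss_pdf. apply Rmult_le_compat_l.
  - left; apply Rinv_0_lt_compat, sqrt_two_PI_pos.
  - apply exp_mono. pose proof (Rsqr_le_abs_1 x y H) as H1.
    unfold Rsqr in H1. simpl. lra.
Qed.

Lemma MVT_derive (f f' : R -> R) (a b : R) : (forall x, is_derive f x (f' x)) ->
  exists c, Rmin a b <= c <= Rmax a b /\ f b - f a = f' c * (b - a).
Proof.
  intros H. destruct (MVT_gen f a b f') as [c Hc].
  - intros; apply H.
  - intros y _. apply continuity_pt_filterlim, (ex_derive_continuous f). eexists; apply H.
  - exists c. exact Hc.
Qed.

(** The gain that pays for all error terms of the achievability: on [z, z + 1] the density is at
    least its value at |z| + 1, so the tail drops linearly in d. *)
Lemma Qtail_decrease (z d : R) : 0 <= d <= 1 ->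
  Qtail (z + d) <= Qtail z - d * gauss_pdf (Rabs z + 1).
Proof.
  intros Hd. destruct (MVT_derive Qtail _ z (z + d) Qtail_derive) as [c [Hc He]].
  rewrite Rmin_left, Rmax_right in Hc by lra.
  assert (gauss_pdf (Rabs z + 1) <= gauss_pdf c).
  { apply gauss_pdf_antitone. pose proof (Rabs_pos z).
    rewrite (Rabs_pos_eq (Rabs z + 1)) by lra.
    unfold Rabs; repeat destruct Rcase_abs; lra. }
  nra.
Qed.

(** * Taylor bounds for the heat kernel *)

Lemma gauss_pdf_derive (x : R) : is_derive gauss_pdf x (- x * gauss_pdf x).
Proof.
  pose proof sqrt_two_PI_pos. unfold gauss_pdf. auto_derive; [auto|]. simpl; unfold Rdiv; field. lra.
Qed.

(** Two factors exp(-u^2/4), each at most 1 / (1 + u^2/4), and sqrt (2 PI) >= 2. The quartic decay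
    dominates the cubic polynomials that occur in the derivatives of [heat]. *)
Lemma gauss_pdf_le (u : R) : gauss_pdf u <= / 2 * / (1 + u ^ 2 / 4) ^ 2.
Proof.
  unfold gauss_pdf. pose proof sqrt_two_PI_pos.
  apply Rmult_le_compat; [left; apply Rinv_0_lt_compat; lra|left; apply exp_pos| |].
  - apply Rinv_le_contravar; [lra|]. pose proof PI2_3_2. unfold PI2 in *.
    apply Rle_trans with (sqrt (2 ^ 2)); [rewrite sqrt_pow2; lra|apply sqrt_le_1_alt; lra].
  - replace (- u ^ 2 / 2) with (- (u ^ 2 / 4) + - (u ^ 2 / 4)) by field.
    assert (Hw : 0 <= u ^ 2 / 4) by (pose proof (pow2_ge_0 u); lra).
    rewrite exp_plus, <- pow_inv. pose proof (exp_neg_le_inv (u ^ 2 / 4) Hw) as H1.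
    pose proof (exp_pos (- (u ^ 2 / 4))).
    set (a := / (1 + u ^ 2 / 4)) in *. replace (a ^ 2) with (a * a) by ring.
    apply Rmult_le_compat; lra.
Qed.

Lemma gauss_pdf_poly2 (u : R) : Rabs ((1 - u ^ 2) * gauss_pdf u) <= 1.
Proof.
  pose proof (gauss_pdf_pos u) as H0. pose proof (gauss_pdf_le u) as H1.
  assert (H2 : 0 < (1 + u ^ 2 / 4) ^ 2) by nra.
  assert (H3 : gauss_pdf u * (1 + u ^ 2 / 4) ^ 2 <= / 2).
  { apply Rmult_le_compat_r with (r := (1 + u ^ 2 / 4) ^ 2) in H1; [|lra].
    rewrite Rmult_assoc, Rinv_l in H1; lra. }
  set (p := gauss_pdf u) in *. set (w := u ^ 2) in *.
  assert (0 <= w) by (unfold w; nra).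
  apply Rabs_le. split; nra.
Qed.

Lemma gauss_pdf_poly3 (u : R) : Rabs ((u ^ 3 - 3 * u) * gauss_pdf u) <= 8.
Proof.
  pose proof (gauss_pdf_pos u) as H0. pose proof (gauss_pdf_le u) as H1.
  assert (H2 : 0 < (1 + u ^ 2 / 4) ^ 2) by nra.
  assert (H3 : gauss_pdf u * (1 + u ^ 2 / 4) ^ 2 <= / 2).
  { apply Rmult_le_compat_r with (r := (1 + u ^ 2 / 4) ^ 2) in H1; [|lra].
    rewrite Rmult_assoc, Rinv_l in H1; lra. }
  set (p := gauss_pdf u) in *.
  assert (Ha : Rabs (u ^ 3 - 3 * u) <= 16 * (1 + u ^ 2 / 4) ^ 2).
  { replace (u ^ 3 - 3 * u) with (u * (u ^ 2 - 3)) by ring. rewrite Rabs_mult.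
    assert (Rabs (u ^ 2 - 3) <= u ^ 2 + 3) by (apply Rabs_le; nra).
    rewrite <- (pow2_abs u) in *. set (a := Rabs u) in *.
    assert (0 <= a) by apply Rabs_pos.
    apply Rle_trans with (a * (a ^ 2 + 3)); [apply Rmult_le_compat_l; lra|].
    pose proof (pow2_ge_0 (a - 1)). pose proof (pow2_ge_0 (a * (a - 1))). nra. }
  rewrite Rabs_mult, (Rabs_pos_eq p) by lra. nra.
Qed.

(** Three nested mean value steps, which give K instead of K / 6; only the cubic order of the
    remainder matters. *)
Lemma taylor3 (f f1 f2 f3 : R -> R) (K y h : R) :
  (forall x, is_derive f x (f1 x)) -> (forall x, is_derive f1 x (f2 x)) ->
  (forall x, is_derive f2 x (f3 x)) -> (forall x, Rabs (f3 x) <= K) ->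
  f (y + h) <= f y + h * f1 y + h ^ 2 / 2 * f2 y + K * Rabs h ^ 3.
Proof.
  intros D0 D1 D2 HK.
  set (g := fun t => f (y + t) - f y - t * f1 y - t ^ 2 / 2 * f2 y).
  assert (Dg : forall t, is_derive g t (f1 (y + t) - f1 y - t * f2 y)).
  { intros t. unfold g. auto_derive; [eexists; apply D0|].
    rewrite (is_derive_unique (fun x : R => f x) _ _ (D0 (y + t))). field. }
  destruct (MVT_derive g _ 0 h Dg) as [c [Hc Ec]].
  destruct (MVT_derive f1 f2 y (y + c) D1) as [d [Hd Ed]].
  destruct (MVT_derive f2 f3 y d D2) as [e [_ Ee]].
  assert (Hc' : Rabs c <= Rabs h).
  { unfold Rmin, Rmax in Hc. repeat destruct Rle_dec; unfold Rabs; repeat destruct Rcase_abs; lra. }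
  assert (Hd' : Rabs (d - y) <= Rabs h).
  { unfold Rmin, Rmax in Hd. repeat destruct Rle_dec;
      revert Hc'; unfold Rabs; repeat destruct Rcase_abs; lra. }
  assert (E : g h = f3 e * (d - y) * c * h).
  { replace (g h) with (g h - g 0).
    - rewrite Ec. replace (f1 (y + c) - f1 y) with (f2 d * (y + c - y)) by lra.
      replace (f2 d) with (f2 y + f3 e * (d - y)) by lra. ring.
    - unfold g. rewrite Rplus_0_r. field. }
  assert (Hg : g h <= K * Rabs h ^ 3).
  { rewrite E. apply Rle_trans with (1 := Rle_abs _). rewrite !Rabs_mult.
    replace (K * Rabs h ^ 3) with (K * Rabs h * Rabs h * Rabs h) by ring.
    pose proof (Rabs_pos h).
    repeat (apply Rmult_le_compat; auto using Rabs_pos, Rmult_le_pos, Rle_refl). }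
  unfold g in Hg. lra.
Qed.

(** The hypotheses are restricted to the interval because the function it serves, [heat] in the time
    variable, is smooth only for positive times. *)
Lemma taylor2_lower (f f1 f2 : R -> R) (K y h : R) : 0 <= h ->
  (forall x, y <= x <= y + h -> is_derive f x (f1 x)) ->
  (forall x, y <= x <= y + h -> is_derive f1 x (f2 x)) ->
  (forall x, y <= x <= y + h -> Rabs (f2 x) <= K) ->
  f y + h * f1 y - K * h ^ 2 <= f (y + h).
Proof.
  intros Hh D0 D1 HK.
  assert (M : forall g g' a b, y <= a -> a <= b -> b <= y + h ->
    (forall x, y <= x <= y + h -> is_derive g x (g' x)) ->
    exists c, a <= c <= b /\ g b - g a = g' c * (b - a)).
  { intros g g' a b Ha Hab Hb D. destruct (MVT_gen g a b g') as [c [Hc Ec]].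
    - rewrite Rmin_left, Rmax_right by lra. intros; apply D; lra.
    - rewrite Rmin_left, Rmax_right by lra. intros x Hx.
      apply continuity_pt_filterlim, (ex_derive_continuous g). eexists; apply D; lra.
    - rewrite Rmin_left, Rmax_right in Hc by lra. exists c; auto. }
  destruct (M f f1 y (y + h)) as [c [Hc Ec]]; try lra; auto.
  destruct (M f1 f2 y c) as [d [Hd Ed]]; try lra; auto.
  pose proof (HK d ltac:(lra)) as Hk. apply Rabs_le_between in Hk.
  assert (0 <= (K + f2 d) * ((c - y) * h)) by (apply Rmult_le_pos; [lra|nra]).
  assert (K * ((c - y) * h) <= K * (h * h)).
  { apply Rmult_le_compat_l; [|apply Rmult_le_compat_r; lra].
    apply Rle_trans with (1 := Rabs_pos (f2 d)). apply HK; lra. }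
  nra.
Qed.

(* [heat t y] solves the heat equation with a step at the origin as initial datum. *)
Definition heat (t y : R) : R := Qtail (y / sqrt t).

Lemma heat_space (t y B h : R) : 0 < t -> Rabs h <= B ->
  heat t (y + h) <= heat t y + h * (- gauss_pdf (y / sqrt t) / sqrt t)
    + h ^ 2 / 2 * (y / sqrt t * gauss_pdf (y / sqrt t) / t) + B ^ 3 / (t * sqrt t).
Proof.
  intros Ht Hh. assert (Hs : 0 < sqrt t) by (apply sqrt_lt_R0; lra).
  assert (Hss : sqrt t * sqrt t = t) by (apply sqrt_sqrt; lra).
  set (s := sqrt t) in *. unfold heat. fold s.
  apply Rle_trans with (Qtail (y / s) + h * (- gauss_pdf (y / s) / s)
    + h ^ 2 / 2 * (y / s * gauss_pdf (y / s) / t) + / (t * s) * Rabs h ^ 3).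
  - apply (taylor3 (fun y => Qtail (y / s)) (fun y => - gauss_pdf (y / s) / s)
      (fun y => y / s * gauss_pdf (y / s) / t)
      (fun y => (1 - (y / s) ^ 2) * gauss_pdf (y / s) / (t * s))).
    + intros x. auto_derive; [eexists; apply Qtail_derive|]. unfold Rdiv.
      rewrite (is_derive_unique (fun x : R => Qtail x) _ _ (Qtail_derive (x * / s))). field. lra.
    + intros x. auto_derive; [eexists; apply gauss_pdf_derive|]. unfold Rdiv.
      rewrite (is_derive_unique (fun x : R => gauss_pdf x) _ _ (gauss_pdf_derive (x * / s))).
      rewrite <- Hss. field. lra.
    + intros x. auto_derive; [eexists; apply gauss_pdf_derive|]. unfold Rdiv.
      rewrite (is_derive_unique (fun x : R => gauss_pdf x) _ _ (gauss_pdf_derive (x * / s))).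
      rewrite <- Hss. field. lra.
    + intros x. unfold Rdiv at 1. rewrite Rabs_mult.
      assert (0 < / (t * s)) by (apply Rinv_0_lt_compat; nra).
      rewrite (Rabs_pos_eq (/ (t * s))) by lra.
      pose proof (gauss_pdf_poly2 (x / s)). nra.
  - apply Rplus_le_compat_l. unfold Rdiv. rewrite Rmult_comm.
    apply Rmult_le_compat_r; [left; apply Rinv_0_lt_compat; nra|].
    apply pow_incr. split; [apply Rabs_pos|lra].
Qed.

(** The heat equation at work: the time derivative is half the second space derivative in
    [heat_space], so advancing the time by V cancels the second-order term of a step with variance
    V. *)
Lemma heat_time (t y V : R) : 0 < t -> 0 <= V ->
  heat t y + V * (y / sqrt t * gauss_pdf (y / sqrt t) / (2 * t)) - 2 * V ^ 2 / t ^ 2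
    <= heat (t + V) y.
Proof.
  intros Ht HV.
  pose proof (taylor2_lower (fun t => heat t y)
    (fun t => y / sqrt t * gauss_pdf (y / sqrt t) / (2 * t))
    (fun t => ((y / sqrt t) ^ 3 - 3 * (y / sqrt t)) * gauss_pdf (y / sqrt t) / (4 * t ^ 2))
    (2 / t ^ 2) t V HV) as H.
  replace (2 * V ^ 2 / t ^ 2) with (2 / t ^ 2 * V ^ 2) by (field; lra).
  apply H; clear H; intros x Hx;
    assert (Hs : 0 < sqrt x) by (apply sqrt_lt_R0; lra);
    assert (Hss : sqrt x * sqrt x = x) by (apply sqrt_sqrt; lra).
  - unfold heat. auto_derive.
    + repeat split; try lra; try (apply Rgt_not_eq; lra). eexists; apply Qtail_derive.
    + unfold Rdiv. rewrite (is_derive_unique (fun x : R => Qtail x) _ _ (Qtail_derive (y * / sqrt x))).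
      set (s := sqrt x) in *. rewrite <- Hss. field. lra.
  - auto_derive.
    + repeat split; try lra; try (apply Rgt_not_eq; lra). eexists; apply gauss_pdf_derive.
    + rewrite (is_derive_unique (fun x : R => gauss_pdf x) _ _ (gauss_pdf_derive (y * / sqrt x))).
      unfold Rdiv. set (s := sqrt x) in *. rewrite <- Hss. field. lra.
  - match goal with |- Rabs (?a / ?b) <= _ => change (Rabs (a * / b) <= 2 / t ^ 2) end.
    rewrite Rabs_mult.
    assert (Hi : 0 < / (4 * x ^ 2)) by (apply Rinv_0_lt_compat; nra).
    rewrite (Rabs_pos_eq (/ (4 * x ^ 2))) by lra.
    pose proof (gauss_pdf_poly3 (y / sqrt x)) as Hp.
    apply Rle_trans with (8 * / (4 * x ^ 2)); [apply Rmult_le_compat_r; lra|].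
    replace (8 * / (4 * x ^ 2)) with (2 * / x ^ 2) by (field; lra).
    apply Rmult_le_compat_l; [lra|]. apply Rinv_le_contravar; [nra|].
    apply pow_incr; lra.
Qed.

(** The Taylor remainders of one step are of order t^(-3/2). Bounding them by increments of 1 / sqrt
    t makes their sum over any number of steps telescope to order 1 / sqrt rho, with rho the
    starting time. *)
Lemma inv_sqrt_telescope (t V : R) : 0 < V -> V <= t ->
  V / (4 * (t * sqrt t)) <= / sqrt t - / sqrt (t + V).
Proof.
  intros HV Ht. assert (Hs : 0 < sqrt t) by (apply sqrt_lt_R0; lra).
  assert (Hs' : 0 < sqrt (t + V)) by (apply sqrt_lt_R0; lra).
  assert (E : sqrt t * sqrt t = t) by (apply sqrt_sqrt; lra).
  assert (E' : sqrt (t + V) * sqrt (t + V) = t + V) by (apply sqrt_sqrt; lra).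
  set (a := sqrt t) in *. set (b := sqrt (t + V)) in *.
  (* V <= t gives b^2 <= 2 a^2. Then a b (a + b) is at most (15/4) a^3, which explains the constant
     4. *)
  assert (Hab : a <= b <= 3 / 2 * a) by nra.
  replace (/ a - / b) with (V / (a * b * (a + b))).
  - apply Rmult_le_compat_l; [lra|]. apply Rinv_le_contravar; [|rewrite <- E].
    + apply Rmult_lt_0_compat; nra.
    + assert (a * b * (a + b) <= a * (3 / 2 * a) * (a + 3 / 2 * a)); [|nra].
      apply Rmult_le_compat; nra.
  - replace V with (b * b - a * a) by lra. field. nra.
Qed.

(* [a] is the first and [b] half the second space derivative of [heat]; the term [kappa / sqrt t] absorbs the
   Taylor remainders, so that [heat t y - kappa / sqrt t] decreases on average along a centred
   random walk with step variance [V]. *)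
Lemma heat_one_step (t V B y : R) : 1 <= t -> 0 < V -> V <= t -> 0 <= B ->
  let kappa := 4 * (B ^ 3 + 2 * V ^ 2) / V in
  exists a b, forall h, Rabs h <= B ->
    heat t (y + h) - kappa / sqrt t
      <= heat (t + V) y - kappa / sqrt (t + V) + h * a + (h ^ 2 - V) * b.
Proof.
  intros Ht HV HVt HB kappa.
  exists (- gauss_pdf (y / sqrt t) / sqrt t), (y / sqrt t * gauss_pdf (y / sqrt t) / (2 * t)).
  intros h Hh. pose proof (heat_space t y B h ltac:(lra) Hh) as H1.
  pose proof (heat_time t y V ltac:(lra) ltac:(lra)) as H2.
  pose proof (inv_sqrt_telescope t V HV HVt) as H3.
  assert (Hs : 1 <= sqrt t) by (rewrite <- sqrt_1; apply sqrt_le_1_alt; lra).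
  assert (Hss : sqrt t * sqrt t = t) by (apply sqrt_sqrt; lra).
  set (u := y / sqrt t * gauss_pdf (y / sqrt t)) in *.
  replace (h ^ 2 / 2 * (u / t)) with (h ^ 2 * (u / (2 * t))) in H1 by (field; lra).
  assert (H4 : 2 * V ^ 2 / t ^ 2 <= 2 * V ^ 2 / (t * sqrt t)).
  { apply Rmult_le_compat_l; [nra|]. apply Rinv_le_contravar; nra. }
  assert (H5 : B ^ 3 / (t * sqrt t) + 2 * V ^ 2 / (t * sqrt t)
            <= kappa / sqrt t - kappa / sqrt (t + V)).
  { assert (0 <= B ^ 3) by (apply pow_le; lra).
    assert (Hk : 0 <= kappa) by (unfold kappa; apply Rdiv_le_0_compat; [nra|lra]).
    apply Rmult_le_compat_l with (r := kappa) in H3; [|exact Hk].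
    replace (kappa * (V / (4 * (t * sqrt t))))
      with (B ^ 3 / (t * sqrt t) + 2 * V ^ 2 / (t * sqrt t)) in H3.
    - unfold Rdiv at 3 4. lra.
    - unfold kappa. field. nra. }
  lra.
Qed.

(** * Sums and expectation functionals *)

Lemma fold_right_Rplus_app (l1 l2 : list R) :
  fold_right Rplus 0 (l1 ++ l2) = fold_right Rplus 0 l1 + fold_right Rplus 0 l2.
Proof. induction l1 as [|a l1 IH]; simpl; [ring|rewrite IH; ring]. Qed.

Lemma sumR_S (n : nat) (f : nat -> R) : sumR (S n) f = sumR n f + f n.
Proof.
  unfold sumR. rewrite seq_S, map_app, fold_right_Rplus_app. simpl. ring.
Qed.

Lemma prodR_S (n : nat) (f : nat -> R) : prodR (S n) f = prodR n f * f n.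
Proof.
  unfold prodR. rewrite seq_S, map_app. simpl.
  induction (map f (seq 0 n)) as [|a l IH]; simpl; [ring|rewrite IH; ring].
Qed.

Lemma sumR_le (n : nat) (f g : nat -> R) :
  (forall i, (i < n)%nat -> f i <= g i) -> sumR n f <= sumR n g.
Proof.
  induction n as [|n IH]; intros H; [apply Rle_refl|]. rewrite !sumR_S.
  apply Rplus_le_compat; [apply IH; intros; apply H; lia|apply H; lia].
Qed.

Lemma sumR_ext (n : nat) (f g : nat -> R) :
  (forall i, (i < n)%nat -> f i = g i) -> sumR n f = sumR n g.
Proof.
  intros H; apply Rle_antisym; apply sumR_le; intros; right; [|symmetry]; apply H; auto.
Qed.

Lemma sumR_plus (n : nat) (f g : nat -> R) :
  sumR n (fun i => f i + g i) = sumR n f + sumR n g.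
Proof. induction n as [|n IH]; [unfold sumR; simpl; ring|]. rewrite !sumR_S, IH. ring. Qed.

Lemma sumR_scal (n : nat) (c : R) (f : nat -> R) : sumR n (fun i => c * f i) = c * sumR n f.
Proof. induction n as [|n IH]; [unfold sumR; simpl; ring|]. rewrite !sumR_S, IH. ring. Qed.

Lemma sumR_minus (n : nat) (f g : nat -> R) :
  sumR n (fun i => f i - g i) = sumR n f - sumR n g.
Proof. induction n as [|n IH]; [unfold sumR; simpl; ring|]. rewrite !sumR_S, IH. ring. Qed.

Lemma sumR_const (n : nat) (c : R) : sumR n (fun _ => c) = INR n * c.
Proof.
  induction n as [|n IH]; [unfold sumR; simpl; ring|]. rewrite sumR_S, IH, S_INR. ring.
Qed.

Lemma sumR_nonneg (n : nat) (f : nat -> R) :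
  (forall i, (i < n)%nat -> 0 <= f i) -> 0 <= sumR n f.
Proof.
  intros H. replace 0 with (sumR n (fun _ => 0)) by (rewrite sumR_const; ring).
  apply sumR_le, H.
Qed.

Lemma sumR_eq0 (n : nat) (f : nat -> R) :
  (forall i, (i < n)%nat -> f i = 0) -> sumR n f = 0.
Proof. intros H. rewrite (sumR_ext n f (fun _ => 0) H), sumR_const. ring. Qed.

Lemma sumR_ge_term (n i : nat) (f : nat -> R) :
  (forall j, (j < n)%nat -> 0 <= f j) -> (i < n)%nat -> f i <= sumR n f.
Proof.
  induction n as [|n IH]; intros H Hi; [lia|]. rewrite sumR_S.
  destruct (Nat.eq_dec i n) as [->|Hne].
  - pose proof (sumR_nonneg n f ltac:(intros; apply H; lia)). lra.
  - pose proof (IH ltac:(intros; apply H; lia) ltac:(lia)). pose proof (H n ltac:(lia)). lra.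
Qed.

Lemma sumR_single (n k : nat) (f : nat -> R) : (k < n)%nat ->
  sumR n (fun i => if Nat.eqb i k then f i else 0) = f k.
Proof.
  induction n as [|n IH]; intros Hk; [lia|]. rewrite sumR_S.
  destruct (Nat.eq_dec n k) as [->|Hne].
  - rewrite Nat.eqb_refl, sumR_eq0; [ring|].
    intros i Hi. destruct (Nat.eqb_spec i k); [lia|reflexivity].
  - rewrite IH by lia. destruct (Nat.eqb_spec n k); [lia|ring].
Qed.

Lemma sumR_swap (n m : nat) (f : nat -> nat -> R) :
  sumR n (fun i => sumR m (fun j => f i j)) = sumR m (fun j => sumR n (fun i => f i j)).
Proof.
  induction n as [|n IH].
  - unfold sumR at 1. simpl. symmetry. apply sumR_eq0. reflexivity.
  - rewrite sumR_S, IH, <- sumR_plus. apply sumR_ext. intros; rewrite sumR_S; reflexivity.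
Qed.

(* A positive normalised linear functional; [supp] is a set of full measure, and monotonicity
   only looks at points of [supp]. *)
Record expectation {A : Type} (supp : A -> Prop) (E : (A -> R) -> R) : Prop := {
  E_le : forall F G, (forall a, supp a -> F a <= G a) -> E F <= E G;
  E_lin : forall c F G, E (fun a => c * F a + G a) = c * E F + E G;
  E_one : E (fun _ => 1) = 1 }.

Arguments E_le {A supp E} _ F G _.
Arguments E_lin {A supp E} _ c F G.
Arguments E_one {A supp E} _.

Section Expectation.
Context {A : Type} {supp : A -> Prop} {E : (A -> R) -> R} (HE : expectation supp E).

Lemma E_ext (F G : A -> R) : (forall a, supp a -> F a = G a) -> E F = E G.
Proof.
  intros H; apply Rle_antisym; apply (E_le HE); intros a Ha; right; [|symmetry]; auto.
Qed.

Lemma E_zero : E (fun _ => 0) = 0.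
Proof.
  pose proof (E_lin HE (-1) (fun _ => 1) (fun _ => 1)) as H. rewrite (E_one HE) in H.
  rewrite (E_ext (fun _ => 0) (fun _ => -1 * 1 + 1)); [lra|intros; ring].
Qed.

Lemma E_scal (c : R) (F : A -> R) : E (fun a => c * F a) = c * E F.
Proof.
  rewrite (E_ext _ (fun a => c * F a + 0)); [|intros; ring].
  rewrite (E_lin HE), E_zero. ring.
Qed.

Lemma E_plus (F G : A -> R) : E (fun a => F a + G a) = E F + E G.
Proof.
  rewrite (E_ext _ (fun a => 1 * F a + G a)); [|intros; ring].
  rewrite (E_lin HE). ring.
Qed.

Lemma E_const (c : R) : E (fun _ => c) = c.
Proof.
  rewrite (E_ext _ (fun _ => c * 1)); [|intros; ring]. rewrite E_scal, (E_one HE). ring.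
Qed.

Lemma E_nonneg (F : A -> R) : (forall a, supp a -> 0 <= F a) -> 0 <= E F.
Proof. intros H. rewrite <- E_zero. apply (E_le HE), H. Qed.

Lemma E_upper (F : A -> R) (c : R) : (forall a, supp a -> F a <= c) -> E F <= c.
Proof. intros H. rewrite <- (E_const c). apply (E_le HE), H. Qed.

Lemma E_sumR (n : nat) (F : nat -> A -> R) :
  E (fun a => sumR n (fun i => F i a)) = sumR n (fun i => E (F i)).
Proof.
  induction n as [|n IH]; [apply E_zero|].
  rewrite sumR_S, <- IH, <- E_plus. apply E_ext. intros; apply sumR_S.
Qed.

(** The probabilistic method: a function that is at least [E F + d] on all of [supp] would have too
    large a mean. Applied to a constant, it produces a point of [supp]. *)
Lemma E_attained (F : A -> R) (d : R) : 0 < d -> exists a, supp a /\ F a < E F + d.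
Proof.
  intros Hd. apply NNPP. intros Hn.
  assert (E F + d <= E F); [|lra].
  rewrite <- (E_const (E F + d)). apply (E_le HE). intros a Ha.
  destruct (Rle_or_lt (E F + d) (F a)) as [H|H]; [exact H|].
  exfalso; apply Hn; exists a; auto.
Qed.

End Expectation.

(** * Independent repetitions: exponential moments, Gaussian comparison, greedy choice of
    codewords *)

Section Iteration.
Context {A : Type} {supp : A -> Prop} {E : (A -> R) -> R} (HE : expectation supp E).

Fixpoint Eit (E : (A -> R) -> R) (n : nat) (F : list A -> R) : R :=
  match n with
  | O => F nil
  | S m => E (fun a => Eit E m (fun l => F (a :: l)))
  end.

Lemma Eit_expectation (n : nat) :
  expectation (fun l => length l = n /\ Forall supp l) (Eit E n).
Proof.
  induction n as [|n IH].
  - split; simpl; auto.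
  - split; simpl.
    + intros F G H. apply (E_le HE). intros a Ha. apply (E_le IH). intros l [Hl Hs].
      apply H. simpl; auto.
    + intros c F G. rewrite <- (E_lin HE). apply (E_ext HE). intros a Ha. apply (E_lin IH).
    + rewrite (E_ext HE _ (fun _ => 1)); [apply (E_one HE)|]. intros; apply (E_one IH).
Qed.

(** Only exp u >= 1 + u is used: inverted at -x for negative x, and for positive x inverted at -x/2
    and squared. *)
Lemma exp_le_quadratic (x : R) : -1 <= x <= 1 -> exp x <= 1 + x + 3 * x ^ 2.
Proof.
  intros Hx. destruct (Rle_or_lt x 0) as [H|H].
  - pose proof (exp_neg_le_inv (- x) ltac:(lra)) as H1. rewrite Ropp_involutive in H1.
    apply Rle_trans with (1 := H1). apply Rmult_le_reg_l with (1 + - x); [lra|].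
    rewrite Rinv_r by lra. nra.
  - assert (H1 : exp (x / 2) <= / (1 - x / 2)).
    { replace (x / 2) with (- (- (x / 2))) at 1 by ring. rewrite exp_Ropp.
      apply Rinv_le_contravar; [lra|]. pose proof (exp_ineq1_le (- (x / 2))). lra. }
    replace x with (x / 2 + x / 2) at 1 by field. rewrite exp_plus.
    pose proof (exp_pos (x / 2)).
    assert (Hi : 0 < / (1 - x / 2)) by (apply Rinv_0_lt_compat; lra).
    apply Rle_trans with (/ (1 - x / 2) * / (1 - x / 2)); [nra|].
    apply Rmult_le_reg_l with ((1 - x / 2) * (1 - x / 2)); [nra|].
    replace ((1 - x / 2) * (1 - x / 2) * (/ (1 - x / 2) * / (1 - x / 2))) with 1 by (field; lra).
    assert (0 <= x * x * ((1 - x) * (9 - 3 * x) / 4 + / 4 * (1 - x) + x * / 4 * 1)) by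
      (assert (0 <= (1 - x) * (9 - 3 * x)) by nra; nra).
    nra.
Qed.

Lemma Eit_exp_le (g : A -> R) (B lam : R) (n : nat) :
  E g = 0 -> (forall a, supp a -> Rabs (g a) <= B) -> 0 <= lam -> lam * B <= 1 ->
  Eit E n (fun l => exp (lam * sumL l g)) <= exp (INR n * (3 * (lam * B) ^ 2)).
Proof.
  intros Hg HB Hl HlB. induction n as [|n IH].
  - simpl. right. f_equal. ring.
  - simpl Eit. rewrite S_INR.
    replace ((INR n + 1) * (3 * (lam * B) ^ 2))
      with (3 * (lam * B) ^ 2 + INR n * (3 * (lam * B) ^ 2)) by ring.
    rewrite exp_plus.
    rewrite (E_ext HE _ (fun a => Eit E n (fun l => exp (lam * sumL l g)) * exp (lam * g a))).
    2:{ intros a _. rewrite Rmult_comm, <- (E_scal (Eit_expectation n)).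
        apply (E_ext (Eit_expectation n)). intros l _.
        change (sumL (a :: l) g) with (g a + sumL l g).
        rewrite <- exp_plus. f_equal. ring. }
    rewrite (E_scal HE).
    assert (H1 : E (fun a => exp (lam * g a)) <= exp (3 * (lam * B) ^ 2)).
    { apply Rle_trans with (E (fun a => lam * g a + (1 + 3 * (lam * B) ^ 2))).
      - apply (E_le HE). intros a Ha. pose proof (HB a Ha) as Hb. apply Rabs_le_between in Hb.
        assert (Hx : - (lam * B) <= lam * g a <= lam * B) by nra.
        pose proof (exp_le_quadratic (lam * g a) ltac:(lra)).
        assert ((lam * g a) ^ 2 <= (lam * B) ^ 2) by nra. lra.
      - rewrite (E_lin HE), Hg, (E_const HE). pose proof (exp_ineq1_le (3 * (lam * B) ^ 2)). lra. }
    assert (0 <= E (fun a => exp (lam * g a))).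
    { apply (E_nonneg HE). intros; left; apply exp_pos. }
    assert (0 <= Eit E n (fun l => exp (lam * sumL l g))).
    { apply (E_nonneg (Eit_expectation n)). intros; left; apply exp_pos. }
    rewrite Rmult_comm. apply Rmult_le_compat; assumption.
Qed.

Definition ind_le (a b : R) : R := if Rle_dec a b then 1 else 0.

Lemma ind_le_bounds (a b : R) : 0 <= ind_le a b <= 1.
Proof. unfold ind_le; destruct Rle_dec; lra. Qed.

(** The exponential Markov inequality. [lam] stays free because the two phases need different
    scales: n^(-1/2) for the first and n^(-1/3) for the second. *)
Lemma chernoff (g : A -> R) (B lam D : R) (n : nat) :
  E g = 0 -> (forall a, supp a -> Rabs (g a) <= B) -> 0 <= lam -> lam * B <= 1 ->
  Eit E n (fun l => ind_le D (sumL l g)) <= exp (- (lam * D) + INR n * (3 * (lam * B) ^ 2)).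
Proof.
  intros Hg HB Hl HlB. pose proof (Eit_exp_le g B lam n Hg HB Hl HlB) as H.
  rewrite exp_plus.
  apply Rle_trans with (Eit E n (fun l => exp (- (lam * D)) * exp (lam * sumL l g))).
  - apply (E_le (Eit_expectation n)). intros l _. rewrite <- exp_plus. unfold ind_le.
    destruct Rle_dec as [Hd|_]; [|left; apply exp_pos].
    rewrite <- exp_0. apply exp_mono. nra.
  - rewrite (E_scal (Eit_expectation n)). apply Rmult_le_compat_l; [left; apply exp_pos|exact H].
Qed.

(** Lindeberg replacement: each random step is exchanged for V units of heat time. The coefficients
    in [heat_one_step] do not depend on the step, so a centred step of variance V removes both of
    them. *)
Lemma Eit_heat_le (g : A -> R) (B V rho : R) (n : nat) :
  E g = 0 -> E (fun a => g a ^ 2) = V -> (forall a, supp a -> Rabs (g a) <= B) ->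
  0 < V -> 0 <= B -> 1 <= rho -> V <= rho ->
  let kappa := 4 * (B ^ 3 + 2 * V ^ 2) / V in
  forall y, Eit E n (fun l => heat rho (y + sumL l g)) - kappa / sqrt rho
    <= heat (rho + INR n * V) y - kappa / sqrt (rho + INR n * V).
Proof.
  intros Hg Hg2 HB HV HB0 Hrho HVr kappa. induction n as [|n IH]; intros y.
  - simpl Eit. change (sumL nil g) with 0. change (INR 0) with 0.
    rewrite Rmult_0_l, !Rplus_0_r. apply Rle_refl.
  - pose proof (pos_INR n) as Hn.
    set (t := rho + INR n * V) in *.
    assert (Ht : rho <= t) by (unfold t; nra).
    replace (rho + INR (S n) * V) with (t + V) by (rewrite S_INR; unfold t; ring).
    destruct (heat_one_step t V B y ltac:(lra) HV ltac:(lra) HB0) as [c [d Hstep]].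
    cbv zeta in Hstep. fold kappa in Hstep.
    assert (H : Eit E (S n) (fun l => heat rho (y + sumL l g))
              <= E (fun a => c * g a + (d * g a ^ 2
                   + (heat (t + V) y - kappa / sqrt (t + V) + kappa / sqrt rho - V * d)))).
    + apply (E_le HE). cbv beta. intros a Ha. specialize (IH (y + g a)). specialize (Hstep (g a) (HB a Ha)).
      rewrite (E_ext (Eit_expectation n) _ (fun l => heat rho (y + g a + sumL l g))).
      * lra.
      * intros l _. f_equal. change (sumL (a :: l) g) with (g a + sumL l g). ring.
    + rewrite !(E_lin HE), Hg, Hg2, (E_const HE) in H. lra.
Qed.

Lemma Qtail_antitone (x y : R) : x <= y -> Qtail y <= Qtail x.
Proof.
  intros H. destruct (MVT_derive Qtail _ x y Qtail_derive) as [c [_ Hc]].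
  pose proof (gauss_pdf_pos c). nra.
Qed.

(** [heat rho], shifted by h, is a smooth majorant of the indicator up to [gexp (h / sqrt rho)]:
    where the sum is at most a, its argument is at most -h. The middle term is the telescoped Taylor
    error. Only this one-sided bound is needed. *)
Lemma clt_lower_tail (g : A -> R) (B V rho a h : R) (n : nat) :
  E g = 0 -> E (fun a => g a ^ 2) = V -> (forall a, supp a -> Rabs (g a) <= B) ->
  0 < V -> 0 <= B -> 1 <= rho -> V <= rho -> 0 <= h ->
  Eit E n (fun l => ind_le (sumL l g) a)
    <= Qtail ((- a - h) / sqrt (rho + INR n * V))
       + 4 * (B ^ 3 + 2 * V ^ 2) / V / sqrt rho + gexp (h / sqrt rho).
Proof.
  intros Hg Hg2 HB HV HB0 Hrho HVr Hh.
  pose proof (Eit_heat_le g B V rho n Hg Hg2 HB HV HB0 Hrho HVr (- a - h)) as H.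
  assert (Hs : 0 < sqrt rho) by (apply sqrt_lt_R0; lra).
  assert (Hs' : 0 < sqrt (rho + INR n * V)).
  { apply sqrt_lt_R0. pose proof (pos_INR n). nra. }
  set (k := 4 * (B ^ 3 + 2 * V ^ 2) / V) in *. cbv zeta in H.
  assert (Hk : 0 <= k / sqrt (rho + INR n * V)).
  { assert (0 <= B ^ 3) by (apply pow_le; lra).
    apply Rdiv_le_0_compat; [|exact Hs']. apply Rdiv_le_0_compat; nra. }
  apply Rle_trans with
    (Eit E n (fun l => heat rho (- a - h + sumL l g) + gexp (h / sqrt rho))).
  - apply (E_le (Eit_expectation n)). intros l _.
    assert (Hq : 0 <= heat rho (- a - h + sumL l g)) by apply Qtail_nonneg.
    pose proof (exp_pos (- (h / sqrt rho) ^ 2 / 2)) as He. fold (gexp (h / sqrt rho)) in He.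
    unfold ind_le. destruct Rle_dec as [Hd|_]; [|lra].
    assert (H1 : Qtail (- (h / sqrt rho)) <= heat rho (- a - h + sumL l g)).
    { apply Qtail_antitone. replace (- (h / sqrt rho)) with (- h / sqrt rho) by (field; lra).
      apply Rmult_le_compat_r; [left; apply Rinv_0_lt_compat; lra|lra]. }
    rewrite Qtail_opp in H1.
    assert (Qtail (h / sqrt rho) <= gexp (h / sqrt rho)); [|lra].
    apply Qtail_bounds. apply Rdiv_le_0_compat; lra.
  - rewrite (E_plus (Eit_expectation n)), (E_const (Eit_expectation n)).
    unfold heat at 2 in H. lra.
Qed.

Definition pos_part (x : R) : R := Rmax x 0.

Lemma pos_part_sqr_step (d h : R) :
  pos_part (d + h) ^ 2 <= pos_part d ^ 2 + 2 * pos_part d * h + h ^ 2.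
Proof. unfold pos_part, Rmax. repeat destruct Rle_dec; nra. Qed.

(* Codewords are picked one at a time so that the squared excesses of the two average errors
   plus the weighted number of confusions with earlier codewords grows by at most a constant. *)
Lemma greedy_selection (A1 A2 : A -> R) (F1 F2 : A -> A -> R) (a beta c : R) (M : nat) :
  (forall u, supp u -> 0 <= A1 u <= 1) -> (forall u, supp u -> 0 <= A2 u <= 1) ->
  0 <= a <= 1 -> 0 <= c -> E A1 <= a -> E A2 <= a ->
  (forall u, supp u -> E (F1 u) <= beta) -> (forall u, supp u -> E (F2 u) <= beta) ->
  2 * c * INR M * beta <= 1 -> 0 <= beta ->
  forall m, (m <= M)%nat -> exists us : nat -> A, (forall j, (j < m)%nat -> supp (us j)) /\
    pos_part (sumR m (fun j => A1 (us j) - a)) ^ 2 + pos_part (sumR m (fun j => A2 (us j) - a)) ^ 2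
    + c * sumR m (fun j => sumR j (fun i => F1 (us i) (us j) + F2 (us i) (us j)))
    <= 4 * INR m.
Proof.
  intros H1 H2 Ha Hc HA1 HA2 HF1 HF2 HM Hb. induction m as [|m IH]; intros Hm.
  - destruct (E_attained HE (fun _ => 0) 1 Rlt_0_1) as [u _].
    exists (fun _ => u). split; [intros; lia|].
    unfold sumR, pos_part; simpl. rewrite Rmax_left by lra. lra.
  - destruct (IH ltac:(lia)) as [us [Hs Hp]]. clear IH.
    set (d1 := sumR m (fun j => A1 (us j) - a)) in *.
    set (d2 := sumR m (fun j => A2 (us j) - a)) in *.
    set (fa := sumR m (fun j => sumR j (fun i => F1 (us i) (us j) + F2 (us i) (us j)))) in *.
    assert (P1 : 0 <= pos_part d1) by apply Rmax_r.
    assert (P2 : 0 <= pos_part d2) by apply Rmax_r.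
    set (pot := fun u => 2 * pos_part d1 * A1 u + (2 * pos_part d2 * A2 u
       + (c * sumR m (fun i => F1 (us i) u + F2 (us i) u)
          + (- (2 * pos_part d1 * a) - 2 * pos_part d2 * a)))).
    assert (Hpot : E pot <= 1).
    { unfold pot. rewrite !(E_lin HE), (E_const HE).
      rewrite (E_sumR HE m (fun i u => F1 (us i) u + F2 (us i) u)).
      assert (Hsum : sumR m (fun i => E (fun u => F1 (us i) u + F2 (us i) u)) <= INR m * (2 * beta)).
      { rewrite <- sumR_const. apply sumR_le. intros i Hi. rewrite (E_plus HE).
        pose proof (HF1 _ (Hs i Hi)). pose proof (HF2 _ (Hs i Hi)). lra. }
      assert (INR m * (2 * beta) <= INR M * (2 * beta)).
      { apply Rmult_le_compat_r; [lra|]. apply le_INR; lia. }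
      assert (c * sumR m (fun i => E (fun u => F1 (us i) u + F2 (us i) u))
              <= c * (INR M * (2 * beta))) by (apply Rmult_le_compat_l; lra).
      assert (pos_part d1 * E A1 <= pos_part d1 * a) by (apply Rmult_le_compat_l; lra).
      assert (pos_part d2 * E A2 <= pos_part d2 * a) by (apply Rmult_le_compat_l; lra).
      lra. }
    destruct (E_attained HE pot 1 Rlt_0_1) as [u [Hu Hlt]].
    exists (fun j => if Nat.eqb j m then u else us j). split.
    { intros j Hj. destruct (Nat.eqb_spec j m); [exact Hu|apply Hs; lia]. }
    rewrite !sumR_S, Nat.eqb_refl, S_INR.
    rewrite (sumR_ext m (fun j => A1 (if Nat.eqb j m then u else us j) - a) (fun j => A1 (us j) - a))
      by (intros i Hi; destruct (Nat.eqb_spec i m); [lia|reflexivity]).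
    rewrite (sumR_ext m (fun j => A2 (if Nat.eqb j m then u else us j) - a) (fun j => A2 (us j) - a))
      by (intros i Hi; destruct (Nat.eqb_spec i m); [lia|reflexivity]).
    rewrite (sumR_ext m (fun i => F1 (if Nat.eqb i m then u else us i) u
         + F2 (if Nat.eqb i m then u else us i) u) (fun i => F1 (us i) u + F2 (us i) u))
      by (intros i Hi; destruct (Nat.eqb_spec i m); [lia|reflexivity]).
    rewrite (sumR_ext m (fun j => sumR j (fun i =>
         F1 (if Nat.eqb i m then u else us i) (if Nat.eqb j m then u else us j)
         + F2 (if Nat.eqb i m then u else us i) (if Nat.eqb j m then u else us j)))
       (fun j => sumR j (fun i => F1 (us i) (us j) + F2 (us i) (us j)))).
    2:{ intros j Hj. apply sumR_ext. intros i Hi.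
        destruct (Nat.eqb_spec i m); [lia|]. destruct (Nat.eqb_spec j m); [lia|reflexivity]. }
    fold d1 d2 fa.
    pose proof (pos_part_sqr_step d1 (A1 u - a)) as S1.
    pose proof (pos_part_sqr_step d2 (A2 u - a)) as S2.
    assert ((A1 u - a) ^ 2 <= 1) by (pose proof (H1 u Hu); nra).
    assert ((A2 u - a) ^ 2 <= 1) by (pose proof (H2 u Hu); nra).
    assert (Hlt2 : pot u < 2) by lra. unfold pot in Hlt2. lra.
Qed.

End Iteration.

(** * Mutual information *)

Definition Ex (n : nat) (p : nat -> R) (F : nat -> R) : R := sumR n (fun i => p i * F i).

Lemma Ex_expectation (n : nat) (p : nat -> R) : is_dist n p ->
  expectation (fun i => (i < n)%nat /\ 0 < p i) (Ex n p).
Proof.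
  intros [H0 H1]. unfold Ex. split.
  - intros F G H. apply sumR_le. intros i Hi. destruct (H0 i Hi) as [Hp|Hp].
    + apply Rmult_le_compat_l; [lra|]. apply H; auto.
    + rewrite <- Hp; lra.
  - intros c F G. rewrite <- sumR_scal, <- sumR_plus. apply sumR_ext. intros; ring.
  - transitivity (sumR n p); [apply sumR_ext; intros; ring|exact H1].
Qed.

Lemma bind_expectation {A B : Type} {sA : A -> Prop} {sB : A -> B -> Prop}
  {E : (A -> R) -> R} {K : A -> (B -> R) -> R} :
  expectation sA E -> (forall a, sA a -> expectation (sB a) (K a)) ->
  expectation (fun ab => sA (fst ab) /\ sB (fst ab) (snd ab))
    (fun F => E (fun a => K a (fun b => F (a, b)))).
Proof.
  intros HE HK. split.
  - intros F G H. apply (E_le HE). intros a Ha. apply (E_le (HK a Ha)). intros b Hb.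
    apply H; auto.
  - intros c F G. rewrite <- (E_lin HE). apply (E_ext HE). intros a Ha. apply (E_lin (HK a Ha)).
  - rewrite (E_ext HE _ (fun _ => 1)); [apply (E_one HE)|]. intros a Ha. apply (E_one (HK a Ha)).
Qed.

Lemma pos_lower_bound (n : nat) (f : nat -> R) :
  exists c, 0 < c /\ forall i, (i < n)%nat -> 0 < f i -> c <= f i.
Proof.
  induction n as [|n [c [Hc H]]].
  - exists 1. split; [lra|intros; lia].
  - destruct (Rlt_or_le 0 (f n)) as [Hf|Hf].
    + exists (Rmin c (f n)). split; [apply Rmin_glb_lt; auto|].
      intros i Hi Hp. destruct (Nat.eq_dec i n) as [->|Hne]; [apply Rmin_r|].
      apply Rle_trans with c; [apply Rmin_l|apply H; auto; lia].
    + exists c. split; [auto|]. intros i Hi Hp.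
      destruct (Nat.eq_dec i n) as [->|Hne]; [lra|apply H; auto; lia].
Qed.

Lemma pos_lower_bound2 (n m : nat) (f : nat -> nat -> R) :
  exists c, 0 < c /\ forall i j, (i < n)%nat -> (j < m)%nat -> 0 < f i j -> c <= f i j.
Proof.
  induction n as [|n [c [Hc H]]].
  - exists 1. split; [lra|intros; lia].
  - destruct (pos_lower_bound m (f n)) as [d [Hd H']].
    exists (Rmin c d). split; [apply Rmin_glb_lt; auto|].
    intros i j Hi Hj Hp. destruct (Nat.eq_dec i n) as [->|Hne].
    + apply Rle_trans with d; [apply Rmin_r|auto].
    + apply Rle_trans with c; [apply Rmin_l|apply H; auto; lia].
Qed.

Lemma ln_le_sub1 (u : R) : 0 < u -> ln u <= u - 1.
Proof. intros H. pose proof (exp_ineq1_le (ln u)). rewrite exp_ln in *; lra. Qed.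

Lemma ln_ge_inv (u : R) : 0 < u -> 1 - / u <= ln u.
Proof.
  intros H. pose proof (ln_le_sub1 (/ u) (Rinv_0_lt_compat _ H)) as H1.
  rewrite ln_Rinv in H1 by lra. lra.
Qed.

Section Channel.
Context (N L : nat) (W : nat -> nat -> R) (HW : is_channel N L W).

Lemma W_nonneg (x y : nat) : (x < N)%nat -> (y < L)%nat -> 0 <= W y x.
Proof. intros Hx Hy. apply (HW x Hx); auto. Qed.

Lemma W_expectation (x : nat) : (x < N)%nat ->
  expectation (fun y => (y < L)%nat /\ 0 < W y x) (Ex L (fun y => W y x)).
Proof. intros Hx. apply Ex_expectation, HW, Hx. Qed.

Lemma PW_ge (P : nat -> R) (x y : nat) : is_dist N P -> (x < N)%nat -> (y < L)%nat ->
  P x * W y x <= PW N P W y.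
Proof.
  intros [HP _] Hx Hy. apply (sumR_ge_term N x (fun x => P x * W y x)); [|exact Hx].
  intros j Hj. apply Rmult_le_pos; [auto|apply W_nonneg; auto].
Qed.

Lemma PW_pos (P : nat -> R) (x y : nat) : is_dist N P -> (x < N)%nat -> (y < L)%nat ->
  0 < P x -> 0 < W y x -> 0 < PW N P W y.
Proof.
  intros HP Hx Hy Hp Hw. apply Rlt_le_trans with (P x * W y x); [nra|apply PW_ge; auto].
Qed.

Lemma PW_nonneg (P : nat -> R) (y : nat) : is_dist N P -> (y < L)%nat -> 0 <= PW N P W y.
Proof.
  intros [HP _] Hy. apply sumR_nonneg. intros x Hx. apply Rmult_le_pos; [auto|apply W_nonneg; auto].
Qed.

Lemma PW_Ex (p : nat -> R) (F : nat -> R) :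
  Ex L (PW N p W) F = Ex N p (fun x => Ex L (fun y => W y x) F).
Proof.
  unfold Ex, PW.
  rewrite (sumR_ext N _ (fun x => sumR L (fun y => p x * W y x * F y))).
  2:{ intros x _. rewrite <- sumR_scal. apply sumR_ext. intros; ring. }
  rewrite sumR_swap. apply sumR_ext. intros y _.
  rewrite Rmult_comm, <- sumR_scal. apply sumR_ext. intros; ring.
Qed.

Lemma PW_sum (p : nat -> R) : sumR L (PW N p W) = sumR N p.
Proof.
  pose proof (PW_Ex p (fun _ => 1)) as H. unfold Ex in H.
  rewrite (sumR_ext L _ (PW N p W)) in H by (intros; ring). rewrite H.
  apply sumR_ext. intros x Hx.
  pose proof (E_one (W_expectation x Hx)) as H1. unfold Ex in H1. rewrite H1. ring.
Qed.

Lemma PW_dist (P : nat -> R) : is_dist N P -> is_dist L (PW N P W).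
Proof.
  intros HP. split; [intros; apply PW_nonneg; auto|]. rewrite PW_sum. apply HP.
Qed.

Lemma MI_Ex (P : nat -> R) :
  MI N L W P = Ex N P (fun x => Ex L (fun y => W y x) (fun y => idens N P W x y)).
Proof. reflexivity. Qed.

Lemma MI_nonneg (P : nat -> R) : is_dist N P -> 0 <= MI N L W P.
Proof.
  intros HP. apply (E_nonneg (Ex_expectation N P HP)). intros x [Hx Hp].
  apply Rle_trans with (sumR L (fun y => W y x - PW N P W y)).
  - rewrite sumR_minus, PW_sum, (proj2 HP), (proj2 (HW x Hx)). lra.
  - apply sumR_le. intros y Hy. destruct (W_nonneg x y Hx Hy) as [Hw|Hw].
    + pose proof (PW_pos P x y HP Hx Hy Hp Hw) as Hq.
      pose proof (ln_ge_inv (W y x / PW N P W y) (Rdiv_lt_0_compat _ _ Hw Hq)) as H.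
      apply Rmult_le_compat_l with (r := W y x) in H; [|lra].
      replace (W y x * (1 - / (W y x / PW N P W y))) with (W y x - PW N P W y) in H
        by (field; lra). exact H.
    + rewrite <- Hw. pose proof (PW_nonneg P y HP Hy). lra.
Qed.

(** The difference of the two sides is the divergence between the output laws of P and Q,
    nonnegative by ln u >= 1 - 1/u. It yields concavity and, later, the sign of the derivative
    towards a better input. *)
Lemma MI_le_cross (P Q : nat -> R) : is_dist N P -> is_dist N Q ->
  (forall x, (x < N)%nat -> 0 < P x -> 0 < Q x) ->
  MI N L W P <= Ex N P (fun x => KL L W x (PW N Q W)).
Proof.
  intros HP HQ HPQ. rewrite MI_Ex.
  set (r := fun y => PW N Q W y / PW N P W y).
  assert (H1 : Ex N P (fun x => Ex L (fun y => W y x) (fun y => idens N P W x y + (1 - r y)))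
             <= Ex N P (fun x => KL L W x (PW N Q W))).
  { apply (E_le (Ex_expectation N P HP)). intros x [Hx Hp].
    apply (E_le (W_expectation x Hx)). intros y [Hy Hw]. unfold idens, r.
    pose proof (PW_pos P x y HP Hx Hy Hp Hw) as H1.
    pose proof (PW_pos Q x y HQ Hx Hy (HPQ x Hx Hp) Hw) as H2.
    pose proof (ln_ge_inv (PW N P W y / PW N Q W y) (Rdiv_lt_0_compat _ _ H1 H2)) as H.
    rewrite !ln_div in * by auto.
    replace (/ (PW N P W y / PW N Q W y)) with (PW N Q W y / PW N P W y) in H by (field; lra).
    lra. }
  rewrite (E_ext (Ex_expectation N P HP) _
    (fun x => Ex L (fun y => W y x) (fun y => idens N P W x y)
              + Ex L (fun y => W y x) (fun y => 1 - r y))) in H1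
    by (intros x [Hx _]; apply (E_plus (W_expectation x Hx))).
  rewrite (E_plus (Ex_expectation N P HP)), <- PW_Ex in H1.
  assert (H2 : 0 <= Ex L (PW N P W) (fun y => 1 - r y)); [|lra].
  apply Rle_trans with (sumR L (fun y => PW N P W y - PW N Q W y)).
  - rewrite sumR_minus, !PW_sum, (proj2 HP), (proj2 HQ). lra.
  - apply sumR_le. intros y Hy. unfold r.
    destruct (PW_nonneg P y HP Hy) as [H|H].
    + right. field. lra.
    + rewrite <- H. pose proof (PW_nonneg Q y HQ Hy). lra.
Qed.

Definition mix (t : R) (P0 P1 : nat -> R) (x : nat) : R := (1 - t) * P0 x + t * P1 x.

Lemma mix_dist (t : R) (P0 P1 : nat -> R) : 0 <= t <= 1 -> is_dist N P0 -> is_dist N P1 ->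
  is_dist N (mix t P0 P1).
Proof.
  intros Ht [H0 S0] [H1 S1]. split.
  - intros x Hx. specialize (H0 x Hx). specialize (H1 x Hx). unfold mix. nra.
  - unfold mix. rewrite sumR_plus, !sumR_scal, S0, S1. ring.
Qed.

(** The information of the mixture is the mixture of two cross terms against the mixed output law,
    and [MI_le_cross] bounds each. With 0 < t < 1 the mixture charges every letter that a component
    charges. *)
Lemma MI_concave (t : R) (P0 P1 : nat -> R) : 0 < t < 1 -> is_dist N P0 -> is_dist N P1 ->
  (1 - t) * MI N L W P0 + t * MI N L W P1 <= MI N L W (mix t P0 P1).
Proof.
  intros Ht H0 H1. pose proof (mix_dist t P0 P1 ltac:(lra) H0 H1) as Hm.
  assert (E : MI N L W (mix t P0 P1)
    = (1 - t) * Ex N P0 (fun x => KL L W x (PW N (mix t P0 P1) W))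
      + t * Ex N P1 (fun x => KL L W x (PW N (mix t P0 P1) W))).
  { unfold MI, Ex. rewrite <- !sumR_scal, <- sumR_plus. apply sumR_ext. intros; unfold mix at 1. ring. }
  rewrite E.
  assert (MI N L W P0 <= Ex N P0 (fun x => KL L W x (PW N (mix t P0 P1) W))).
  { apply MI_le_cross; auto. intros x Hx Hp. unfold mix. pose proof (proj1 H1 x Hx). nra. }
  assert (MI N L W P1 <= Ex N P1 (fun x => KL L W x (PW N (mix t P0 P1) W))).
  { apply MI_le_cross; auto. intros x Hx Hp. unfold mix. pose proof (proj1 H0 x Hx). nra. }
  nra.
Qed.

Definition tilt (P v : nat -> R) (s : R) (x : nat) : R := P x + s * v x.

Definition chi2 (P v : nat -> R) : R := sumR L (fun y => PW N v W y ^ 2 / PW N P W y).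

(** The mean divergence from the fixed output law of P is affine in s; it exceeds the information by
    the divergence between the two output laws, which is at most their chi-square distance
    [s ^ 2 * chi2 P v]. *)
Lemma MI_tilt_lower (P v : nat -> R) (s : R) :
  is_dist N P -> (forall x, (x < N)%nat -> 0 < P x) -> sumR N v = 0 ->
  is_dist N (tilt P v s) ->
  MI N L W P + s * dI N L W P v - s ^ 2 * chi2 P v <= MI N L W (tilt P v s).
Proof.
  intros HP Hpos Hv HT. set (T := tilt P v s) in *.
  assert (E1 : MI N L W P + s * dI N L W P v = Ex N T (fun x => KL L W x (PW N P W))).
  { unfold MI, dI, Ex, T, tilt. rewrite <- sumR_scal, <- sumR_plus. apply sumR_ext; intros; ring. }
  assert (PT : forall y, PW N T W y = PW N P W y + s * PW N v W y).
  { intros y. unfold PW, T, tilt. rewrite <- sumR_scal, <- sumR_plus. apply sumR_ext; intros; ring. }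
  assert (H : Ex N T (fun x => KL L W x (PW N P W)) <= MI N L W T
     + Ex L (PW N T W) (fun y => PW N T W y / PW N P W y - 1)).
  { rewrite MI_Ex, PW_Ex, <- (E_plus (Ex_expectation N T HT)).
    apply (E_le (Ex_expectation N T HT)). intros x [Hx Hp].
    rewrite <- (E_plus (W_expectation x Hx)).
    apply (E_le (W_expectation x Hx)). intros y [Hy Hw]. unfold idens.
    pose proof (PW_pos P x y HP Hx Hy (Hpos x Hx) Hw) as H1.
    pose proof (PW_pos T x y HT Hx Hy Hp Hw) as H2.
    pose proof (ln_le_sub1 (PW N T W y / PW N P W y) (Rdiv_lt_0_compat _ _ H2 H1)) as H.
    rewrite !ln_div in * by auto. lra. }
  rewrite E1. apply Rle_trans with (1 := Rplus_le_compat_r _ _ _ H).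
  assert (E2 : Ex L (PW N T W) (fun y => PW N T W y / PW N P W y - 1)
     = s * sumR L (PW N v W) + s ^ 2 * chi2 P v); [|rewrite E2, PW_sum, Hv; lra].
  unfold Ex, chi2. rewrite <- !sumR_scal, <- sumR_plus. apply sumR_ext. intros y Hy.
  destruct (PW_nonneg P y HP Hy) as [Hp|Hp].
  - rewrite PT. field. lra.
  (* An output of probability zero under the everywhere positive P is produced by no input, so both
     sides vanish despite the division by zero. *)
  - assert (H0 : forall x, (x < N)%nat -> W y x = 0).
    { intros x Hx. pose proof (PW_ge P x y HP Hx Hy). pose proof (Hpos x Hx).
      pose proof (W_nonneg x y Hx Hy). nra. }
    assert (Hz : forall p, PW N p W y = 0).
    { intros p. apply sumR_eq0. intros x Hx. rewrite (H0 x Hx). ring. }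
    rewrite !Hz. unfold Rdiv. ring.
Qed.

(** One bound must serve all tilted inputs. If P is at least half of [Pstar], then W / PW is at most
    2 / p for the smallest entry p of [Pstar]; since PW <= 1 it is at least the smallest positive
    transition probability. *)
Lemma idens_bounded (Pstar : nat -> R) :
  (forall x, (x < N)%nat -> 0 < Pstar x) ->
  exists B, 1 <= B /\ forall P, is_dist N P -> (forall x, (x < N)%nat -> Pstar x / 2 <= P x) ->
    forall x y, (x < N)%nat -> (y < L)%nat -> 0 < W y x -> Rabs (idens N P W x y) <= B.
Proof.
  intros Hpos. destruct (pos_lower_bound N Pstar) as [p [Hp Hpm]].
  destruct (pos_lower_bound2 L N W) as [w [Hw Hwm]].
  exists (1 + Rabs (ln (2 / p)) + Rabs (ln w)).
  pose proof (Rabs_pos (ln (2 / p))). pose proof (Rabs_pos (ln w)). split; [lra|].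
  intros P HP HPs x y Hx Hy Hwp. unfold idens.
  specialize (Hpm x Hx (Hpos x Hx)). specialize (Hwm y x Hy Hx Hwp). specialize (HPs x Hx).
  pose proof (PW_ge P x y HP Hx Hy) as Hge.
  assert (Hle : PW N P W y <= 1).
  { rewrite <- (proj2 (PW_dist P HP)). apply sumR_ge_term; [|auto].
    intros; apply PW_nonneg; auto. }
  assert (Hq : 0 < PW N P W y) by (apply (PW_pos P x y); auto; lra).
  set (q := PW N P W y) in *. set (a := W y x) in *.
  assert (H1 : a / q <= 2 / p).
  { apply Rle_div_l; [lra|]. assert (2 / p * (p / 2 * a) <= 2 / p * q).
    - apply Rmult_le_compat_l; [left; apply Rdiv_lt_0_compat; lra|nra].
    - replace (2 / p * (p / 2 * a)) with a in * by (field; lra). lra. }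
  assert (H2 : w <= a / q) by (apply Rle_div_r; [lra|nra]).
  assert (H3 : ln (a / q) <= ln (2 / p)).
  { apply ln_le; [lra|exact H1]. }
  assert (H4 : ln w <= ln (a / q)) by (apply ln_le; [lra|exact H2]).
  pose proof (Rle_abs (ln (2 / p))). pose proof (Rle_abs (- ln w)) as Hn. rewrite Rabs_Ropp in Hn.
  apply Rabs_le. lra.
Qed.

End Channel.

(** * Equality and positivity of the two informations at the maximiser *)

Section Balance.
Context (N L : nat) (W1 W2 : nat -> nat -> R)
  (HW1 : is_channel N L W1) (HW2 : is_channel N L W2)
  (Pstar : nat -> R) (HPd : is_dist N Pstar)
  (HPmax : forall P, is_dist N P -> minI N L W1 W2 P <= minI N L W1 W2 Pstar)
  (HC1 : exists P, is_dist N P /\ MI N L W1 P > minI N L W1 W2 Pstar)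
  (HC2 : exists P, is_dist N P /\ MI N L W2 P > minI N L W1 W2 Pstar).

(* If the two informations differed at the maximiser, moving a little towards a better input
   distribution of the worse channel would increase the minimum. *)
Lemma MI_maximizer_le : MI N L W2 Pstar <= MI N L W1 Pstar.
Proof.
  destruct (Rle_or_lt (MI N L W2 Pstar) (MI N L W1 Pstar)) as [H|H]; [exact H|exfalso].
  destruct HC1 as [P [HP Hgt]]. unfold minI in Hgt, HPmax.
  rewrite Rmin_left in Hgt, HPmax by lra.
  pose proof (MI_nonneg N L W1 HW1 Pstar HPd) as H0.
  set (i1 := MI N L W1 Pstar) in *. set (i2 := MI N L W2 Pstar) in *.
  (* This weight makes (1 - t) i2 the midpoint of i1 and i2, so the better channel stays above i1
     even if P is worthless for it. *)
  set (t := (i2 - i1) / (2 * i2)).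
  assert (Ht : t * (2 * i2) = i2 - i1) by (unfold t; field; lra).
  assert (Ht01 : 0 < t < 1).
  { split; [unfold t; apply Rdiv_lt_0_compat; lra|]. nra. }
  pose proof (HPmax _ (mix_dist N t Pstar P ltac:(lra) HPd HP)) as Hm.
  pose proof (MI_concave N L W1 HW1 t Pstar P Ht01 HPd HP) as M1.
  pose proof (MI_concave N L W2 HW2 t Pstar P Ht01 HPd HP) as M2.
  pose proof (MI_nonneg N L W2 HW2 P HP) as H2. fold i1 in M1. fold i2 in M2.
  assert (i1 < MI N L W1 (mix t Pstar P)) by nra.
  assert (i1 < MI N L W2 (mix t Pstar P)) by nra.
  revert Hm. unfold Rmin. destruct Rle_dec; lra.
Qed.

(** Mixing equally an input that is good for channel 1 with one that is good for channel 2 gives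
    both channels positive information by concavity. Positivity lets n C dominate the lower-order
    terms of the rate. *)
Lemma maximin_pos : 0 < minI N L W1 W2 Pstar.
Proof.
  pose proof (MI_nonneg N L W1 HW1 Pstar HPd) as H1.
  pose proof (MI_nonneg N L W2 HW2 Pstar HPd) as H2.
  assert (Hc : 0 <= minI N L W1 W2 Pstar) by (apply Rmin_glb; lra).
  destruct HC1 as [P1 [HP1 G1]]. destruct HC2 as [P2 [HP2 G2]].
  assert (Ht : 0 < / 2 < 1) by lra.
  pose proof (HPmax _ (mix_dist N (/ 2) P1 P2 ltac:(lra) HP1 HP2)) as Hm.
  pose proof (MI_concave N L W1 HW1 (/ 2) P1 P2 Ht HP1 HP2) as M1.
  pose proof (MI_concave N L W2 HW2 (/ 2) P1 P2 Ht HP1 HP2) as M2.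
  pose proof (MI_nonneg N L W1 HW1 P2 HP2). pose proof (MI_nonneg N L W2 HW2 P1 HP1).
  assert (0 < minI N L W1 W2 (mix (/ 2) P1 P2)) by (apply Rmin_glb_lt; lra).
  lra.
Qed.

End Balance.

(** * One use of the broadcast channel and the increment [tau] *)

Section Broadcast.
Context (N L : nat) (W1 W2 : nat -> nat -> R)
  (HW1 : is_channel N L W1) (HW2 : is_channel N L W2).

Definition Eo (x : nat) (F : nat * nat -> R) : R :=
  Ex L (fun a => W1 a x) (fun a => Ex L (fun b => W2 b x) (fun b => F (a, b))).

Definition supp_o (x : nat) (ab : nat * nat) : Prop :=
  ((fst ab < L)%nat /\ 0 < W1 (fst ab) x) /\ ((snd ab < L)%nat /\ 0 < W2 (snd ab) x).

Lemma Eo_expectation (x : nat) : (x < N)%nat -> expectation (supp_o x) (Eo x).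
Proof.
  intros Hx. apply (bind_expectation (W_expectation N L W1 HW1 x Hx)
    (fun a _ => W_expectation N L W2 HW2 x Hx)).
Qed.

Definition E3 (P : nat -> R) (F : nat * (nat * nat) -> R) : R :=
  Ex N P (fun x => Eo x (fun ab => F (x, ab))).

Definition supp3 (P : nat -> R) (c : nat * (nat * nat)) : Prop :=
  ((fst c < N)%nat /\ 0 < P (fst c)) /\ supp_o (fst c) (snd c).

Lemma E3_expectation (P : nat -> R) : is_dist N P -> expectation (supp3 P) (E3 P).
Proof.
  intros HP. apply (bind_expectation (Ex_expectation N P HP)).
  intros x [Hx _]. apply Eo_expectation, Hx.
Qed.

Lemma Eo_fst (x : nat) (f : nat -> R) : (x < N)%nat ->
  Eo x (fun ab => f (fst ab)) = Ex L (fun a => W1 a x) f.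
Proof.
  intros Hx. apply (E_ext (W_expectation N L W1 HW1 x Hx)). intros a _.
  exact (E_const (W_expectation N L W2 HW2 x Hx) (f a)).
Qed.

Lemma Eo_snd (x : nat) (f : nat -> R) : (x < N)%nat ->
  Eo x (fun ab => f (snd ab)) = Ex L (fun b => W2 b x) f.
Proof.
  intros Hx. exact (E_const (W_expectation N L W1 HW1 x Hx) (Ex L (fun b => W2 b x) f)).
Qed.

Definition i1 (P : nat -> R) (c : nat * (nat * nat)) : R := idens N P W1 (fst c) (fst (snd c)).
Definition i2 (P : nat -> R) (c : nat * (nat * nat)) : R := idens N P W2 (fst c) (snd (snd c)).

Lemma E3_i1 (P : nat -> R) : is_dist N P -> E3 P (i1 P) = MI N L W1 P.
Proof.
  intros HP. apply (E_ext (Ex_expectation N P HP)). intros x [Hx _].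
  apply (Eo_fst x (fun a => idens N P W1 x a) Hx).
Qed.

Lemma E3_i2 (P : nat -> R) : is_dist N P -> E3 P (i2 P) = MI N L W2 P.
Proof.
  intros HP. apply (E_ext (Ex_expectation N P HP)). intros x [Hx _].
  apply (Eo_snd x (fun b => idens N P W2 x b) Hx).
Qed.

Lemma E_affine {A : Type} {s : A -> Prop} {E : (A -> R) -> R} (HE : expectation s E)
  (c0 c1 c2 : R) (f : A -> R) :
  E (fun a => c0 + c1 * f a + c2 * f a ^ 2) = c0 + c1 * E f + c2 * E (fun a => f a ^ 2).
Proof.
  rewrite (E_ext HE _ (fun a => c2 * f a ^ 2 + (c1 * f a + c0))) by (intros; ring).
  rewrite !(E_lin HE), (E_const HE). ring.
Qed.

(* Given the input, the two outputs are independent, so the conditional variances add up. *)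
Lemma Eo_variance (x : nat) (f g : nat -> R) (c : R) : (x < N)%nat ->
  Eo x (fun ab => f (fst ab) + g (snd ab)) = c ->
  Eo x (fun ab => (f (fst ab) + g (snd ab) - c) ^ 2)
  = (Ex L (fun a => W1 a x) (fun a => f a ^ 2) - Ex L (fun a => W1 a x) f ^ 2)
    + (Ex L (fun b => W2 b x) (fun b => g b ^ 2) - Ex L (fun b => W2 b x) g ^ 2).
Proof.
  intros Hx Hc. rewrite (E_plus (Eo_expectation x Hx)), (Eo_fst x f Hx), (Eo_snd x g Hx) in Hc.
  unfold Eo. set (m1 := Ex L (fun a => W1 a x) f) in *. set (m2 := Ex L (fun b => W2 b x) g) in *.
  rewrite (E_ext (W_expectation N L W1 HW1 x Hx) _ (fun a =>
     (c ^ 2 - 2 * c * m2 + Ex L (fun b => W2 b x) (fun b => g b ^ 2))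
     + (2 * m2 - 2 * c) * f a + 1 * f a ^ 2)).
  - rewrite (E_affine (W_expectation N L W1 HW1 x Hx)). fold m1. rewrite <- Hc. ring.
  - intros a _. cbn [fst snd].
    rewrite (E_ext (W_expectation N L W2 HW2 x Hx) _ (fun b =>
      (f a - c) ^ 2 + (2 * (f a - c)) * g b + 1 * g b ^ 2)) by (intros; ring).
    rewrite (E_affine (W_expectation N L W2 HW2 x Hx)). fold m2. ring.
Qed.

Context (Pstar : nat -> R) (HPd : is_dist N Pstar)
  (HPmax : forall P, is_dist N P -> minI N L W1 W2 P <= minI N L W1 W2 Pstar)
  (HC1 : exists P, is_dist N P /\ MI N L W1 P > minI N L W1 W2 Pstar)
  (HC2 : exists P, is_dist N P /\ MI N L W2 P > minI N L W1 W2 Pstar)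
  (eta : R) (Heta : eta_prop N L W1 W2 Pstar eta).

Lemma MI_balanced : MI N L W1 Pstar = minI N L W1 W2 Pstar /\ MI N L W2 Pstar = minI N L W1 W2 Pstar.
Proof.
  pose proof (MI_maximizer_le N L W1 W2 HW1 HW2 Pstar HPd HPmax HC1) as H1.
  assert (H2 : MI N L W1 Pstar <= MI N L W2 Pstar).
  { assert (Hs : forall P, minI N L W2 W1 P = minI N L W1 W2 P) by (intros; apply Rmin_comm).
    apply (MI_maximizer_le N L W2 W1 HW2 HW1 Pstar HPd).
    - intros P HP. rewrite !Hs. auto.
    - rewrite Hs. exact HC2. }
  unfold minI. rewrite Rmin_left by lra. lra.
Qed.

Definition tau (c : nat * (nat * nat)) : R := eta * i1 Pstar c + (1 - eta) * i2 Pstar c.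

(** Testing [eta_prop] on the point mass at x minus [Pstar] shows that the weighted divergence at x
    equals its [Pstar]-average, which is the common value of the two informations. *)
Lemma Eo_tau (x : nat) : (x < N)%nat ->
  Eo x (fun ab => eta * idens N Pstar W1 x (fst ab) + (1 - eta) * idens N Pstar W2 x (snd ab))
  = minI N L W1 W2 Pstar.
Proof.
  intros Hx. set (d := fun y => (if Nat.eqb y x then 1 else 0) - Pstar y).
  assert (Hd : forall f, sumR N (fun y => d y * f y) = f x - sumR N (fun y => Pstar y * f y)).
  { intros f. unfold d.
    rewrite (sumR_ext N _ (fun y => (if Nat.eqb y x then f y else 0) - Pstar y * f y)).
    - rewrite sumR_minus, sumR_single by exact Hx. reflexivity.
    - intros y _. destruct Nat.eqb; ring. }
  assert (Hd0 : sumR N d = 0).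
  { rewrite (sumR_ext N d (fun y => d y * 1)) by (intros; ring). rewrite (Hd (fun _ => 1)).
    rewrite (sumR_ext N _ Pstar) by (intros; ring). rewrite (proj2 HPd). ring. }
  pose proof (Heta d Hd0) as H. unfold dI in H. rewrite !Hd in H.
  fold (MI N L W1 Pstar) in H. fold (MI N L W2 Pstar) in H.
  destruct MI_balanced as [E1 E2]. rewrite E1, E2 in H.
  rewrite (E_plus (Eo_expectation x Hx)), !(E_scal (Eo_expectation x Hx)),
    (Eo_fst x (fun a => idens N Pstar W1 x a) Hx), (Eo_snd x (fun b => idens N Pstar W2 x b) Hx).
  change (Ex L (fun a => W1 a x) (fun a => idens N Pstar W1 x a)) with (KL L W1 x (PW N Pstar W1)).
  change (Ex L (fun b => W2 b x) (fun b => idens N Pstar W2 x b)) with (KL L W2 x (PW N Pstar W2)).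
  lra.
Qed.

Lemma E3_tau : E3 Pstar (fun c => tau c - minI N L W1 W2 Pstar) = 0.
Proof.
  unfold E3. rewrite (E_ext (Ex_expectation N Pstar HPd) _ (fun _ => 0)).
  - apply (E_zero (Ex_expectation N Pstar HPd)).
  - intros x [Hx _]. unfold Rminus. rewrite (E_plus (Eo_expectation x Hx)), (E_const (Eo_expectation x Hx)).
    pose proof (Eo_tau x Hx) as H. unfold tau, i1, i2. cbn [fst snd]. rewrite H. ring.
Qed.

(** As the conditional mean of [tau] does not depend on the input, its variance is the average
    conditional variance, which is how [Vdisp] is defined. *)
Lemma E3_tau_sqr : E3 Pstar (fun c => (tau c - minI N L W1 W2 Pstar) ^ 2)
  = eta ^ 2 * Vdisp N L W1 Pstar + (1 - eta) ^ 2 * Vdisp N L W2 Pstar.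
Proof.
  unfold E3, Vdisp. rewrite <- !sumR_scal, <- sumR_plus. apply sumR_ext. intros x Hx.
  pose proof (Eo_variance x (fun a => eta * idens N Pstar W1 x a)
    (fun b => (1 - eta) * idens N Pstar W2 x b) _ Hx (Eo_tau x Hx)) as H.
  unfold tau, i1, i2. cbn [fst snd]. rewrite H.
  rewrite !(E_scal (W_expectation N L W1 HW1 x Hx)), !(E_scal (W_expectation N L W2 HW2 x Hx)).
  rewrite (E_ext (W_expectation N L W1 HW1 x Hx) (fun a => (eta * idens N Pstar W1 x a) ^ 2)
     (fun a => eta ^ 2 * idens N Pstar W1 x a ^ 2)) by (intros; ring).
  rewrite (E_ext (W_expectation N L W2 HW2 x Hx) (fun a => ((1 - eta) * idens N Pstar W2 x a) ^ 2)
     (fun a => (1 - eta) ^ 2 * idens N Pstar W2 x a ^ 2)) by (intros; ring).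
  rewrite !(E_scal (W_expectation N L W1 HW1 x Hx)), !(E_scal (W_expectation N L W2 HW2 x Hx)).
  unfold Ex. ring.
Qed.

End Broadcast.

(** * Trajectories of feedback codes and the converse *)

Lemma sumL_seq (n : nat) (f : nat -> R) : sumL (seq 0 n) f = sumR n f.
Proof.
  unfold sumL, sumR. induction (seq 0 n) as [|a l IH]; simpl; [reflexivity|rewrite IH; reflexivity].
Qed.

Lemma sumL_app {A : Type} (l1 l2 : list A) (f : A -> R) : sumL (l1 ++ l2) f = sumL l1 f + sumL l2 f.
Proof. unfold sumL. induction l1 as [|a l1 IH]; simpl; [ring|rewrite IH; ring]. Qed.

Lemma sumL_map {A B : Type} (g : A -> B) (l : list A) (f : B -> R) :
  sumL (map g l) f = sumL l (fun a => f (g a)).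
Proof. unfold sumL. induction l as [|a l IH]; simpl; [reflexivity|rewrite IH; reflexivity]. Qed.

Lemma sumL_ext_in {A : Type} (l : list A) (f g : A -> R) :
  (forall a, In a l -> f a = g a) -> sumL l f = sumL l g.
Proof.
  unfold sumL. induction l as [|a l IH]; simpl; intros H; [reflexivity|].
  rewrite (H a), IH; auto.
Qed.

Lemma sumL_sumR_swap {A : Type} (l : list A) (n : nat) (f : nat -> A -> R) :
  sumR n (fun i => sumL l (f i)) = sumL l (fun a => sumR n (fun i => f i a)).
Proof.
  unfold sumL. induction l as [|a l IH]; simpl; [apply sumR_eq0; reflexivity|].
  rewrite <- IH, <- sumR_plus. reflexivity.
Qed.

Lemma sumL_words_S (A n : nat) (F : list nat -> R) :
  sumL (words A (S n)) F = sumL (words A n) (fun s => sumR A (fun a => F (s ++ a :: nil))).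
Proof.
  simpl words. induction (words A n) as [|s l IH]; [reflexivity|].
  simpl flat_map. rewrite sumL_app, IH, sumL_map, sumL_seq. reflexivity.
Qed.

Lemma in_words (A n : nat) (s : list nat) :
  In s (words A n) -> length s = n /\ List.Forall (fun y => (y < A)%nat) s.
Proof.
  revert s. induction n as [|n IH]; simpl; intros s H.
  - destruct H as [<-|[]]. auto.
  - apply in_flat_map in H. destruct H as [t [Ht H]]. apply in_map_iff in H.
    destruct H as [a [<- Ha]]. apply in_seq in Ha. destruct (IH t Ht) as [Hl Hf].
    split; [rewrite length_app; simpl; lia|].
    apply Forall_app. split; [exact Hf|constructor; [lia|constructor]].
Qed.

Definition sel {A : Type} (k : bool) (p : A * A) : A := if k then fst p else snd p.

Fixpoint Sid (N : nat) (P : nat -> R) (W : nat -> nat -> R) (xs ys : list nat) : R :=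
  match xs, ys with
  | x :: xs', y :: ys' => idens N P W x y + Sid N P W xs' ys'
  | _, _ => 0
  end.

Lemma Sid_snoc (N : nat) (P : nat -> R) (W : nat -> nat -> R) (xs ys : list nat) (x y : nat) :
  length xs = length ys ->
  Sid N P W (xs ++ x :: nil) (ys ++ y :: nil) = Sid N P W xs ys + idens N P W x y.
Proof.
  revert ys. induction xs as [|a xs IH]; intros [|b ys] H; simpl in *; try discriminate; [ring|].
  rewrite IH by lia. ring.
Qed.

Section Trajectories.
Context (N L : nat) (W1 W2 : nat -> nat -> R)
  (HW1 : is_channel N L W1) (HW2 : is_channel N L W2).

Definition Wsel (k : bool) : nat -> nat -> R := if k then W1 else W2.

Lemma Wsel_channel (k : bool) : is_channel N L (Wsel k).
Proof. destruct k; assumption. Qed.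

Lemma Eo_sel (k : bool) (x : nat) (f : nat -> R) : (x < N)%nat ->
  Eo L W1 W2 x (fun ab => f (sel k ab)) = Ex L (fun y => Wsel k y x) f.
Proof. destruct k; [apply (Eo_fst N)|apply (Eo_snd N)]; auto. Qed.

Definition history : Type := (list nat * (list nat * list nat))%type.

Definition extend (h : history) (x : nat) (ab : nat * nat) : history :=
  (fst h ++ x :: nil, (fst (snd h) ++ fst ab :: nil, snd (snd h) ++ snd ab :: nil)).

Lemma sel_extend (k : bool) (h : history) (x : nat) (ab : nat * nat) :
  sel k (snd (extend h x ab)) = sel k (snd h) ++ sel k ab :: nil.
Proof. destruct k; reflexivity. Qed.

(** What [valid_encoder] demands of past outputs; of the inputs only the length is recorded, to keep
    the words aligned in [Sid_snoc]. *)
Definition supp_tr (n : nat) (h : history) : Prop :=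
  length (fst h) = n /\ (forall k, length (sel k (snd h)) = n) /\
  (forall k, List.Forall (fun y => (y < L)%nat) (sel k (snd h))).

Definition Etr (enc : nat -> nat -> list nat -> list nat -> nat -> R) (j n : nat)
  (F : history -> R) : R :=
  sumL (words N n) (fun xs => sumL (words L n) (fun y1 => sumL (words L n) (fun y2 =>
    traj_prob n enc W1 W2 j xs y1 y2 * F (xs, (y1, y2))))).

Lemma traj_prob_snoc (enc : nat -> nat -> list nat -> list nat -> nat -> R) (j n : nat)
  (xs y1 y2 : list nat) (x a b : nat) :
  length xs = n -> length y1 = n -> length y2 = n ->
  traj_prob (S n) enc W1 W2 j (xs ++ x :: nil) (y1 ++ a :: nil) (y2 ++ b :: nil)
  = traj_prob n enc W1 W2 j xs y1 y2 * (enc n j y1 y2 x * W1 a x * W2 b x).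
Proof.
  intros H0 H1 H2. unfold traj_prob. rewrite prodR_S.
  assert (Hn : forall s c, length s = n -> nth n (s ++ c :: nil) 0%nat = c).
  { intros s c Hs. rewrite app_nth2 by lia. rewrite Hs, Nat.sub_diag. reflexivity. }
  assert (Hf : forall s (c : nat), length s = n -> firstn n (s ++ c :: nil) = s).
  { intros s c Hs. rewrite firstn_app, Hs, Nat.sub_diag, firstn_O, app_nil_r, <- Hs.
    apply firstn_all. }
  rewrite !Hn, !Hf by assumption. f_equal.
  unfold prodR. f_equal. apply map_ext_in. intros i Hi. apply in_seq in Hi.
  rewrite !app_nth1 by lia. rewrite !firstn_app.
  rewrite H1, H2. replace (i - n)%nat with 0%nat by lia. rewrite !firstn_O, !app_nil_r. reflexivity.
Qed.

(** Words grow at the end, so the last channel use can be summed first. This turns the closed sum in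
    [err_prob] into a step-by-step expectation to which induction over time applies. *)
Lemma Etr_S (enc : nat -> nat -> list nat -> list nat -> nat -> R) (j n : nat) (F : history -> R) :
  Etr enc j (S n) F = Etr enc j n (fun h => Ex N (enc n j (fst (snd h)) (snd (snd h))) (fun x =>
    Eo L W1 W2 x (fun ab => F (extend h x ab)))).
Proof.
  unfold Etr. rewrite sumL_words_S. apply sumL_ext_in. intros xs Hxs.
  apply in_words in Hxs. destruct Hxs as [Lxs _].
  rewrite (sumR_ext N _ (fun x => sumL (words L n) (fun y1 => sumL (words L n) (fun y2 =>
    sumR L (fun a => sumR L (fun b =>
    traj_prob (S n) enc W1 W2 j (xs ++ x :: nil) (y1 ++ a :: nil) (y2 ++ b :: nil)
      * F (xs ++ x :: nil, (y1 ++ a :: nil, y2 ++ b :: nil)))))))).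
  2:{ intros x _. rewrite sumL_words_S. apply sumL_ext_in. intros y1 _.
      rewrite <- sumL_sumR_swap. apply sumR_ext. intros a _. rewrite sumL_words_S. reflexivity. }
  rewrite sumL_sumR_swap. apply sumL_ext_in. intros y1 Hy1.
  apply in_words in Hy1. destruct Hy1 as [Ly1 _].
  rewrite sumL_sumR_swap. apply sumL_ext_in. intros y2 Hy2.
  apply in_words in Hy2. destruct Hy2 as [Ly2 _].
  unfold Eo, Ex. rewrite <- sumR_scal. apply sumR_ext. intros x _. cbn [fst snd].
  rewrite <- !sumR_scal. apply sumR_ext. intros a _.
  rewrite <- !sumR_scal. apply sumR_ext. intros b _.
  rewrite traj_prob_snoc by assumption. unfold extend. cbn [fst snd]. ring.
Qed.

Lemma Etr_0 (enc : nat -> nat -> list nat -> list nat -> nat -> R) (j : nat) (F : history -> R) :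
  Etr enc j 0 F = F (nil, (nil, nil)).
Proof. unfold Etr, sumL, traj_prob, prodR. simpl. ring. Qed.

Section Coding.
Context (n M : nat) (enc : nat -> nat -> list nat -> list nat -> nat -> R)
  (Henc : valid_encoder N L n M enc) (j : nat) (Hj : (j < M)%nat).

Lemma enc_expectation (m : nat) (h : history) : (m < n)%nat -> supp_tr m h ->
  expectation (fun x => (x < N)%nat /\ 0 < enc m j (fst (snd h)) (snd (snd h)) x)
    (Ex N (enc m j (fst (snd h)) (snd (snd h)))).
Proof.
  intros Hm [_ [Hl Hf]]. apply Ex_expectation, Henc; auto;
    [apply (Hl true)|apply (Hl false)|apply (Hf true)|apply (Hf false)].
Qed.

Lemma supp_tr_extend (m : nat) (h : history) (x : nat) (ab : nat * nat) :
  supp_tr m h -> supp_o L W1 W2 x ab -> supp_tr (S m) (extend h x ab).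
Proof.
  intros [H0 [Hl Hf]] [[Ha _] [Hb _]]. split; [|split].
  - simpl. rewrite length_app. simpl. lia.
  - intros k. rewrite sel_extend, length_app, Hl. simpl; lia.
  - intros k. rewrite sel_extend. apply Forall_app. split; [apply Hf|].
    constructor; [destruct k; assumption|constructor].
Qed.

Lemma Etr_expectation (m : nat) : (m <= n)%nat -> expectation (supp_tr m) (Etr enc j m).
Proof.
  induction m as [|m IH]; intros Hm.
  - split.
    + intros F G H. rewrite !Etr_0. apply H. split; [reflexivity|].
      split; intros [|]; simpl; auto.
    + intros c F G. rewrite !Etr_0. reflexivity.
    + apply Etr_0.
  - specialize (IH ltac:(lia)). split.
    + intros F G H. rewrite !Etr_S. apply (E_le IH). intros h Hh.
      apply (E_le (enc_expectation m h ltac:(lia) Hh)). intros x [Hx _].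
      apply (E_le (Eo_expectation N L W1 W2 HW1 HW2 x Hx)). intros ab Hab.
      apply H, supp_tr_extend; auto.
    + intros c F G. rewrite !Etr_S, <- (E_lin IH). apply (E_ext IH). intros h Hh.
      rewrite <- (E_lin (enc_expectation m h ltac:(lia) Hh)).
      apply (E_ext (enc_expectation m h ltac:(lia) Hh)). intros x [Hx _].
      apply (E_lin (Eo_expectation N L W1 W2 HW1 HW2 x Hx)).
    + rewrite Etr_S, (E_ext IH _ (fun _ => 1)); [apply (E_one IH)|]. intros h Hh.
      pose proof (enc_expectation m h ltac:(lia) Hh) as HEn.
      rewrite (E_ext HEn _ (fun _ => 1)); [apply (E_one HEn)|]. intros x [Hx _].
      apply (E_one (Eo_expectation N L W1 W2 HW1 HW2 x Hx)).
Qed.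

Context (Pstar : nat -> R) (HPd : is_dist N Pstar) (HPpos : forall x, (x < N)%nat -> 0 < Pstar x).

Fixpoint Eout (q : nat -> R) (m : nat) (H : list nat -> R) : R :=
  match m with
  | O => H nil
  | S m' => Eout q m' (fun ys => Ex L q (fun y => H (ys ++ y :: nil)))
  end.

Lemma Eout_expectation (q : nat -> R) (m : nat) : is_dist L q ->
  expectation (fun _ => True) (Eout q m).
Proof.
  intros Hq. pose proof (Ex_expectation L q Hq) as HE. induction m as [|m IH]; split; simpl; auto.
  - intros F G H. apply (E_le IH). intros ys _. apply (E_le HE). auto.
  - intros c F G. rewrite <- (E_lin IH). apply (E_ext IH). intros ys _. apply (E_lin HE).
  - rewrite (E_ext IH _ (fun _ => 1)); [apply (E_one IH)|]. intros ys _. apply (E_one HE).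
Qed.

(* Change of measure: weighting by [exp (- Sid)] makes the outputs i.i.d. and independent of the
   message, whatever the encoder does. *)
Lemma change_of_measure (k : bool) (m : nat) : (m <= n)%nat ->
  forall H : list nat -> R, (forall ys, 0 <= H ys) ->
  Etr enc j m (fun h => H (sel k (snd h)) * exp (- Sid N Pstar (Wsel k) (fst h) (sel k (snd h))))
  <= Eout (PW N Pstar (Wsel k)) m H.
Proof.
  pose proof (Wsel_channel k) as HWk. pose proof (PW_dist N L _ HWk Pstar HPd) as Hq.
  induction m as [|m IH]; intros Hm H H0.
  - rewrite Etr_0. simpl. destruct k; simpl; rewrite Ropp_0, exp_0; lra.
  - rewrite Etr_S. simpl Eout.
    apply Rle_trans with (2 := IH ltac:(lia)
      (fun ys => Ex L (PW N Pstar (Wsel k)) (fun y => H (ys ++ y :: nil)))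
      (fun ys => E_nonneg (Ex_expectation _ _ Hq) _ (fun y _ => H0 (ys ++ y :: nil)))).
    pose proof (Etr_expectation m ltac:(lia)) as HEm.
    apply (E_le HEm). intros h Hh.
    pose proof (enc_expectation m h ltac:(lia) Hh) as HEn. apply (E_upper HEn). intros x [Hx _].
    pose proof (Eo_expectation N L W1 W2 HW1 HW2 x Hx) as HEo.
    set (ys := sel k (snd h)). set (s := Sid N Pstar (Wsel k) (fst h) ys).
    rewrite (E_ext HEo _ (fun ab => exp (- s) * (fun y => H (ys ++ y :: nil)
       * exp (- idens N Pstar (Wsel k) x y)) (sel k ab))).
    2:{ intros ab _. rewrite sel_extend. fold ys. unfold extend. cbn [fst snd].
        rewrite Sid_snoc by (destruct Hh as [E1 [E2 _]]; unfold ys; rewrite E1, E2; reflexivity).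
        fold s. rewrite Ropp_plus_distr, exp_plus. ring. }
    rewrite (E_scal HEo), Rmult_comm.
    apply Rmult_le_compat_r; [left; apply exp_pos|].
    rewrite (Eo_sel k x (fun y => H (ys ++ y :: nil) * exp (- idens N Pstar (Wsel k) x y)) Hx).
    apply sumR_le. intros y Hy.
    pose proof (PW_nonneg N L _ HWk Pstar y HPd Hy) as Hpw.
    specialize (H0 (ys ++ y :: nil)).
    destruct (W_nonneg N L _ HWk x y Hx Hy) as [Hw|Hw]; [|rewrite <- Hw; nra].
    pose proof (PW_pos N L _ HWk Pstar x y HPd Hx Hy (HPpos x Hx) Hw) as Hp.
    unfold idens. rewrite exp_Ropp, exp_ln by (apply Rdiv_lt_0_compat; lra).
    right. field. lra.
Qed.

End Coding.
End Trajectories.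

(** * Upper bound on the code size *)

Section Converse.
Context (N L : nat) (W1 W2 : nat -> nat -> R)
  (HW1 : is_channel N L W1) (HW2 : is_channel N L W2)
  (Pstar : nat -> R) (HPd : is_dist N Pstar)
  (HPpos : forall x, (x < N)%nat -> 0 < Pstar x)
  (eta cap : R) (Heta01 : 0 < eta < 1)
  (Htau : forall x, (x < N)%nat ->
     Eo L W1 W2 x (fun ab => eta * idens N Pstar W1 x (fst ab)
       + (1 - eta) * idens N Pstar W2 x (snd ab)) = cap).

Definition Tid (h : history) : R :=
  eta * Sid N Pstar W1 (fst h) (fst (snd h)) + (1 - eta) * Sid N Pstar W2 (fst h) (snd (snd h)).

(** A sum in place of the maximum over the letters: any bound on the conditional variance that is
    uniform in the input suffices. *)
Definition vmax : R := sumR N (fun x => Eo L W1 W2 x (fun ab =>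
  (eta * idens N Pstar W1 x (fst ab) + (1 - eta) * idens N Pstar W2 x (snd ab) - cap) ^ 2)).

Lemma vmax_nonneg : 0 <= vmax.
Proof.
  apply sumR_nonneg. intros x Hx. apply (E_nonneg (Eo_expectation N L W1 W2 HW1 HW2 x Hx)).
  intros; apply pow2_ge_0.
Qed.

(* The conditional mean of each increment is [cap] for every input, so the increments are
   orthogonal whatever the encoder does. *)
Lemma Tid_second_moment (n M : nat) (enc : nat -> nat -> list nat -> list nat -> nat -> R) (j : nat) :
  valid_encoder N L n M enc -> (j < M)%nat -> forall m, (m <= n)%nat ->
  Etr N L W1 W2 enc j m (fun h => (Tid h - INR m * cap) ^ 2) <= INR m * vmax.
Proof.
  intros Henc Hj. induction m as [|m IH]; intros Hm.
  - rewrite Etr_0. unfold Tid. simpl. lra.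
  - rewrite Etr_S. specialize (IH ltac:(lia)). rewrite S_INR.
    pose proof (Etr_expectation N L W1 W2 HW1 HW2 n M enc Henc j Hj m ltac:(lia)) as HEm.
    apply Rle_trans with (Etr N L W1 W2 enc j m (fun h => (Tid h - INR m * cap) ^ 2 + vmax)).
    2:{ rewrite (E_plus HEm), (E_const HEm). lra. }
    apply (E_le HEm). intros h Hh.
    apply (E_upper (enc_expectation N L n M enc Henc j Hj m h ltac:(lia) Hh)). intros x [Hx _].
    pose proof (Eo_expectation N L W1 W2 HW1 HW2 x Hx) as HEo.
    set (f := fun ab => eta * idens N Pstar W1 x (fst ab) + (1 - eta) * idens N Pstar W2 x (snd ab) - cap).
    assert (Hf0 : Eo L W1 W2 x f = 0).
    { rewrite (E_ext HEo f (fun ab => 1 * (eta * idens N Pstar W1 x (fst ab)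
        + (1 - eta) * idens N Pstar W2 x (snd ab)) + - cap)) by (intros; unfold f; ring).
      rewrite (E_lin HEo), (Htau x Hx), (E_const HEo). ring. }
    set (d := Tid h - INR m * cap).
    rewrite (E_ext HEo _ (fun ab => d ^ 2 + 2 * d * f ab + 1 * f ab ^ 2)).
    + rewrite (E_affine HEo), Hf0.
      assert (Eo L W1 W2 x (fun ab => f ab ^ 2) <= vmax); [|lra].
      apply (sumR_ge_term N x (fun x => Eo L W1 W2 x (fun ab =>
        (eta * idens N Pstar W1 x (fst ab) + (1 - eta) * idens N Pstar W2 x (snd ab) - cap) ^ 2)));
        [|exact Hx].
      intros x' Hx'. apply (E_nonneg (Eo_expectation N L W1 W2 HW1 HW2 x' Hx')).
      intros; apply pow2_ge_0.
    + intros ab _. unfold d, f, Tid, extend. cbn [fst snd].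
      destruct Hh as [H0 [Hl _]]. pose proof (Hl true) as H1. pose proof (Hl false) as H2.
      cbn [sel] in H1, H2. rewrite !Sid_snoc by congruence. ring.
Qed.

Definition hit (g : list nat -> nat) (j : nat) (ys : list nat) : R :=
  if Nat.eqb (g ys) j then 1 else 0.

Lemma hit_sum_le (g : list nat -> nat) (M : nat) (ys : list nat) :
  sumR M (fun j => hit g j ys) <= 1.
Proof.
  unfold hit. destruct (Nat.lt_ge_cases (g ys) M) as [H|H].
  - rewrite (sumR_ext M _ (fun j => if Nat.eqb j (g ys) then 1 else 0)).
    + rewrite (sumR_single M (g ys) (fun _ => 1) H). lra.
    + intros; rewrite Nat.eqb_sym; reflexivity.
  - rewrite sumR_eq0; [lra|]. intros j Hj. destruct (Nat.eqb_spec (g ys) j); [lia|reflexivity].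
Qed.

(** The indicator of S <= th is at most exp (th - S). After the change of measure the outputs carry
    no information about the message, and a decoder names at most one message, so the hits sum to at
    most one. *)
Lemma hit_below_threshold (k : bool) (n M : nat)
  (enc : nat -> nat -> list nat -> list nat -> nat -> R) (g : list nat -> nat) (th : R) :
  valid_encoder N L n M enc ->
  sumR M (fun j => Etr N L W1 W2 enc j n (fun h =>
    hit g j (sel k (snd h)) * ind_le (Sid N Pstar (Wsel W1 W2 k) (fst h) (sel k (snd h))) th))
  <= exp th.
Proof.
  intros Henc. pose proof (Wsel_channel N L W1 W2 HW1 HW2 k) as HWk.
  set (q := PW N Pstar (Wsel W1 W2 k)).
  pose proof (Eout_expectation L q n (PW_dist N L _ HWk Pstar HPd)) as HEq.
  assert (Hh : forall j ys, 0 <= hit g j ys) by (intros; unfold hit; destruct Nat.eqb; lra).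
  apply Rle_trans with (sumR M (fun j => exp th * Eout L q n (hit g j))).
  - apply sumR_le. intros j Hj.
    pose proof (Etr_expectation N L W1 W2 HW1 HW2 n M enc Henc j Hj n (le_n n)) as HE.
    apply Rle_trans with (Etr N L W1 W2 enc j n (fun h => exp th * (hit g j (sel k (snd h))
       * exp (- Sid N Pstar (Wsel W1 W2 k) (fst h) (sel k (snd h)))))).
    + apply (E_le HE). intros h _. specialize (Hh j (sel k (snd h))).
      set (s := Sid _ _ _ _ _). unfold ind_le.
      pose proof (exp_pos th). pose proof (exp_pos (- s)).
      replace (exp th * (hit g j (sel k (snd h)) * exp (- s)))
        with (hit g j (sel k (snd h)) * (exp th * exp (- s))) by ring.
      apply Rmult_le_compat_l; [exact Hh|].
      rewrite <- exp_plus. destruct Rle_dec as [Hs|_]; [|left; apply exp_pos].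
      rewrite <- exp_0. apply exp_mono; lra.
    + rewrite (E_scal HE). apply Rmult_le_compat_l; [left; apply exp_pos|].
      apply (change_of_measure N L W1 W2 HW1 HW2 n M enc Henc j Hj Pstar HPd HPpos k n (le_n n)).
      apply Hh.
  - rewrite sumR_scal, <- (E_sumR HEq).
    assert (H : Eout L q n (fun ys => sumR M (fun j => hit g j ys)) <= 1)
      by (apply (E_upper HEq); intros; apply hit_sum_le).
    pose proof (exp_pos th). nra.
Qed.

Lemma err_prob_Etr (k : bool) (n M : nat) (enc : nat -> nat -> list nat -> list nat -> nat -> R)
  (g : list nat -> nat) :
  err_prob N L n M W1 W2 enc (fun a b => sel k (a, b)) g
  = / INR M * sumR M (fun j => Etr N L W1 W2 enc j n (fun h =>
      if Nat.eqb (g (sel k (snd h))) j then 0 else 1)).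
Proof. reflexivity. Qed.

(** For every trajectory 1 is bounded by five terms: an error of either decoder, a Chebyshev term
    for T, or a correct decision of either decoder while its own density sum is below th. *)
Lemma converse_bound (n M : nat) (eps K : R) : (1 <= n)%nat -> 0 < K ->
  FLF_code N L W1 W2 n M eps ->
  1 <= 2 * eps + vmax / K ^ 2 + 2 * exp (INR n * cap + K * sqrt (INR n)) / INR M.
Proof.
  intros Hn HK [HM [enc [g1 [g2 [Henc [He1 He2]]]]]].
  assert (HM0 : 0 < INR M) by (apply lt_0_INR; lia).
  assert (Hn0 : 0 < INR n) by (apply lt_0_INR; lia).
  assert (HKn : 0 < K ^ 2 * INR n) by (apply Rmult_lt_0_compat; [apply pow_lt|]; lra).
  set (th := INR n * cap + K * sqrt (INR n)).
  change (err_prob N L n M W1 W2 enc (fun a b => sel true (a, b)) g1 <= eps) in He1.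
  change (err_prob N L n M W1 W2 enc (fun a b => sel false (a, b)) g2 <= eps) in He2.
  rewrite err_prob_Etr in He1, He2.
  pose proof (hit_below_threshold true n M enc g1 th Henc) as Hb1.
  pose proof (hit_below_threshold false n M enc g2 th Henc) as Hb2.
  set (e1 := sumR M _) in He1. set (e2 := sumR M _) in He2.
  set (b1 := sumR M _) in Hb1. set (b2 := sumR M _) in Hb2.
  assert (H : INR M * 1 <= e1 + e2 + INR M * (vmax / K ^ 2) + b1 + b2).
  { unfold e1, e2, b1, b2. rewrite <- !sumR_const, <- !sumR_plus. apply sumR_le. intros j Hj.
    pose proof (Etr_expectation N L W1 W2 HW1 HW2 n M enc Henc j Hj n (le_n n)) as HE.
    assert (Hm : Etr N L W1 W2 enc j n (fun h => / (K ^ 2 * INR n) * (Tid h - INR n * cap) ^ 2)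
              <= vmax / K ^ 2).
    { rewrite (E_scal HE).
      pose proof (Tid_second_moment n M enc j Henc Hj n (le_n n)) as H2.
      replace (vmax / K ^ 2) with (/ (K ^ 2 * INR n) * (INR n * vmax)) by (field; lra).
      apply Rmult_le_compat_l; [|exact H2]. left. apply Rinv_0_lt_compat, HKn. }
    eapply Rle_trans; [|apply Rplus_le_compat_r, Rplus_le_compat_r, Rplus_le_compat_l, Hm].
    rewrite <- !(E_plus HE).
    apply Rle_trans with (Etr N L W1 W2 enc j n (fun _ => 1)); [rewrite (E_one HE); lra|].
    apply (E_le HE). intros h _.
    unfold hit, ind_le. cbn [sel Wsel].
    assert (Hc : 0 <= / (K ^ 2 * INR n) * (Tid h - INR n * cap) ^ 2).
    { apply Rmult_le_pos; [left; apply Rinv_0_lt_compat, HKn|apply pow2_ge_0]. }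
    destruct (Nat.eqb (g1 (fst (snd h))) j), (Nat.eqb (g2 (snd (snd h))) j);
      repeat destruct Rle_dec; try lra.
    (* The remaining case: both decoders are right and both sums exceed th. So does their convex
       combination T, and the Chebyshev term alone reaches 1. *)
    assert (HT : th <= Tid h) by (unfold Tid; nra).
    assert (HT' : K * sqrt (INR n) <= Tid h - INR n * cap) by (unfold th in HT; lra).
    assert (1 <= / (K ^ 2 * INR n) * (Tid h - INR n * cap) ^ 2); [|lra].
    apply Rmult_le_reg_l with (K ^ 2 * INR n); [exact HKn|].
    rewrite <- Rmult_assoc, Rinv_r, Rmult_1_l, Rmult_1_r by lra.
    assert (Hs : 0 < sqrt (INR n)) by (apply sqrt_lt_R0; lra).
    replace (K ^ 2 * INR n) with ((K * sqrt (INR n)) ^ 2)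
      by (rewrite Rpow_mult_distr, pow2_sqrt; lra).
    apply pow_incr. split; [nra|lra]. }
  assert (E1 : e1 <= INR M * eps).
  { apply Rmult_le_reg_l with (/ INR M); [apply Rinv_0_lt_compat; lra|].
    rewrite <- Rmult_assoc, Rinv_l by lra. lra. }
  assert (E2 : e2 <= INR M * eps).
  { apply Rmult_le_reg_l with (/ INR M); [apply Rinv_0_lt_compat; lra|].
    rewrite <- Rmult_assoc, Rinv_l by lra. lra. }
  apply Rmult_le_reg_l with (INR M); [lra|].
  replace (INR M * (2 * eps + vmax / K ^ 2 + 2 * exp th / INR M))
    with (INR M * eps + INR M * eps + INR M * (vmax / K ^ 2) + exp th + exp th) by (field; lra).
  lra.
Qed.

Lemma converse (eps : R) : eps < / 2 ->
  exists K2, forall n M, (1 <= n)%nat -> FLF_code N L W1 W2 n M eps ->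
    ln (INR M) <= INR n * cap + K2 * sqrt (INR n).
Proof.
  intros He. pose proof vmax_nonneg as Hv.
  set (d := 1 - 2 * eps). assert (Hd : 0 < d) by (unfold d; lra).
  (* Makes the Chebyshev term at most d / 2; the other half of d = 1 - 2 eps must come from exp th /
     M, which bounds M. *)
  set (K := 1 + 2 * vmax / d).
  assert (Hq : 0 <= 2 * vmax / d) by (apply Rdiv_le_0_compat; lra).
  assert (HK : vmax / K ^ 2 <= d / 2).
  { apply Rle_div_l; [unfold K; nra|].
    replace vmax with (d / 2 * (2 * vmax / d)) at 1 by (field; lra).
    apply Rmult_le_compat_l; [lra|]. fold K. replace (2 * vmax / d) with (K - 1) by (unfold K; ring).
    assert (1 <= K) by (unfold K; lra). nra. }
  exists (K + Rabs (ln (4 / d))). intros n M Hn Hcode.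
  assert (HM0 : 0 < INR M) by (destruct Hcode as [HM _]; apply lt_0_INR; lia).
  pose proof (converse_bound n M eps K Hn ltac:(unfold K; lra) Hcode) as H.
  set (th := INR n * cap + K * sqrt (INR n)) in *.
  pose proof (exp_pos th) as Hexp.
  assert (H1 : INR M <= 4 / d * exp th).
  { assert (H2 : d / 2 <= 2 * exp th / INR M) by (unfold d in *; lra).
    apply Rmult_le_compat_r with (r := INR M) in H2; [|lra].
    replace (2 * exp th / INR M * INR M) with (2 * exp th) in H2 by (field; lra).
    apply Rmult_le_reg_l with (d / 2); [lra|].
    replace (d / 2 * (4 / d * exp th)) with (2 * exp th) by (field; lra). lra. }
  apply ln_le in H1; [|lra].
  rewrite ln_mult, ln_exp in H1 by (try apply Rdiv_lt_0_compat; lra).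
  assert (Hs : 1 <= sqrt (INR n)).
  { rewrite <- sqrt_1. apply sqrt_le_1_alt. apply (le_INR 1), Hn. }
  pose proof (Rle_abs (ln (4 / d))). pose proof (Rabs_pos (ln (4 / d))).
  unfold th in H1. nra.
Qed.

End Converse.

(** * Random code trees *)

Lemma sumR_lt_restrict (M k : nat) (f : nat -> R) : (k <= M)%nat ->
  sumR M (fun j => if Nat.ltb j k then f j else 0) = sumR k f.
Proof.
  induction M as [|M IH]; intros Hk.
  - replace k with 0%nat by lia. reflexivity.
  - rewrite sumR_S. destruct (Nat.ltb_spec M k) as [H|H].
    + replace k with (S M) by lia. rewrite sumR_S. f_equal. apply sumR_ext.
      intros i Hi. destruct (Nat.ltb_spec i (S M)); [reflexivity|lia].
    + rewrite IH by lia. ring.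
Qed.

Lemma Ex_delta (n k : nat) (G : nat -> R) : (k < n)%nat ->
  Ex n (fun x => if Nat.eqb x k then 1 else 0) G = G k.
Proof.
  intros Hk. unfold Ex. rewrite (sumR_ext n _ (fun x => if Nat.eqb x k then G x else 0)).
  - apply sumR_single, Hk.
  - intros i _. destruct Nat.eqb; ring.
Qed.

Lemma delta_dist (n k : nat) : (k < n)%nat -> is_dist n (fun x => if Nat.eqb x k then 1 else 0).
Proof.
  intros Hk. split; [intros x _; destruct Nat.eqb; lra|].
  apply (sumR_single n k (fun _ => 1) Hk).
Qed.

Definition Ecoin (F : bool -> R) : R := (F true + F false) / 2.

Lemma Ecoin_expectation : expectation (fun _ => True) Ecoin.
Proof.
  unfold Ecoin. split.
  - intros F G H. pose proof (H true I). pose proof (H false I). lra.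
  - intros; field.
  - field.
Qed.

Section Family.
Context {B : Type} (b0 : B) (D : nat -> (B -> R) -> R).

(** Independent draws from [D 0] up to [D (K - 1)] stored as a function; indices from K on keep the
    default [b0]. *)
Fixpoint Efam (K : nat) (F : (nat -> B) -> R) : R :=
  match K with
  | O => F (fun _ => b0)
  | S K' => Efam K' (fun u => D K' (fun w => F (fun l => if Nat.eqb l K' then w else u l)))
  end.

Lemma Efam_expectation (sD : nat -> B -> Prop) (K : nat) :
  (forall l, (l < K)%nat -> expectation (sD l) (D l)) ->
  expectation (fun u => forall l, (l < K)%nat -> sD l (u l)) (Efam K).
Proof.
  induction K as [|K IH]; intros HD.
  - split; simpl; auto. intros F G H. apply H. intros; lia.
  - specialize (IH (fun l Hl => HD l ltac:(lia))). pose proof (HD K ltac:(lia)) as HK.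
    split; simpl.
    + intros F G H. apply (E_le IH). intros u Hu. apply (E_le HK). intros w Hw.
      apply H. intros l Hl. destruct (Nat.eqb_spec l K) as [->|Hne]; [exact Hw|apply Hu; lia].
    + intros c F G. rewrite <- (E_lin IH). apply (E_ext IH). intros u Hu. apply (E_lin HK).
    + rewrite (E_ext IH _ (fun _ => 1)); [apply (E_one IH)|]. intros; apply (E_one HK).
Qed.

Lemma Efam_marginal (sD : nat -> B -> Prop) (K l : nat) (g : B -> R) :
  (forall l, (l < K)%nat -> expectation (sD l) (D l)) -> (l < K)%nat ->
  Efam K (fun u => g (u l)) = D l g.
Proof.
  induction K as [|K IH]; intros HD Hl; [lia|]. simpl.
  assert (HD' : forall l, (l < K)%nat -> expectation (sD l) (D l)) by (intros; apply HD; lia).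
  destruct (Nat.eqb_spec l K) as [->|Hne].
  - apply (E_const (Efam_expectation sD K HD')).
  - rewrite <- (IH HD') by lia. apply (E_ext (Efam_expectation sD K HD')). intros u _.
    apply (E_const (HD K ltac:(lia))).
Qed.
End Family.

(** * Transmission of fixed words and likelihood ratios *)

Section Memoryless.
Context (N L : nat) (W1 W2 : nat -> nat -> R)
  (HW1 : is_channel N L W1) (HW2 : is_channel N L W2).

Lemma Eo_ext (x : nat) (F G : nat * nat -> R) : (forall ab, F ab = G ab) -> Eo L W1 W2 x F = Eo L W1 W2 x G.
Proof.
  intros H. apply sumR_ext. intros a _. f_equal. apply sumR_ext. intros b _. f_equal. apply H.
Qed.

Lemma Eo_swap {A : Type} {s : A -> Prop} {E : (A -> R) -> R} (HE : expectation s E)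
  (x : nat) (G : A -> nat * nat -> R) :
  E (fun u => Eo L W1 W2 x (G u)) = Eo L W1 W2 x (fun ab => E (fun u => G u ab)).
Proof.
  unfold Eo, Ex. rewrite (E_sumR HE L (fun a u => W1 a x * sumR L (fun b => W2 b x * G u (a, b)))).
  apply sumR_ext. intros a _. rewrite (E_scal HE). f_equal.
  rewrite (E_sumR HE L (fun b u => W2 b x * G u (a, b))).
  apply sumR_ext. intros b _. apply (E_scal HE).
Qed.

Fixpoint Ech (w : list nat) (F : list nat * list nat -> R) : R :=
  match w with
  | nil => F (nil, nil)
  | x :: w' => Eo L W1 W2 x (fun ab => Ech w' (fun ys => F (fst ab :: fst ys, snd ab :: snd ys)))
  end.

Definition in_range (A : nat) (w : list nat) : Prop := List.Forall (fun x => (x < A)%nat) w.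

Definition supp_ch (w : list nat) (ys : list nat * list nat) : Prop :=
  forall k, length (sel k ys) = length w /\ in_range L (sel k ys).

Lemma Ech_expectation (w : list nat) : in_range N w -> expectation (supp_ch w) (Ech w).
Proof.
  induction w as [|x w IH]; intros Hw.
  - split; simpl; auto. intros F G H. apply H. intros [|]; split; simpl; auto; constructor.
  - inversion Hw as [|? ? Hx Hw']; subst. specialize (IH Hw').
    pose proof (Eo_expectation N L W1 W2 HW1 HW2 x Hx) as HEo. split; simpl.
    + intros F G H. apply (E_le HEo). intros ab [[Ha _] [Hb _]]. apply (E_le IH).
      intros ys Hys. apply H. intros k. destruct (Hys k) as [Hl Hr].
      destruct k; simpl in *; (split; [lia|constructor; auto]).
    + intros c F G. rewrite <- (E_lin HEo). apply (E_ext HEo). intros ab _. apply (E_lin IH).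
    + rewrite (E_ext HEo _ (fun _ => 1)); [apply (E_one HEo)|]. intros; apply (E_one IH).
Qed.

Lemma Ech_ext (w : list nat) (F G : list nat * list nat -> R) :
  (forall ys, F ys = G ys) -> Ech w F = Ech w G.
Proof.
  revert F G. induction w as [|x w IH]; intros F G H; simpl; [apply H|].
  apply Eo_ext. intros ab. apply IH. intros; apply H.
Qed.

Lemma Ech_app (w1 w2 : list nat) (F : list nat * list nat -> R) :
  Ech (w1 ++ w2) F = Ech w1 (fun y => Ech w2 (fun z => F (fst y ++ fst z, snd y ++ snd z))).
Proof.
  revert F. induction w1 as [|x w1 IH]; intros F; simpl.
  - apply Ech_ext. intros [y z]; reflexivity.
  - apply Eo_ext. intros ab. rewrite IH. reflexivity.
Qed.

Lemma Ech_snoc (w : list nat) (x : nat) (F : list nat * list nat -> R) :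
  Ech (w ++ x :: nil) F
  = Ech w (fun y => Eo L W1 W2 x (fun ab => F (fst y ++ fst ab :: nil, snd y ++ snd ab :: nil))).
Proof. rewrite Ech_app. reflexivity. Qed.

Lemma Ech_swap {A : Type} {s : A -> Prop} {E : (A -> R) -> R} (HE : expectation s E)
  (w : list nat) (H : A -> list nat * list nat -> R) :
  E (fun u => Ech w (H u)) = Ech w (fun ys => E (fun u => H u ys)).
Proof.
  revert H. induction w as [|x w IH]; intros H; simpl; [reflexivity|].
  rewrite (Eo_swap HE). apply Eo_ext. intros ab. apply IH.
Qed.

Definition inputs (c : list (nat * (nat * nat))) : list nat := map fst c.
Definition outputs (c : list (nat * (nat * nat))) : list nat * list nat :=
  (map (fun t => fst (snd t)) c, map (fun t => snd (snd t)) c).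

(** Drawing a whole word and then transmitting it is the same as drawing independent triples of
    input and outputs: [Eo_swap] moves the choice of later letters past the first channel use. *)
Lemma Ew_Ech (P : nat -> R) (m : nat) (F : list nat -> list nat * list nat -> R) : is_dist N P ->
  Eit (Ex N P) m (fun w => Ech w (F w)) = Eit (E3 N L W1 W2 P) m (fun c => F (inputs c) (outputs c)).
Proof.
  intros HP. pose proof (Ex_expectation N P HP) as HE. revert F.
  induction m as [|m IH]; intros F; simpl; [reflexivity|].
  apply (E_ext HE). intros x _.
  rewrite (Eo_swap (Eit_expectation HE m) x
    (fun w ab => Ech w (fun ys => F (x :: w) (fst ab :: fst ys, snd ab :: snd ys)))).
  apply Eo_ext. intros ab.
  rewrite (IH (fun w ys => F (x :: w) (fst ab :: fst ys, snd ab :: snd ys))). reflexivity.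
Qed.

(* Not [exp (Sid ...)]: since [ln 0 = 0], [Sid] does not see letters with [W b x = 0], which must
   rule out a codeword. *)
Fixpoint Rt (P : nat -> R) (W : nat -> nat -> R) (w y : list nat) : R :=
  match w, y with
  | x :: w', b :: y' => W b x / PW N P W b * Rt P W w' y'
  | _, _ => 1
  end.

Lemma ratio_nonneg (P : nat -> R) (W : nat -> nat -> R) (x b : nat) : is_channel N L W ->
  is_dist N P -> (x < N)%nat -> 0 < P x -> (b < L)%nat -> 0 <= W b x / PW N P W b.
Proof.
  intros HW HP Hx Hp Hb. destruct (W_nonneg N L W HW x b Hx Hb) as [H|H].
  - apply Rdiv_le_0_compat; [lra|]. apply (PW_pos N L W HW P x b); auto.
  - rewrite <- H. unfold Rdiv. lra.
Qed.

Lemma Rt_nonneg (P : nat -> R) (W : nat -> nat -> R) (w y : list nat) : is_channel N L W ->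
  is_dist N P -> List.Forall (fun x => (x < N)%nat /\ 0 < P x) w -> in_range L y ->
  0 <= Rt P W w y.
Proof.
  intros HW HP Hw. revert y. induction Hw as [|x w [Hx Hp] Hw IH]; intros y Hy; simpl; [lra|].
  destruct Hy as [|b y Hb Hy]; [lra|]. apply Rmult_le_pos; [|apply IH, Hy].
  apply ratio_nonneg; auto.
Qed.

(** For a fixed output the likelihood ratio averages to one over an independent random word; it is
    less when some output letter has probability zero. *)
Lemma Ew_Rt_le (P : nat -> R) (W : nat -> nat -> R) (m : nat) (y : list nat) :
  is_channel N L W -> is_dist N P -> in_range L y -> Eit (Ex N P) m (fun w => Rt P W w y) <= 1.
Proof.
  intros HW HP. pose proof (Ex_expectation N P HP) as HE. revert y.
  induction m as [|m IH]; intros y Hy; [simpl; lra|].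
  destruct Hy as [|b y Hb Hy].
  - pose proof (Eit_expectation HE (S m)) as HES. rewrite (E_ext HES _ (fun _ => 1)).
    + right. apply (E_one HES).
    + intros [|] _; reflexivity.
  - simpl. pose proof (Eit_expectation HE m) as HEm.
    rewrite (E_ext HE _ (fun x => Eit (Ex N P) m (fun w => Rt P W w y) * (W b x / PW N P W b))).
    2:{ intros x _. rewrite (E_scal HEm). ring. }
    rewrite (E_scal HE). specialize (IH y Hy).
    assert (H0 : 0 <= Eit (Ex N P) m (fun w => Rt P W w y)).
    { apply (E_nonneg HEm). intros w [_ Hw]. apply Rt_nonneg; auto. }
    assert (H1 : Ex N P (fun x => W b x / PW N P W b) <= 1).
    { unfold Ex. rewrite (sumR_ext N _ (fun x => / PW N P W b * (P x * W b x)))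
        by (intros; unfold Rdiv; ring).
      rewrite sumR_scal. fold (PW N P W b).
      destruct (PW_nonneg N L W HW P b HP Hb) as [H|H].
      - rewrite Rinv_l; lra.
      - rewrite <- H. lra. }
    assert (H2 : 0 <= Ex N P (fun x => W b x / PW N P W b)).
    { apply (E_nonneg HE). intros x [Hx Hp]. apply ratio_nonneg; auto. }
    nra.
Qed.

Definition isel (k : bool) (P : nat -> R) (t : nat * (nat * nat)) : R :=
  idens N P (Wsel W1 W2 k) (fst t) (sel k (snd t)).

Lemma Rt_exp (k : bool) (P : nat -> R) (c : list (nat * (nat * nat))) : is_dist N P ->
  List.Forall (supp3 N L W1 W2 P) c ->
  Rt P (Wsel W1 W2 k) (inputs c) (sel k (outputs c)) = exp (sumL c (isel k P)).
Proof.
  intros HP Hc. pose proof (Wsel_channel N L W1 W2 HW1 HW2 k) as HWk.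
  induction Hc as [|t c [[Hx Hp] [[Ha Hwa] [Hb Hwb]]] Hc IH].
  - destruct k; simpl; rewrite exp_0; reflexivity.
  - change (sumL (t :: c) (isel k P)) with (isel k P t + sumL c (isel k P)).
    rewrite exp_plus, <- IH.
    replace (sel k (outputs (t :: c))) with (sel k (snd t) :: sel k (outputs c))
      by (destruct k; reflexivity).
    change (Rt P (Wsel W1 W2 k) (inputs (t :: c)) (sel k (snd t) :: sel k (outputs c)))
      with (Wsel W1 W2 k (sel k (snd t)) (fst t) / PW N P (Wsel W1 W2 k) (sel k (snd t))
            * Rt P (Wsel W1 W2 k) (inputs c) (sel k (outputs c))).
    f_equal. unfold isel, idens.
    assert (Hy : (sel k (snd t) < L)%nat) by (destruct k; assumption).
    assert (Hw : 0 < Wsel W1 W2 k (sel k (snd t)) (fst t)) by (destruct k; assumption).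
    rewrite exp_ln; [reflexivity|]. apply Rdiv_lt_0_compat; [exact Hw|].
    apply (PW_pos N L _ HWk P (fst t)); auto.
Qed.

End Memoryless.

Definition b2R (b : bool) : R := if b then 1 else 0.

Lemma b2R_bounds (b : bool) : 0 <= b2R b <= 1.
Proof. destruct b; simpl; lra. Qed.

Lemma firstn_S_nth (w : list nat) (i : nat) : (i < length w)%nat ->
  firstn (S i) w = firstn i w ++ nth i w 0%nat :: nil.
Proof.
  revert i. induction w as [|x w IH]; intros i Hi; [simpl in Hi; lia|].
  destruct i as [|i]; [reflexivity|]. simpl in *. rewrite <- IH by lia. reflexivity.
Qed.

Lemma combine_triples (c : list (nat * (nat * nat))) :
  combine (inputs c) (combine (fst (outputs c)) (snd (outputs c))) = c.
Proof.
  induction c as [|[x [a b]] c IH]; [reflexivity|]. simpl in *. rewrite IH. reflexivity.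
Qed.

Section LastIndex.
Context {A : Type} (phi : A -> list nat -> bool) (us : nat -> A).

(** With the largest accepted index, message j is lost only if its own tree rejects or a later tree
    accepts. Hence only confusions of a new tree with earlier ones count, which is what a greedy
    choice can control. *)
Fixpoint last_accepted (M : nat) (y : list nat) : nat :=
  match M with
  | O => 0%nat
  | S m => if phi (us m) y then m else last_accepted m y
  end.

Lemma last_accepted_error (M j : nat) (y : list nat) : (j < M)%nat ->
  (if Nat.eqb (last_accepted M y) j then 0 else 1)
  <= (1 - b2R (phi (us j) y))
     + sumR M (fun i => if Nat.ltb j i then b2R (phi (us i) y) else 0).
Proof.
  induction M as [|M IH]; intros Hj; [lia|]. simpl last_accepted. rewrite sumR_S.
  assert (Hs : 0 <= sumR M (fun i => if Nat.ltb j i then b2R (phi (us i) y) else 0)).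
  { apply sumR_nonneg. intros i _. destruct Nat.ltb; [apply b2R_bounds|lra]. }
  pose proof (b2R_bounds (phi (us j) y)). pose proof (b2R_bounds (phi (us M) y)).
  destruct (Nat.eq_dec j M) as [->|Hne].
  - rewrite Nat.ltb_irrefl. destruct (phi (us M) y).
    + rewrite Nat.eqb_refl. lra.
    + change (b2R false) with 0 in *. destruct Nat.eqb; lra.
  - destruct (Nat.ltb_spec j M); [|lia]. specialize (IH ltac:(lia)).
    destruct (phi (us M) y).
    + change (b2R true) with 1. destruct (Nat.eqb M j); lra.
    + change (b2R false) with 0. lra.
Qed.
End LastIndex.

(** * Codes from random trees *)

Section Coding.
Context (N L : nat) (W1 W2 : nat -> nat -> R)
  (HW1 : is_channel N L W1) (HW2 : is_channel N L W2)
  (n1 m K : nat) (P0 : nat -> R) (Pm : nat -> nat -> R) (gam : R)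
  (md : bool -> list (nat * (nat * nat)) -> nat)
  (HP0 : is_dist N P0) (HPm : forall l, (l < K)%nat -> is_dist N (Pm l))
  (Hmd : forall b c, (md b c < K)%nat) (Hgam : 0 < gam).

(* A code tree consists of the served decoder, the codeword of the first phase and one
   codeword of the second phase for each mode. *)
Definition tree : Type := (bool * (list nat * (nat -> list nat)))%type.

Definition word_supp (P : nat -> R) (r : nat) (w : list nat) : Prop :=
  length w = r /\ List.Forall (fun x => (x < N)%nat /\ 0 < P x) w.

Definition supp_tree (u : tree) : Prop :=
  True /\ word_supp P0 n1 (fst (snd u)) /\
  (forall l, (l < K)%nat -> word_supp (Pm l) m (snd (snd u) l)).

Definition Etree (F : tree -> R) : R :=
  Ecoin (fun b => Eit (Ex N P0) n1 (fun x0 =>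
    Efam nil (fun l => Eit (Ex N (Pm l)) m) K (fun xm => F (b, (x0, xm))))).

Lemma fam_expectation : forall l, (l < K)%nat ->
  expectation (word_supp (Pm l) m) (Eit (Ex N (Pm l)) m).
Proof. intros l Hl. apply Eit_expectation, Ex_expectation, HPm, Hl. Qed.

Lemma Etree_expectation : expectation supp_tree Etree.
Proof.
  apply (bind_expectation Ecoin_expectation (fun _ _ =>
    bind_expectation (Eit_expectation (Ex_expectation N P0 HP0) n1) (fun _ _ =>
      Efam_expectation nil _ (fun l => word_supp (Pm l) m) K fam_expectation))).
Qed.

Lemma word_supp_range (P : nat -> R) (r : nat) (w : list nat) : word_supp P r w -> in_range N w.
Proof. intros [_ H]. apply Forall_impl with (2 := H). tauto. Qed.

Definition mode (u : tree) (y : list nat * list nat) : nat :=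
  md (fst u) (combine (fst (snd u)) (combine (fst y) (snd y))).

Definition Etx (u : tree) (F : list nat * list nat -> R) : R :=
  Ech L W1 W2 (fst (snd u)) (fun y => Ech L W1 W2 (snd (snd u) (mode u y)) (fun z =>
    F (fst y ++ fst z, snd y ++ snd z))).

Definition supp_tx (y : list nat * list nat) : Prop := forall k, in_range L (sel k y).

Lemma Etx_expectation (u : tree) : supp_tree u -> expectation supp_tx (Etx u).
Proof.
  intros [_ [H0 Hm]]. apply word_supp_range in H0.
  assert (Hm' : forall y, in_range N (snd (snd u) (mode u y)))
    by (intros y; apply (word_supp_range _ _ _ (Hm _ (Hmd _ _)))).
  pose proof (Ech_expectation N L W1 W2 HW1 HW2 _ H0) as HE.
  pose proof (fun y => Ech_expectation N L W1 W2 HW1 HW2 _ (Hm' y)) as HE'.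
  unfold Etx. split.
  - intros F G H. apply (E_le HE). intros y Hy. apply (E_le (HE' y)). intros z Hz. apply H.
    intros k. destruct (Hy k) as [_ Hy2]. destruct (Hz k) as [_ Hz2].
    destruct k; simpl in *; apply Forall_app; auto.
  - intros c F G. rewrite <- (E_lin HE). apply (E_ext HE). intros y _. apply (E_lin (HE' y)).
  - rewrite (E_ext HE _ (fun _ => 1)); [apply (E_one HE)|]. intros y _. apply (E_one (HE' y)).
Qed.

Lemma Etx_swap {A : Type} {s : A -> Prop} {E : (A -> R) -> R} (HE : expectation s E)
  (u : tree) (H : A -> list nat * list nat -> R) :
  E (fun v => Etx u (H v)) = Etx u (fun ys => E (fun v => H v ys)).
Proof.
  unfold Etx. rewrite (Ech_swap L W1 W2 HE). apply Ech_ext. intros y.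
  apply (Ech_swap L W1 W2 HE).
Qed.

(** The mode is read off the first n1 outputs even late in the second phase, so it does not change
    while the second codeword is sent. *)
Definition next_input (u : tree) (i : nat) (y1 y2 : list nat) : nat :=
  if Nat.ltb i n1 then nth i (fst (snd u)) 0%nat
  else nth (i - n1) (snd (snd u) (mode u (firstn n1 y1, firstn n1 y2))) 0%nat.

Definition tree_enc (us : nat -> tree) (i j : nat) (y1 y2 : list nat) (x : nat) : R :=
  if Nat.eqb x (next_input (us j) i y1 y2) then 1 else 0.

Lemma next_input_lt (u : tree) (i : nat) (y1 y2 : list nat) : supp_tree u -> (i < n1 + m)%nat ->
  (next_input u i y1 y2 < N)%nat.
Proof.
  intros [_ [H0 Hm]] Hi. unfold next_input. specialize (Hm _ (Hmd (fst u)
    (combine (fst (snd u)) (combine (firstn n1 y1) (firstn n1 y2))))).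
  assert (Hn : forall w r, in_range N w -> (r < length w)%nat -> (nth r w 0 < N)%nat).
  { intros w r Hw Hr. apply (proj1 (Forall_forall _ _) Hw), nth_In, Hr. }
  destruct (Nat.ltb_spec i n1).
  - apply Hn; [apply (word_supp_range _ _ _ H0)|]. destruct H0 as [-> _]. lia.
  - apply Hn; [apply (word_supp_range _ _ _ Hm)|]. destruct Hm as [Hl _]. cbn [fst snd] in *.
    unfold mode. cbn [fst snd]. rewrite Hl. lia.
Qed.

Lemma tree_enc_valid (us : nat -> tree) (M : nat) : (forall j, (j < M)%nat -> supp_tree (us j)) ->
  valid_encoder N L (n1 + m) M (tree_enc us).
Proof.
  intros Hs i j y1 y2 Hi Hj _ _ _ _. apply delta_dist, next_input_lt; auto.
Qed.

Lemma Etr_tree_S (us : nat -> tree) (j i : nat) (F : list nat * list nat -> R) :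
  supp_tree (us j) -> (i < n1 + m)%nat ->
  Etr N L W1 W2 (tree_enc us) j (S i) (fun h => F (snd h))
  = Etr N L W1 W2 (tree_enc us) j i (fun h =>
      (fun y => Eo L W1 W2 (next_input (us j) i (fst y) (snd y)) (fun ab =>
         F (fst y ++ fst ab :: nil, snd y ++ snd ab :: nil))) (snd h)).
Proof.
  intros Hs Hi. rewrite Etr_S. unfold Etr. apply sumL_ext_in. intros xs _.
  apply sumL_ext_in. intros y1 _. apply sumL_ext_in. intros y2 _. f_equal. cbn [fst snd].
  unfold tree_enc. rewrite Ex_delta by (apply next_input_lt; auto). reflexivity.
Qed.

Lemma Etr_tree_phase1 (us : nat -> tree) (j i : nat) : supp_tree (us j) -> (i <= n1)%nat ->
  forall F : list nat * list nat -> R,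
  Etr N L W1 W2 (tree_enc us) j i (fun h => F (snd h))
  = Ech L W1 W2 (firstn i (fst (snd (us j)))) F.
Proof.
  intros Hs. induction i as [|i IH]; intros Hi F.
  - rewrite Etr_0. reflexivity.
  - rewrite Etr_tree_S by (auto; lia).
    rewrite (IH ltac:(lia) (fun y => Eo L W1 W2 (next_input (us j) i (fst y) (snd y)) (fun ab =>
      F (fst y ++ fst ab :: nil, snd y ++ snd ab :: nil)))).
    assert (Hl : length (fst (snd (us j))) = n1) by (destruct Hs as [_ [[H _] _]]; exact H).
    rewrite firstn_S_nth, Ech_snoc by lia. apply Ech_ext. intros y.
    unfold next_input. destruct (Nat.ltb_spec i n1); [reflexivity|lia].
Qed.

Lemma Etr_tree_phase2 (us : nat -> tree) (j r : nat) : supp_tree (us j) -> (r <= m)%nat ->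
  forall F : list nat * list nat -> R,
  Etr N L W1 W2 (tree_enc us) j (n1 + r) (fun h => F (snd h))
  = Ech L W1 W2 (fst (snd (us j))) (fun y =>
      Ech L W1 W2 (firstn r (snd (snd (us j)) (mode (us j) y))) (fun z =>
        F (fst y ++ fst z, snd y ++ snd z))).
Proof.
  intros Hs. pose proof Hs as [_ [H0 Hm]].
  pose proof (Ech_expectation N L W1 W2 HW1 HW2 _ (word_supp_range _ _ _ H0)) as HE.
  induction r as [|r IH]; intros Hr F.
  - rewrite Nat.add_0_r, Etr_tree_phase1 by (auto; lia).
    rewrite <- (proj1 H0) at 1. rewrite firstn_all. apply Ech_ext. intros [y1 y2]. simpl.
    rewrite !app_nil_r. reflexivity.
  - rewrite Nat.add_succ_r, Etr_tree_S by (auto; lia).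
    rewrite (IH ltac:(lia) (fun y => Eo L W1 W2 (next_input (us j) (n1 + r) (fst y) (snd y)) (fun ab =>
      F (fst y ++ fst ab :: nil, snd y ++ snd ab :: nil)))).
    apply (E_ext HE). intros y Hy.
    destruct (Hm (mode (us j) y) (Hmd _ _)) as [Hl _].
    rewrite firstn_S_nth, Ech_snoc by lia. apply Ech_ext. intros z.
    assert (Hf : forall k, firstn n1 (sel k y ++ sel k z) = sel k y).
    { intros k. destruct (Hy k) as [Hk _]. rewrite (proj1 H0) in Hk.
      rewrite firstn_app, Hk, Nat.sub_diag, firstn_O, app_nil_r, <- Hk. apply firstn_all. }
    pose proof (Hf true) as Hf1. pose proof (Hf false) as Hf2. cbn [sel fst snd] in Hf1, Hf2.
    unfold next_input. cbn [fst snd]. rewrite Hf1, Hf2.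
    destruct (Nat.ltb_spec (n1 + r) n1); [lia|].
    replace (n1 + r - n1)%nat with r by lia. rewrite <- surjective_pairing.
    apply Eo_ext. intros ab. cbn [fst snd]. rewrite <- !app_assoc. reflexivity.
Qed.

Lemma Etr_tree (us : nat -> tree) (j : nat) (F : list nat * list nat -> R) : supp_tree (us j) ->
  Etr N L W1 W2 (tree_enc us) j (n1 + m) (fun h => F (snd h)) = Etx (us j) F.
Proof.
  intros Hs. rewrite Etr_tree_phase2 by auto. unfold Etx. apply Ech_ext. intros y.
  destruct Hs as [_ [_ Hm]]. destruct (Hm (mode (us j) y) (Hmd _ _)) as [Hl _].
  rewrite <- Hl at 1. rewrite firstn_all. reflexivity.
Qed.

Definition metric (k : bool) (u : tree) (l : nat) (y : list nat) : R :=
  Rt N P0 (Wsel W1 W2 k) (fst (snd u)) (firstn n1 y)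
  * Rt N (Pm l) (Wsel W1 W2 k) (snd (snd u) l) (skipn n1 y).

(** The mode depends on the outputs of both receivers, so a single decoder cannot compute it and
    tests each one. *)
Definition accepts (k : bool) (u : tree) (y : list nat) : bool :=
  existsb (fun l => if Rlt_dec gam (metric k u l y) then true else false) (seq 0 K).

Lemma in_range_firstn (A r : nat) (y : list nat) : in_range A y ->
  in_range A (firstn r y) /\ in_range A (skipn r y).
Proof.
  intros H. unfold in_range in *. rewrite <- (firstn_skipn r y) in H. apply Forall_app in H. exact H.
Qed.

Lemma metric_nonneg (k : bool) (u : tree) (l : nat) (y : list nat) :
  supp_tree u -> (l < K)%nat -> in_range L y -> 0 <= metric k u l y.
Proof.
  intros [_ [H0 Hm]] Hl Hy. destruct (in_range_firstn L n1 y Hy) as [Y1 Y2].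
  pose proof (Wsel_channel N L W1 W2 HW1 HW2 k) as HWk.
  apply Rmult_le_pos; [apply (Rt_nonneg N L)|apply (Rt_nonneg N L)]; auto;
    [apply H0|apply (Hm l Hl)].
Qed.

(** Union bound over the modes and Markov's inequality: for a fixed output each metric is a product
    of two independent ratios of mean at most 1. *)
Lemma false_alarm (k : bool) (y : list nat) : in_range L y ->
  Etree (fun u => b2R (accepts k u y)) <= INR K / gam.
Proof.
  intros Hy. destruct (in_range_firstn L n1 y Hy) as [Y1 Y2].
  pose proof (Wsel_channel N L W1 W2 HW1 HW2 k) as HWk. pose proof Etree_expectation as HE.
  apply Rle_trans with (Etree (fun u => sumR K (fun l => / gam * metric k u l y))).
  - apply (E_le HE). intros u Hu.
    assert (Hnn : forall l, (l < K)%nat -> 0 <= / gam * metric k u l y).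
    { intros l Hl. apply Rmult_le_pos; [left; apply Rinv_0_lt_compat, Hgam|].
      apply metric_nonneg; auto. }
    unfold b2R. destruct (accepts k u y) eqn:Ea; [|apply sumR_nonneg, Hnn].
    apply existsb_exists in Ea. destruct Ea as [l [Hl He]]. apply in_seq in Hl.
    destruct Rlt_dec as [Hlt|]; [|discriminate].
    apply Rle_trans with (/ gam * metric k u l y).
    + apply Rmult_le_reg_l with gam; [exact Hgam|]. rewrite <- Rmult_assoc, Rinv_r; lra.
    + apply (sumR_ge_term K l (fun l => / gam * metric k u l y) Hnn). lia.
  - rewrite (E_sumR HE K (fun l u => / gam * metric k u l y)). unfold Rdiv. rewrite <- sumR_const.
    apply sumR_le. intros l Hl. rewrite (E_scal HE).
    rewrite <- (Rmult_1_r (/ gam)) at 2.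
    apply Rmult_le_compat_l; [left; apply Rinv_0_lt_compat, Hgam|].
    apply (E_upper Ecoin_expectation). intros b _. unfold metric. cbn [fst snd].
    pose proof (Eit_expectation (Ex_expectation N P0 HP0) n1) as HE0.
    apply Rle_trans with
      (Eit (Ex N P0) n1 (fun x0 => Rt N P0 (Wsel W1 W2 k) x0 (firstn n1 y))).
    + apply (E_le HE0). intros x0 [_ Hx0].
      pose proof (Efam_expectation nil _ _ K fam_expectation) as HEf.
      rewrite (E_scal HEf).
      rewrite (Efam_marginal nil _ _ K l
        (fun w => Rt N (Pm l) (Wsel W1 W2 k) w (skipn n1 y)) fam_expectation Hl).
      pose proof (Ew_Rt_le N L (Pm l) _ m _ HWk (HPm l Hl) Y2) as H1.
      pose proof (Rt_nonneg N L P0 _ x0 _ HWk HP0 Hx0 Y1) as H2.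
      rewrite <- (Rmult_1_r (Rt N P0 _ x0 _)) at 2. apply Rmult_le_compat_l; assumption.
    + apply (Ew_Rt_le N L); auto.
Qed.

Definition miss (k : bool) (u : tree) : R := Etx u (fun y => 1 - b2R (accepts k u (sel k y))).

Definition miss_walk (k b : bool) : R :=
  Eit (E3 N L W1 W2 P0) n1 (fun c => Eit (E3 N L W1 W2 (Pm (md b c))) m (fun d =>
    ind_le (sumL c (isel N W1 W2 k P0) + sumL d (isel N W1 W2 k (Pm (md b c)))) (ln gam))).

(** A miss implies that the test for the mode actually used fails. Of the family only that mode's
    codeword then matters, so its marginal suffices, and the words together with their outputs
    become random walks of information densities. *)
Lemma miss_average (k : bool) : Etree (miss k) <= (miss_walk k true + miss_walk k false) / 2.
Proof.
  change (Etree (miss k) <= Ecoin (miss_walk k)).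
  apply (E_le Ecoin_expectation). intros b _. unfold miss_walk.
  pose proof (Eit_expectation (Ex_expectation N P0 HP0) n1) as HE0.
  pose proof (Efam_expectation nil _ _ K fam_expectation) as HEf.
  set (test := fun x0 l w (y z : list nat * list nat) =>
     ind_le (Rt N P0 (Wsel W1 W2 k) x0 (sel k y) * Rt N (Pm l) (Wsel W1 W2 k) w (sel k z)) gam).
  apply Rle_trans with (Eit (Ex N P0) n1 (fun x0 => Ech L W1 W2 x0 (fun y =>
    let l := md b (combine x0 (combine (fst y) (snd y))) in
    Eit (Ex N (Pm l)) m (fun w => Ech L W1 W2 w (fun z => test x0 l w y z))))).
  - apply (E_le HE0). intros x0 Hx0.
    pose proof (Ech_expectation N L W1 W2 HW1 HW2 _ (word_supp_range _ _ _ Hx0)) as HEc.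
    unfold miss, Etx. cbn [fst snd].
    rewrite (Ech_swap L W1 W2 HEf x0 (fun xm y => Ech L W1 W2
       (xm (mode (b, (x0, xm)) y)) (fun z =>
        1 - b2R (accepts k (b, (x0, xm)) (sel k (fst y ++ fst z, snd y ++ snd z)))))).
    apply (E_le HEc). intros y Hy. unfold mode. cbn [fst snd].
    set (l := md b (combine x0 (combine (fst y) (snd y)))).
    rewrite <- (Efam_marginal nil _ _ K l (fun w => Ech L W1 W2 w (fun z => test x0 l w y z))
      fam_expectation (Hmd _ _)).
    apply (E_le HEf). intros xm Hxm.
    pose proof (Hxm l (Hmd _ _)) as Hw.
    pose proof (Ech_expectation N L W1 W2 HW1 HW2 _ (word_supp_range _ _ _ Hw)) as HEz.
    apply (E_le HEz). intros z Hz. unfold test, ind_le, b2R.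
    destruct Rle_dec as [Hr|Hr]; [destruct accepts; lra|].
    assert (Ea : accepts k (b, (x0, xm)) (sel k (fst y ++ fst z, snd y ++ snd z)) = true);
      [|rewrite Ea; lra].
    apply existsb_exists. exists l. split; [apply in_seq; pose proof (Hmd b
      (combine x0 (combine (fst y) (snd y)))); unfold l; lia|].
    assert (Es : sel k (fst y ++ fst z, snd y ++ snd z) = sel k y ++ sel k z)
      by (destruct k; reflexivity).
    unfold metric. cbn [fst snd]. rewrite Es.
    destruct (Hy k) as [Hyl _]. rewrite (proj1 Hx0) in Hyl.
    rewrite firstn_app, skipn_app, Hyl, Nat.sub_diag, firstn_O, skipn_O, app_nil_r, <- Hyl,
      firstn_all, skipn_all. simpl app.
    destruct Rlt_dec as [_|Hn]; [reflexivity|]. exfalso. apply Hn. lra.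
  - rewrite (Ew_Ech N L W1 W2 P0 n1 (fun x0 y =>
      let l := md b (combine x0 (combine (fst y) (snd y))) in
      Eit (Ex N (Pm l)) m (fun w => Ech L W1 W2 w (fun z => test x0 l w y z))) HP0).
    apply (E_le (Eit_expectation (E3_expectation N L W1 W2 HW1 HW2 P0 HP0) n1)).
    intros c [_ Hc]. cbv zeta. rewrite combine_triples.
    set (l := md b c). pose proof (HPm l (Hmd _ _)) as HPl.
    rewrite (Ew_Ech N L W1 W2 (Pm l) m (fun w z => test (inputs c) l w (outputs c) z) HPl).
    apply (E_le (Eit_expectation (E3_expectation N L W1 W2 HW1 HW2 (Pm l) HPl) m)).
    intros d [_ Hd]. unfold test.
    rewrite (Rt_exp N L W1 W2 HW1 HW2 k P0 c HP0 Hc), (Rt_exp N L W1 W2 HW1 HW2 k (Pm l) d HPl Hd),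
      <- exp_plus.
    set (s := _ + _). unfold ind_le. destruct (Rle_dec (exp s) gam) as [H1|];
      [|destruct Rle_dec; lra].
    destruct (Rle_dec s (ln gam)) as [|Hn]; [lra|]. exfalso. apply Hn.
    rewrite <- (ln_exp s). apply ln_le; [apply exp_pos|exact H1].
Qed.

Lemma coding_theorem (a : R) (M : nat) : (1 <= M)%nat -> 0 <= a <= 1 -> (0 < K)%nat ->
  (forall k, (miss_walk k true + miss_walk k false) / 2 <= a) ->
  FLF_code N L W1 W2 (n1 + m) M (a + 2 / sqrt (INR M) + 8 * INR M * INR K / gam).
Proof.
  intros HM Ha HK Hmiss. pose proof Etree_expectation as HE.
  assert (HM0 : 0 < INR M) by (apply lt_0_INR; lia).
  assert (HK0 : 0 < INR K) by (apply lt_0_INR; lia).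
  set (F := fun k u v => Etx u (fun y => b2R (accepts k v (sel k y)))).
  assert (Hmb : forall k u, supp_tree u -> 0 <= miss k u <= 1).
  { intros k u Hu. pose proof (Etx_expectation u Hu) as HEx. split.
    - apply (E_nonneg HEx). intros y _. pose proof (b2R_bounds (accepts k u (sel k y))). lra.
    - apply (E_upper HEx). intros y _. pose proof (b2R_bounds (accepts k u (sel k y))). lra. }
  assert (HFb : forall k u v, supp_tree u -> 0 <= F k u v).
  { intros k u v Hu. apply (E_nonneg (Etx_expectation u Hu)). intros; apply b2R_bounds. }
  assert (HF : forall k u, supp_tree u -> Etree (F k u) <= INR K / gam).
  { intros k u Hu. unfold F.
    rewrite (Etx_swap HE u (fun v y => b2R (accepts k v (sel k y)))).
    apply (E_upper (Etx_expectation u Hu)). intros y Hy. apply false_alarm, Hy. }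
  (* Chosen so that 2 c M (K / gam) = 1. A potential of at most 4 M then gives an excess of at most
     2 sqrt M for each decoder and at most 4 M / c = 8 M^2 K / gam false alarms. *)
  set (c := gam / (2 * INR M * INR K)).
  assert (Hc : 0 < c) by (apply Rdiv_lt_0_compat; nra).
  destruct (greedy_selection HE (miss true) (miss false) (F true) (F false) a (INR K / gam) c M)
    with (m := M) as [us [Hus Hpot]]; auto.
  - lra.
  - apply Rle_trans with (2 := Hmiss true), miss_average.
  - apply Rle_trans with (2 := Hmiss false), miss_average.
  - right. unfold c. field. lra.
  - apply Rdiv_le_0_compat; lra.
  - set (D := fun k => sumR M (fun j => miss k (us j) - a)).
    set (FA := fun k => sumR M (fun j => sumR j (fun i => F k (us i) (us j)))).
    rewrite (sumR_ext M (fun j => sumR j (fun i => F true (us i) (us j) + F false (us i) (us j)))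
      (fun j => sumR j (fun i => F true (us i) (us j)) + sumR j (fun i => F false (us i) (us j))))
      in Hpot by (intros; apply sumR_plus).
    rewrite sumR_plus in Hpot. fold (FA true) (FA false) (D true) (D false) in Hpot.
    assert (HFA0 : forall k, 0 <= FA k).
    { intros k. apply sumR_nonneg. intros j Hj. apply sumR_nonneg. intros i Hi.
      apply HFb, Hus. lia. }
    pose proof (pow2_ge_0 (pos_part (D true))) as Q1.
    pose proof (pow2_ge_0 (pos_part (D false))) as Q2.
    pose proof (HFA0 true) as Q3. pose proof (HFA0 false) as Q4.
    assert (HD : forall k, D k <= 2 * sqrt (INR M)).
    { intros k. apply Rle_trans with (pos_part (D k)); [apply Rmax_l|].
      assert (Hp : pos_part (D k) ^ 2 <= 4 * INR M) by (destruct k; nra).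
      assert (Hs : sqrt (INR M) * sqrt (INR M) = INR M) by (apply sqrt_sqrt; lra).
      assert (0 < sqrt (INR M)) by (apply sqrt_lt_R0; lra). nra. }
    assert (HFA : forall k, FA k <= 8 * INR M * INR M * INR K / gam).
    { intros k. apply Rmult_le_reg_l with c; [exact Hc|].
      replace (c * (8 * INR M * INR M * INR K / gam)) with (4 * INR M) by (unfold c; field; lra).
      destruct k; nra. }
    assert (Herr : forall k, err_prob N L (n1 + m) M W1 W2 (tree_enc us) (fun a b => sel k (a, b))
        (last_accepted (accepts k) us M) <= a + 2 / sqrt (INR M) + 8 * INR M * INR K / gam).
    { intros k. rewrite err_prob_Etr.
      assert (Hs : sqrt (INR M) * sqrt (INR M) = INR M) by (apply sqrt_sqrt; lra).
      assert (Hs0 : 0 < sqrt (INR M)) by (apply sqrt_lt_R0; lra).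
      apply Rmult_le_reg_l with (INR M); [exact HM0|].
      rewrite <- Rmult_assoc, Rinv_r, Rmult_1_l by lra.
      replace (INR M * (a + 2 / sqrt (INR M) + 8 * INR M * INR K / gam))
        with (INR M * a + 2 * sqrt (INR M) + 8 * INR M * INR M * INR K / gam).
      2:{ replace (2 * sqrt (INR M)) with (INR M * (2 / sqrt (INR M)))
            by (rewrite <- Hs at 1; field; lra). field. lra. }
      (* The last summand counts trees later than j. Exchanging the sums turns it into [FA], which
         compares each tree with the earlier ones. *)
      apply Rle_trans with (sumR M (fun j => (miss k (us j) - a) + a
        + sumR M (fun i => if Nat.ltb j i then F k (us j) (us i) else 0))).
      - apply sumR_le. intros j Hj. pose proof (Hus j Hj) as Hu.
        pose proof (Etx_expectation (us j) Hu) as HEx.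
        rewrite (Etr_tree us j (fun y => if Nat.eqb (last_accepted (accepts k) us M (sel k y)) j
          then 0 else 1) Hu).
        apply Rle_trans with (Etx (us j) (fun y => (1 - b2R (accepts k (us j) (sel k y)))
          + sumR M (fun i => if Nat.ltb j i then b2R (accepts k (us i) (sel k y)) else 0))).
        + apply (E_le HEx). intros y _. apply last_accepted_error, Hj.
        + rewrite (E_plus HEx), (E_sumR HEx M (fun i y =>
            if Nat.ltb j i then b2R (accepts k (us i) (sel k y)) else 0)).
          fold (miss k (us j)).
          rewrite (sumR_ext M (fun i => Etx (us j) (fun y =>
              if Nat.ltb j i then b2R (accepts k (us i) (sel k y)) else 0))
            (fun i => if Nat.ltb j i then F k (us j) (us i) else 0)); [lra|].
          intros i _. destruct Nat.ltb; [reflexivity|apply (E_zero HEx)].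
      - rewrite !sumR_plus, sumR_const, sumR_swap. fold (D k).
        rewrite (sumR_ext M _ (fun j => sumR j (fun i => F k (us i) (us j)))).
        2:{ intros i Hi. apply (sumR_lt_restrict M i (fun j => F k (us j) (us i))). lia. }
        fold (FA k). pose proof (HD k). pose proof (HFA k). lra. }
    split; [exact HM|].
    exists (tree_enc us), (last_accepted (accepts true) us M), (last_accepted (accepts false) us M).
    split; [apply tree_enc_valid, Hus|split; [apply (Herr true)|apply (Herr false)]].
Qed.

End Coding.

(** * The two-phase scheme *)

Lemma sumL_affine {A : Type} (l : list A) (f : A -> R) (c d : R) :
  sumL l (fun a => c * f a + d) = c * sumL l f + INR (length l) * d.
Proof.
  unfold sumL. induction l as [|a l IH]; [simpl; ring|].
  cbn [fold_right length]. rewrite IH, S_INR. ring.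
Qed.

Lemma sumL_lin2 {A : Type} (l : list A) (f g : A -> R) (c d : R) :
  sumL l (fun a => c * f a + d * g a) = c * sumL l f + d * sumL l g.
Proof.
  unfold sumL. induction l as [|a l IH]; [simpl; ring|].
  cbn [fold_right]. rewrite IH. ring.
Qed.

Lemma ind_le_mono (a b c d : R) : (a <= b -> c <= d) -> ind_le a b <= ind_le c d.
Proof. intros H. unfold ind_le. destruct (Rle_dec a b), (Rle_dec c d); lra. Qed.

Lemma ind_le_cases (a b : R) : ind_le a b = 0 \/ ind_le a b = 1.
Proof. unfold ind_le. destruct Rle_dec; auto. Qed.

Definition grid (n l : nat) : R := 2 * INR l / INR n - 1.

Lemma grid_bounds (n l : nat) : (1 <= n)%nat -> (l <= n)%nat -> -1 <= grid n l <= 1.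
Proof.
  intros Hn Hl. assert (Hn0 : 0 < INR n) by (apply lt_0_INR; lia).
  pose proof (le_INR l n Hl) as H. pose proof (pos_INR l).
  assert (0 <= 2 * INR l / INR n <= 2).
  { split; [apply Rdiv_le_0_compat; lra|]. apply Rle_div_l; lra. }
  unfold grid. lra.
Qed.

Lemma grid_approx (n : nat) : (1 <= n)%nat -> exists f : R -> nat, (forall t, (f t < S n)%nat) /\
  forall t, Rabs t <= 1 -> Rabs (grid n (f t) - t) <= 2 / INR n.
Proof.
  intros Hn. assert (Hn0 : 0 < INR n) by (apply lt_0_INR; lia).
  (* [up] rounds strictly upwards, giving n + 1 at t = 1; the minimum with n repairs this and keeps
     the index legal for every t outside [-1,1]. *)
  exists (fun t => Nat.min n (Z.to_nat (up ((t + 1) / 2 * INR n)))). split; [intros; lia|].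
  intros t Ht. apply Rabs_le_between in Ht. set (r := (t + 1) / 2 * INR n).
  assert (Hr : 0 <= r <= INR n) by (unfold r; nra).
  destruct (archimed r) as [U1 U2].
  assert (HZ : INR (Z.to_nat (up r)) = IZR (up r)).
  { rewrite INR_IZR_INZ, Z2Nat.id; [reflexivity|]. apply le_IZR. simpl. lra. }
  set (l := Nat.min n (Z.to_nat (up r))).
  assert (Hl : Rabs (INR l - r) <= 1).
  { unfold l. destruct (Nat.le_ge_cases n (Z.to_nat (up r))) as [H|H].
    - rewrite Nat.min_l by exact H. apply le_INR in H. rewrite HZ in H. apply Rabs_le. lra.
    - rewrite Nat.min_r by exact H. rewrite HZ. apply Rabs_le. lra. }
  unfold grid. replace (2 * INR l / INR n - 1 - t) with (2 / INR n * (INR l - r))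
    by (unfold r; field; lra).
  rewrite Rabs_mult, Rabs_pos_eq by (apply Rdiv_le_0_compat; lra).
  assert (0 < 2 / INR n) by (apply Rdiv_lt_0_compat; lra). nra.
Qed.

Section Scheme.
Context (N L : nat) (W1 W2 : nat -> nat -> R)
  (HW1 : is_channel N L W1) (HW2 : is_channel N L W2)
  (Pstar : nat -> R) (HPd : is_dist N Pstar)
  (HPpos : forall x, (x < N)%nat -> 0 < Pstar x)
  (cap : R) (Hcap : forall k, MI N L (Wsel W1 W2 k) Pstar = cap)
  (eta : R) (Heta01 : 0 < eta < 1)
  (v : nat -> R) (Hv0 : sumR N v = 0)
  (cd : bool -> R) (Hcd : forall k, dI N L (Wsel W1 W2 k) Pstar v = cd k)
  (Hcd0 : eta * cd true + (1 - eta) * cd false = 0) (Hcdnz : forall k, cd k <> 0)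
  (B : R) (HB1 : 1 <= B)
  (HB : forall k P, is_dist N P -> (forall x, (x < N)%nat -> Pstar x / 2 <= P x) ->
    forall x y, (x < N)%nat -> (y < L)%nat -> 0 < Wsel W1 W2 k y x ->
      Rabs (idens N P (Wsel W1 W2 k) x y) <= B)
  (kap : R) (Hkap : forall k, chi2 N L (Wsel W1 W2 k) Pstar v <= kap) (Hkap0 : 0 <= kap).

Notation E3' := (E3 N L W1 W2).
Notation isel' := (isel N W1 W2).
Notation tau' := (tau N W1 W2 Pstar eta).

Lemma E3_isel (k : bool) (P : nat -> R) : is_dist N P -> E3' P (isel' k P) = MI N L (Wsel W1 W2 k) P.
Proof. intros HP. destruct k; [apply E3_i1|apply E3_i2]; auto. Qed.

Lemma isel_bounded (k : bool) (P : nat -> R) (t : nat * (nat * nat)) : is_dist N P ->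
  (forall x, (x < N)%nat -> Pstar x / 2 <= P x) -> supp3 N L W1 W2 P t -> Rabs (isel' k P t) <= B.
Proof.
  intros HP Hh [[Hx _] [[Ha Hwa] [Hb Hwb]]].
  apply HB; auto; destruct k; assumption.
Qed.

Lemma MI_bounded (k : bool) (P : nat -> R) : is_dist N P ->
  (forall x, (x < N)%nat -> Pstar x / 2 <= P x) -> Rabs (MI N L (Wsel W1 W2 k) P) <= B.
Proof.
  intros HP Hh. rewrite <- (E3_isel k P HP).
  pose proof (E3_expectation N L W1 W2 HW1 HW2 P HP) as HE.
  assert (Hb : forall t, supp3 N L W1 W2 P t -> - B <= isel' k P t <= B).
  { intros t Ht. apply Rabs_le_between, isel_bounded; auto. }
  apply Rabs_le. split.
  - rewrite <- (E_const HE (- B)). apply (E_le HE). intros t Ht. apply Hb, Ht.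
  - apply (E_upper HE). intros t Ht. apply Hb, Ht.
Qed.

(** [chernoff] for the centred and negated densities, which are bounded by 2 B because both the
    density and its mean are bounded by B. *)
Lemma walk_lower_tail (k : bool) (P : nat -> R) (r : nat) (lam D : R) : is_dist N P ->
  (forall x, (x < N)%nat -> Pstar x / 2 <= P x) -> 0 <= lam -> lam * (2 * B) <= 1 ->
  Eit (E3' P) r (fun c => ind_le (sumL c (isel' k P)) (INR r * MI N L (Wsel W1 W2 k) P - D))
  <= exp (- (lam * D) + INR r * (3 * (lam * (2 * B)) ^ 2)).
Proof.
  intros HP Hh Hlam HlB. pose proof (E3_expectation N L W1 W2 HW1 HW2 P HP) as HE.
  set (mu := MI N L (Wsel W1 W2 k) P).
  pose proof (MI_bounded k P HP Hh) as Hmu. fold mu in Hmu. apply Rabs_le_between in Hmu.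
  apply Rle_trans with (Eit (E3' P) r (fun c => ind_le D (sumL c (fun t => -1 * isel' k P t + mu)))).
  - apply (E_le (Eit_expectation HE r)). intros c [Hc _]. apply ind_le_mono.
    rewrite sumL_affine, Hc. lra.
  - apply (chernoff HE); auto.
    + rewrite (E_lin HE), (E3_isel k P HP), (E_const HE). fold mu. ring.
    + intros t Ht. pose proof (isel_bounded k P t HP Hh Ht) as Hi. apply Rabs_le_between in Hi.
      apply Rabs_le. lra.
Qed.

Lemma walk_upper_tail (k : bool) (P : nat -> R) (r : nat) (lam D : R) : is_dist N P ->
  (forall x, (x < N)%nat -> Pstar x / 2 <= P x) -> 0 <= lam -> lam * (2 * B) <= 1 ->
  Eit (E3' P) r (fun c => ind_le (INR r * MI N L (Wsel W1 W2 k) P + D) (sumL c (isel' k P)))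
  <= exp (- (lam * D) + INR r * (3 * (lam * (2 * B)) ^ 2)).
Proof.
  intros HP Hh Hlam HlB. pose proof (E3_expectation N L W1 W2 HW1 HW2 P HP) as HE.
  set (mu := MI N L (Wsel W1 W2 k) P).
  pose proof (MI_bounded k P HP Hh) as Hmu. fold mu in Hmu. apply Rabs_le_between in Hmu.
  apply Rle_trans with (Eit (E3' P) r (fun c => ind_le D (sumL c (fun t => 1 * isel' k P t + - mu)))).
  - apply (E_le (Eit_expectation HE r)). intros c [Hc _]. apply ind_le_mono.
    rewrite sumL_affine, Hc. lra.
  - apply (chernoff HE); auto.
    + rewrite (E_lin HE), (E3_isel k P HP), (E_const HE). fold mu. ring.
    + intros t Ht. pose proof (isel_bounded k P t HP Hh Ht) as Hi. apply Rabs_le_between in Hi.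
      apply Rabs_le. lra.
Qed.

Lemma Pstar_half : forall x, (x < N)%nat -> Pstar x / 2 <= Pstar x.
Proof. intros x Hx. pose proof (HPpos x Hx). lra. Qed.

(** * Steering one decoder to the threshold *)

Section Thresholds.
Context (n1 m n : nat) (Hn : n = (n1 + m)%nat) (Hn1 : (1 <= n)%nat) (Hm : (1 <= m)%nat)
  (s : R) (Hs : 0 < s)
  (Htilt : forall t, -1 <= t <= 1 -> is_dist N (tilt Pstar v (s * t)) /\
     forall x, (x < N)%nat -> Pstar x / 2 <= tilt Pstar v (s * t) x)
  (theta gam D zeta cmax : R) (Hcmax : forall k, Rabs (cd k) <= cmax)
  (Htheta : ln gam + D + INR m * s * (2 / INR n) * cmax + INR m * (kap * s ^ 2) <= theta)
  (near : R -> nat) (Hnear : forall t, (near t < S n)%nat)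
  (Hnear' : forall t, Rabs t <= 1 -> Rabs (grid n (near t) - t) <= 2 / INR n).

Definition Pmode (l : nat) : nat -> R := tilt Pstar v (s * grid n l).

(** The solution t of S_b + m C + m s t [cd b] = theta, that is, the relative tilt which to first
    order brings decoder b to theta in the mean. *)
Definition aim (b : bool) (c : list (nat * (nat * nat))) : R :=
  (theta - sumL c (isel' b Pstar) - INR m * cap) / (INR m * s * cd b).

Definition modes (b : bool) (c : list (nat * (nat * nat))) : nat := near (aim b c).

Lemma Pmode_dist (l : nat) : (l < S n)%nat -> is_dist N (Pmode l).
Proof. intros Hl. apply Htilt, grid_bounds; [exact Hn1|apply Nat.lt_succ_r, Hl]. Qed.

Lemma Pmode_half (l : nat) : (l < S n)%nat -> forall x, (x < N)%nat -> Pstar x / 2 <= Pmode l x.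
Proof. intros Hl. apply Htilt, grid_bounds; [exact Hn1|apply Nat.lt_succ_r, Hl]. Qed.

Lemma MI_Pmode (k : bool) (l : nat) : (l < S n)%nat ->
  cap + s * grid n l * cd k - kap * s ^ 2 <= MI N L (Wsel W1 W2 k) (Pmode l).
Proof.
  intros Hl. pose proof (Wsel_channel N L W1 W2 HW1 HW2 k) as HWk.
  pose proof (MI_tilt_lower N L _ HWk Pstar v (s * grid n l) HPd HPpos Hv0 (Pmode_dist l Hl)) as H.
  rewrite Hcap, Hcd in H. fold (Pmode l) in H.
  pose proof (grid_bounds n l Hn1 (proj1 (Nat.lt_succ_r l n) Hl)) as Hg.
  assert ((s * grid n l) ^ 2 * chi2 N L (Wsel W1 W2 k) Pstar v <= s ^ 2 * kap); [|lra].
  rewrite Rpow_mult_distr, Rmult_assoc. apply Rmult_le_compat_l; [apply pow2_ge_0|].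
  assert (Hg2 : 0 <= grid n l ^ 2 <= 1) by nra.
  apply Rle_trans with (grid n l ^ 2 * kap); [|nra].
  apply Rmult_le_compat_l; [lra|apply Hkap].
Qed.

Definition off_range (b : bool) (c : list (nat * (nat * nat))) : R :=
  ind_le (INR m * s * Rabs (cd b)) (Rabs (theta - sumL c (isel' b Pstar) - INR m * cap)).

Definition below (c : list (nat * (nat * nat))) : R := ind_le (sumL c tau' + INR m * cap) theta.

Lemma sumL_tau (c : list (nat * (nat * nat))) :
  sumL c tau' = eta * sumL c (isel' true Pstar) + (1 - eta) * sumL c (isel' false Pstar).
Proof. apply sumL_lin2. Qed.

(* The mode is aimed at lifting decoder [b] exactly to [theta]; the other decoder then lands
   above [theta] precisely when the weighted sum [sumL c tau] plus [m * cap] does. *)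
Lemma reaches_threshold (k b : bool) (c : list (nat * (nat * nat))) :
  off_range b c = 0 -> (k <> b -> below c = 0) ->
  ln gam <= sumL c (isel' k Pstar) + (INR m * MI N L (Wsel W1 W2 k) (Pmode (modes b c)) - D).
Proof.
  intros Hoff Hbel.
  assert (Hm0 : 0 < INR m) by apply (lt_INR 0), Hm.
  assert (Hms : 0 < INR m * s) by (apply Rmult_lt_0_compat; lra).
  pose proof (Hcdnz b) as Hcb. pose proof (Rabs_pos_lt _ Hcb) as Hcb'.
  assert (Hden : INR m * s * cd b <> 0) by (apply Rmult_integral_contrapositive_currified; lra).
  set (S := sumL c (isel' b Pstar)) in *. set (dev := theta - S - INR m * cap).
  assert (Haim : Rabs (aim b c) <= 1).
  { unfold aim. fold S. fold dev. unfold Rdiv. rewrite Rabs_mult, Rabs_inv, Rabs_mult,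
      (Rabs_pos_eq (INR m * s)) by lra.
    unfold off_range in Hoff. fold S in Hoff. fold dev in Hoff. unfold ind_le in Hoff.
    destruct Rle_dec as [H|H] in Hoff; [lra|].
    apply Rle_div_l; [nra|]. lra. }
  pose proof (Hnear' _ Haim) as Hng. pose proof (MI_Pmode k _ (Hnear (aim b c))) as HMI.
  fold (modes b c) in Hng, HMI. set (g := grid n (modes b c)) in *.
  assert (Hgc : aim b c * cd k - 2 / INR n * cmax <= g * cd k).
  { assert (Hx : Rabs ((g - aim b c) * cd k) <= 2 / INR n * cmax).
    { rewrite Rabs_mult. apply Rmult_le_compat; auto using Rabs_pos. }
    apply Rabs_le_between in Hx. lra. }
  assert (Hgain : INR m * cap + INR m * s * (aim b c * cd k)
     - INR m * s * (2 / INR n) * cmax - INR m * (kap * s ^ 2)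
     <= INR m * MI N L (Wsel W1 W2 k) (Pmode (modes b c))).
  { apply Rmult_le_compat_l with (r := INR m) in HMI; [|lra].
    apply Rmult_le_compat_l with (r := INR m * s) in Hgc; [|lra]. lra. }
  assert (Haimc : INR m * s * (aim b c * cd b) = dev).
  { unfold aim. fold S. fold dev. field. repeat split; try lra; auto. }
  assert (Hgoal : theta <= sumL c (isel' k Pstar) + INR m * cap + INR m * s * (aim b c * cd k));
    [|lra].
  destruct (Bool.bool_dec k b) as [->|Hkb].
  - fold S. rewrite Haimc. unfold dev. lra.
  - specialize (Hbel Hkb). unfold below, ind_le in Hbel. destruct Rle_dec as [H|H] in Hbel; [lra|].
    rewrite sumL_tau in H.
    set (X := INR m * s * aim b c) in *.
    replace (INR m * s * (aim b c * cd b)) with (X * cd b) in Haimc by (unfold X; ring).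
    replace (INR m * s * (aim b c * cd k)) with (X * cd k) by (unfold X; ring).
    (* To first order the tilt does not move the weighted sum, so what is given to decoder b is
       taken from the other in the proportion fixed by [eta]. *)
    assert (HX : eta * (X * cd true) + (1 - eta) * (X * cd false) = 0).
    { replace 0 with (X * (eta * cd true + (1 - eta) * cd false)) by (rewrite Hcd0; ring). ring. }
    unfold dev, S in Haimc.
    destruct k, b; try congruence.
    + apply Rmult_le_reg_l with eta; [lra|]. nra.
    + apply Rmult_le_reg_l with (1 - eta); [lra|]. nra.
Qed.

(** Three ways to fail: the needed tilt is out of range, T is too low while the other decoder is
    served, or the second phase falls D short of its mean. The last bound is uniform in the mode
    because the mode depends on the first phase. *)
Lemma miss_walk_bound (k b : bool) (pb : R) : 0 <= zeta -> 0 <= pb ->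
  (forall l, (l < S n)%nat -> Eit (E3' (Pmode l)) m (fun d =>
     ind_le (sumL d (isel' k (Pmode l))) (INR m * MI N L (Wsel W1 W2 k) (Pmode l) - D)) <= zeta) ->
  (k <> b -> Eit (E3' Pstar) n1 below <= pb) ->
  miss_walk N L W1 W2 n1 m Pstar Pmode gam modes k b
  <= Eit (E3' Pstar) n1 (off_range b) + pb + zeta.
Proof.
  intros Hz Hpb Hzeta Hbel. unfold miss_walk.
  pose proof (Eit_expectation (E3_expectation N L W1 W2 HW1 HW2 Pstar HPd) n1) as HE.
  set (bel := fun c => if Bool.bool_dec k b then 0 else below c).
  apply Rle_trans with (Eit (E3' Pstar) n1 (fun c => off_range b c + bel c + zeta)).
  - apply (E_le HE). intros c _.
    pose proof (Eit_expectation (E3_expectation N L W1 W2 HW1 HW2 _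
      (Pmode_dist _ (Hnear (aim b c)))) m) as HEm. fold (modes b c) in HEm.
    set (l := modes b c) in *.
    assert (Ho : 0 <= off_range b c) by apply ind_le_bounds.
    assert (Hb : 0 <= bel c) by (unfold bel; destruct Bool.bool_dec; [lra|apply ind_le_bounds]).
    assert (Hone : Eit (E3' (Pmode l)) m (fun d =>
       ind_le (sumL c (isel' k Pstar) + sumL d (isel' k (Pmode l))) (ln gam)) <= 1).
    { apply (E_upper HEm). intros; apply ind_le_bounds. }
    destruct (ind_le_cases (INR m * s * Rabs (cd b))
      (Rabs (theta - sumL c (isel' b Pstar) - INR m * cap))) as [Ho0|Ho0];
      fold (off_range b c) in Ho0; [|lra].
    assert (Hb1 : bel c = 0 \/ bel c = 1).
    { unfold bel. destruct Bool.bool_dec; [auto|apply ind_le_cases]. }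
    destruct Hb1 as [Hb0|Hb0]; [|lra].
    pose proof (reaches_threshold k b c Ho0 (fun Hkb => ltac:(
      unfold bel in Hb0; destruct (Bool.bool_dec k b); [contradiction|exact Hb0]))) as Hreach.
    fold l in Hreach. rewrite Ho0, Hb0.
    replace (0 + 0 + zeta) with zeta by ring.
    apply Rle_trans with (2 := Hzeta l (Hnear _)).
    apply (E_le HEm). intros d _. apply ind_le_mono. lra.
  - rewrite !(E_plus HE), (E_const HE).
    assert (Eit (E3' Pstar) n1 bel <= pb); [|lra].
    unfold bel. destruct (Bool.bool_dec k b) as [_|Hkb].
    + rewrite (E_zero HE). exact Hpb.
    + apply Hbel, Hkb.
Qed.

(** If S_b stays within R1 of its mean n1 C, the needed correction is below R1 + |theta - n C|,
    which lies within the reach of the tilt. *)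
Lemma off_range_prob (b : bool) (lam R1 : R) : 0 <= lam -> lam * (2 * B) <= 1 ->
  R1 + Rabs (theta - INR n * cap) <= INR m * s * Rabs (cd b) ->
  Eit (E3' Pstar) n1 (off_range b)
  <= 2 * exp (- (lam * R1) + INR n1 * (3 * (lam * (2 * B)) ^ 2)).
Proof.
  intros Hlam HlB HR.
  pose proof (Eit_expectation (E3_expectation N L W1 W2 HW1 HW2 Pstar HPd) n1) as HE.
  pose proof (walk_lower_tail b Pstar n1 lam R1 HPd Pstar_half Hlam HlB) as H1.
  pose proof (walk_upper_tail b Pstar n1 lam R1 HPd Pstar_half Hlam HlB) as H2.
  rewrite Hcap in H1, H2.
  apply Rle_trans with (Eit (E3' Pstar) n1 (fun c =>
    ind_le (sumL c (isel' b Pstar)) (INR n1 * cap - R1)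
    + ind_le (INR n1 * cap + R1) (sumL c (isel' b Pstar)))); [|rewrite (E_plus HE); lra].
  apply (E_le HE). intros c _. unfold off_range.
  set (S := sumL c (isel' b Pstar)).
  assert (Hnn : INR n = INR n1 + INR m) by (rewrite Hn; apply plus_INR).
  pose proof (ind_le_bounds S (INR n1 * cap - R1)). pose proof (ind_le_bounds (INR n1 * cap + R1) S).
  unfold ind_le in *. destruct (Rle_dec (INR m * s * Rabs (cd b)) _) as [H3|]; [|lra].
  destruct (Rle_dec S (INR n1 * cap - R1)) as [|Hn2]; [lra|].
  destruct (Rle_dec (INR n1 * cap + R1) S) as [|Hn3]; [lra|]. exfalso.
  assert (H4 : Rabs (theta - S - INR m * cap) <= Rabs (theta - INR n * cap) + Rabs (INR n1 * cap - S)).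
  { replace (theta - S - INR m * cap) with ((theta - INR n * cap) + (INR n1 * cap - S))
      by (rewrite Hnn; ring). apply Rabs_triang. }
  assert (Rabs (INR n1 * cap - S) < R1) by (apply Rabs_def1; lra). lra.
Qed.

(** The smoothing time is m V, the variance that the second phase would have contributed. Added to
    the n1 V of the first phase it gives exactly n V, so no variance correction appears. *)
Lemma below_prob (V h : R) : 0 < V -> 1 <= INR m * V -> 0 <= h ->
  E3' Pstar (fun c => tau' c - cap) = 0 -> E3' Pstar (fun c => (tau' c - cap) ^ 2) = V ->
  Eit (E3' Pstar) n1 below
  <= Qtail ((INR n * cap - theta - h) / sqrt (INR n * V))
     + 4 * ((2 * B) ^ 3 + 2 * V ^ 2) / V / sqrt (INR m * V) + gexp (h / sqrt (INR m * V)).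
Proof.
  intros HV HmV Hh Ht0 Ht2.
  pose proof (E3_expectation N L W1 W2 HW1 HW2 Pstar HPd) as HE.
  assert (Hnn : INR n = INR n1 + INR m) by (rewrite Hn; apply plus_INR).
  assert (Hm1 : 1 <= INR m) by (apply (le_INR 1), Hm).
  apply Rle_trans with (Eit (E3' Pstar) n1 (fun c =>
    ind_le (sumL c (fun t => tau' t - cap)) (theta - INR n * cap))).
  - apply (E_le (Eit_expectation HE n1)). intros c [Hc _]. apply ind_le_mono.
    replace (sumL c (fun t => tau' t - cap)) with (1 * sumL c tau' + INR (length c) * - cap).
    + rewrite Hc, Hnn. lra.
    + rewrite <- sumL_affine. apply sumL_ext_in. intros; ring.
  - replace (INR n * cap - theta - h) with (- (theta - INR n * cap) - h) by ring.
    replace (INR n * V) with (INR m * V + INR n1 * V) by (rewrite Hnn; ring).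
    apply (clt_lower_tail HE); auto; [|lra|nra].
    intros t Ht. pose proof (isel_bounded true Pstar t HPd Pstar_half Ht) as I1.
    pose proof (isel_bounded false Pstar t HPd Pstar_half Ht) as I2.
    pose proof (MI_bounded true Pstar HPd Pstar_half) as I3. rewrite Hcap in I3.
    apply Rabs_le_between in I1, I2, I3.
    change (tau' t) with (eta * isel' true Pstar t + (1 - eta) * isel' false Pstar t).
    apply Rabs_le. nra.
Qed.

End Thresholds.
Lemma FLF_code_mono (n M : nat) (e1 e2 : R) : e1 <= e2 ->
  FLF_code N L W1 W2 n M e1 -> FLF_code N L W1 W2 n M e2.
Proof.
  intros He [HM [enc [g1 [g2 [H0 [H1 H2]]]]]]. split; [exact HM|].
  exists enc, g1, g2. split; [exact H0|split; lra].
Qed.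

Lemma mult_ge_self (a b : R) : 0 <= a -> 1 <= b -> a <= a * b.
Proof. intros. nra. Qed.

Lemma nat_ceil (x : R) : 0 <= x -> exists k : nat, x < INR k <= x + 1.
Proof.
  intros Hx. destruct (archimed x) as [U1 U2]. exists (Z.to_nat (up x)).
  rewrite INR_IZR_INZ, Z2Nat.id; [lra|]. apply le_IZR. simpl. lra.
Qed.

Lemma exp_pow (x : R) (k : nat) : exp x ^ k = exp (INR k * x).
Proof.
  induction k as [|k IH]; [simpl; rewrite Rmult_0_l, exp_0; reflexivity|].
  rewrite S_INR, Rmult_plus_distr_r, Rmult_1_l, exp_plus, <- IH. simpl. ring.
Qed.

(** * Choice of the parameters as functions of n *)

Section Asymptotics.
Context (Hcap0 : 0 < cap) (V : R) (HV : 0 < V)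
  (Ht0 : E3' Pstar (fun c => tau' c - cap) = 0)
  (Ht2 : E3' Pstar (fun c => (tau' c - cap) ^ 2) = V)
  (s0 : R) (Hs0 : 0 < s0)
  (Htilt : forall s t, 0 < s <= s0 -> -1 <= t <= 1 -> is_dist N (tilt Pstar v (s * t)) /\
     forall x, (x < N)%nat -> Pstar x / 2 <= tilt Pstar v (s * t) x)
  (eps z : R) (Heps : 0 < eps < / 2) (Hz : Qtail z = 2 * eps)
  (rr cmax : R) (Hrr : 0 < rr) (Hrr2 : forall k, 2 <= rr * Rabs (cd k))
  (Hcmax : forall k, Rabs (cd k) <= cmax).

(** The shift h is [hcoef] q^2 l. As [hcoef] is at least 1 and at least 4 rr V, h^2 / (m V) >= 2 l
    and the smoothing term is at most exp (- l) = 1 / n. *)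
Definition hcoef : R := 4 * rr * V + 1.
(** In the second phase the quadratic Chernoff term is at most 24 rr B^2 l; the extra 1 leaves exp
    (- l). *)
Definition dcoef : R := 24 * rr * B ^ 2 + 1.
(** The part sqrt V, divided by sqrt (n V), becomes the shift l / q of the Gaussian argument. *)
Definition K3coef : R := hcoef + sqrt V.
(** Adds the allowance D, the second-order tilt loss, and 5 for the 3 l in ln gam, the rounding of M
    and the grid error. *)
Definition K1coef : R := K3coef + dcoef + 2 * rr * kap + 5.
Definition clt_coef : R := 4 * ((2 * B) ^ 3 + 2 * V ^ 2) / V.

(* With [q = n^(1/6)] and [l = ln n], the second phase has length of order [q^4 l], the tilt is
   [1/q], and every error term is of order [q^2 l] in the threshold. *)
Lemma achievability_at (n : nat) (q l : R) :
  INR n = q ^ 6 -> exp l = INR n -> 1 <= l -> l <= q ->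
  2 * rr <= q -> / rr <= q -> / (rr * V) <= q -> 4 * rr * cmax <= q -> / s0 <= q -> 2 * B <= q ->
  2 * (sqrt V * Rabs z) <= l -> 2 * K1coef <= q ->
  (sqrt V * Rabs z + K1coef + 2) / cap <= q -> 18 / eps <= q ->
  (clt_coef / sqrt (rr * V) + 39 + 4 * exp (12 * B ^ 2)) / gauss_pdf (Rabs z + 1) <= q ->
  exists M, FLF_code N L W1 W2 n M eps /\
    INR n * cap - sqrt (INR n * V) * z - K1coef * q ^ 2 * l <= ln (INR M).
Proof.
  intros Hn6 Hexp Hl1 Hlq C1 C2 C3 C4 C5 C6 C7 C8 C9 C10 C11.
  assert (Hq1 : 1 <= q) by lra. assert (Hq0 : 0 < q) by lra.
  assert (Hw : 0 < sqrt V) by (apply sqrt_lt_R0; exact HV).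
  assert (Hww : sqrt V * sqrt V = V) by (apply sqrt_sqrt; lra).
  set (w := sqrt V) in *.
  assert (Hz0 : 0 <= w * Rabs z) by (apply Rmult_le_pos; [lra|apply Rabs_pos]).
  assert (Hh : 1 <= hcoef) by (unfold hcoef; nra).
  assert (Hd : 1 <= dcoef) by (unfold dcoef; nra).
  assert (HK3 : K3coef = hcoef + w) by reflexivity.
  assert (Hrk : 0 <= rr * kap) by nra.
  assert (HK1 : 1 <= K1coef) by (unfold K1coef; lra).
  assert (P2 : q <= q ^ 2) by nra. assert (P2' : 1 <= q ^ 2) by nra.
  assert (P3 : q ^ 2 <= q ^ 3) by nra. assert (P3' : 1 <= q ^ 3) by nra.
  assert (P4 : q ^ 3 <= q ^ 4) by nra. assert (P4' : 1 <= q ^ 4) by nra.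
  assert (P6 : q ^ 3 * q ^ 3 = q ^ 6) by ring.
  assert (P6' : q ^ 2 <= q ^ 6) by nra.
  assert (Hn0 : 0 < INR n) by (rewrite Hn6; lra).
  assert (Hn1 : (1 <= n)%nat) by (apply INR_le; simpl; lra).
  assert (Hexpn : exp (- l) = / INR n) by (rewrite exp_Ropp, Hexp; reflexivity).
  assert (Hql : 1 <= q ^ 2 * l)
    by (apply Rle_trans with (q ^ 2); [lra|apply mult_ge_self; lra]).
  assert (Hq4l : q ^ 4 <= q ^ 4 * l) by (apply mult_ge_self; lra).
  assert (Hsq : sqrt (INR n * V) = q ^ 3 * w).
  { rewrite sqrt_mult by lra. fold w. f_equal. rewrite Hn6, <- P6. apply sqrt_square. lra. }
  (* As rr |cd k| >= 2, this length with tilt 1 / q reaches 2 q^3 l: one half for the fluctuations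
     of the first phase, one half for the offset of theta from n C. *)
  set (x := rr * q ^ 4 * l).
  assert (Hx1 : 1 <= x).
  { unfold x. assert (1 <= rr * q).
    { apply Rmult_le_compat_l with (r := rr) in C2; [rewrite Rinv_r in C2; lra|lra]. }
    assert (rr * q <= rr * (q ^ 4 * l)); [apply Rmult_le_compat_l; lra|lra]. }
  destruct (nat_ceil x ltac:(lra)) as [m [Hm1 Hm2]].
  assert (Hm2' : INR m <= 2 * rr * q ^ 4 * l) by (unfold x in *; lra).
  assert (Hmn : (m <= n)%nat).
  { apply INR_le. apply Rle_trans with (1 := Hm2'). rewrite Hn6.
    replace (q ^ 6) with (q * q ^ 4 * q) by ring.
    apply Rmult_le_compat; try lra; [apply Rmult_le_pos; lra|]. apply Rmult_le_compat_r; lra. }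
  assert (Hmpos : (1 <= m)%nat) by (apply INR_le; simpl; lra).
  set (n1 := (n - m)%nat). assert (Hnn : n = (n1 + m)%nat) by (unfold n1; lia).
  assert (Hm0 : 0 < INR m) by lra.
  set (s := / q). assert (Hs : 0 < s) by (apply Rinv_0_lt_compat; lra).
  assert (Hsq1 : s * q = 1) by (unfold s; field; lra).
  assert (Hss : s <= s0).
  { unfold s. rewrite <- (Rinv_inv s0). apply Rinv_le_contravar; [apply Rinv_0_lt_compat|]; lra. }
  destruct (grid_approx n Hn1) as [near [Hnear Hnear']].
  set (tgt := INR n * cap - sqrt (INR n * V) * z - K1coef * q ^ 2 * l).
  assert (Hzabs : - (w * Rabs z) <= w * z <= w * Rabs z).
  { pose proof (Rle_abs z). pose proof (Rle_abs (- z)) as Hr. rewrite Rabs_Ropp in Hr.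
    replace (- (w * Rabs z)) with (w * - Rabs z) by ring.
    split; apply Rmult_le_compat_l; lra. }
  (* Makes M at least n^2, so that 2 / sqrt M is at most 2 / n. *)
  assert (Htgt : 2 * l <= tgt).
  { unfold tgt. rewrite Hsq, Hn6.
    assert (HC9 : w * Rabs z + K1coef + 2 <= q ^ 3 * cap).
    { apply Rmult_le_compat_r with (r := cap) in C9; [|lra].
      unfold Rdiv in C9. rewrite Rmult_assoc, Rinv_l, Rmult_1_r in C9 by lra.
      apply Rle_trans with (1 := C9), Rmult_le_compat_r; lra. }
    assert (q ^ 3 * (w * z) <= q ^ 3 * (w * Rabs z)) by (apply Rmult_le_compat_l; lra).
    assert (q ^ 2 * l <= q ^ 3)
      by (replace (q ^ 3) with (q ^ 2 * q) by ring; apply Rmult_le_compat_l; lra).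
    assert (K1coef * (q ^ 2 * l) <= K1coef * q ^ 3) by (apply Rmult_le_compat_l; lra).
    assert (q ^ 3 * (w * Rabs z + K1coef + 2) <= q ^ 3 * (q ^ 3 * cap))
      by (apply Rmult_le_compat_l; lra).
    rewrite <- P6. lra. }
  destruct (nat_ceil (exp tgt) (Rlt_le _ _ (exp_pos tgt))) as [M [HM1 HM2]].
  assert (Het : exp (2 * l) <= exp tgt) by (apply exp_mono; exact Htgt).
  assert (He2 : exp (2 * l) = INR n * INR n).
  { replace (2 * l) with (l + l) by ring. rewrite exp_plus, Hexp. reflexivity. }
  assert (HnR1 : 1 <= INR n) by (rewrite Hn6; lra).
  assert (Hnn1 : 1 <= INR n * INR n)
    by (apply Rle_trans with (INR n); [lra|apply mult_ge_self; lra]).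
  assert (HM0 : 0 < INR M) by lra.
  assert (HMpos : (1 <= M)%nat) by (apply INR_le; simpl; lra).
  assert (HlnM : tgt <= ln (INR M) <= tgt + 1).
  { split.
    - rewrite <- (ln_exp tgt). apply ln_le; [apply exp_pos|lra].
    - rewrite <- (ln_exp (tgt + 1)). apply ln_le; [lra|]. rewrite exp_plus.
      pose proof (exp_ineq1_le 1). assert (1 <= exp tgt) by lra.
      apply Rle_trans with (exp tgt * 2); [lra|apply Rmult_le_compat_l; lra]. }
  exists M. split; [|exact (proj1 HlnM)].
  (* With n + 1 modes the false alarm term becomes 8 (n + 1) / n^3, below 16 / n, at the price of
     only 3 l in the threshold. *)
  set (gam := INR M * INR n ^ 3).
  assert (Hn3 : 0 < INR n ^ 3) by (apply pow_lt; lra).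
  assert (Hgam : 0 < gam) by (apply Rmult_lt_0_compat; lra).
  assert (Hlngam : ln gam = ln (INR M) + 3 * l).
  { unfold gam. rewrite ln_mult by lra. f_equal. rewrite <- Hexp.
    replace (exp l ^ 3) with (exp (3 * l)); [apply ln_exp|].
    replace (3 * l) with (l + l + l) by ring. rewrite !exp_plus. ring. }
  set (D := dcoef * q ^ 2 * l).
  set (theta := ln gam + D + 1 + INR m * (kap * s ^ 2)).
  assert (Hslack : INR m * s * (2 / INR n) * cmax <= 1).
  { assert (Hc0 : 0 <= cmax) by (apply Rle_trans with (1 := Rabs_pos (cd true)), Hcmax).
    apply Rle_trans with (2 * rr * q ^ 4 * l * s * (2 / INR n) * cmax).
    - apply Rmult_le_compat_r; [exact Hc0|]. apply Rmult_le_compat_r; [apply Rdiv_le_0_compat; lra|].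
      apply Rmult_le_compat_r; lra.
    - rewrite Hn6. unfold s.
      replace (2 * rr * q ^ 4 * l * / q * (2 / q ^ 6) * cmax) with (4 * rr * cmax * l / q ^ 3)
        by (field; lra).
      apply Rle_div_l; [lra|]. rewrite Rmult_1_l. replace (q ^ 3) with (q * q * q) by ring.
      apply Rle_trans with (q * q).
      + apply Rmult_le_compat; try lra. apply Rmult_le_pos; lra.
      + apply mult_ge_self; [apply Rmult_le_pos; lra|lra]. }
  assert (Hks : 0 <= INR m * (kap * s ^ 2) <= 2 * (rr * kap) * (q ^ 2 * l)).
  { assert (0 <= kap * s ^ 2) by (apply Rmult_le_pos; [lra|apply pow2_ge_0]).
    split; [apply Rmult_le_pos; lra|].
    apply Rle_trans with (2 * rr * q ^ 4 * l * (kap * s ^ 2)).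
    - apply Rmult_le_compat_r; lra.
    - right. replace (q ^ 4) with (q ^ 2 * (q * q)) by ring.
      replace (2 * rr * (q ^ 2 * (q * q)) * l * (kap * s ^ 2))
        with (2 * (rr * kap) * (q ^ 2 * l) * ((s * q) * (s * q))) by ring.
      rewrite Hsq1. ring. }
  assert (Hl_ql : l <= q ^ 2 * l) by (rewrite Rmult_comm; apply mult_ge_self; lra).
  assert (Hth_up : theta <= INR n * cap - q ^ 3 * w * z - K3coef * (q ^ 2 * l)).
  { unfold theta, D. rewrite Hlngam. unfold tgt in HlnM. rewrite Hsq in HlnM.
    unfold K1coef in HlnM. lra. }
  assert (Hth_lo : tgt <= theta).
  { unfold theta, D. rewrite Hlngam. assert (0 <= dcoef * (q ^ 2 * l)) by (apply Rmult_le_pos; lra). lra. }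
  assert (Hdev : Rabs (theta - INR n * cap) <= q ^ 3 * l).
  { assert (G1 : q ^ 3 * (w * Rabs z) <= q ^ 3 * (l / 2)) by (apply Rmult_le_compat_l; lra).
    assert (G2 : K1coef * (q ^ 2 * l) <= q / 2 * (q ^ 2 * l)) by (apply Rmult_le_compat_r; lra).
    assert (G3 : q / 2 * (q ^ 2 * l) = q ^ 3 * (l / 2)) by field.
    assert (G4 : q ^ 3 * (w * z) <= q ^ 3 * (w * Rabs z)) by (apply Rmult_le_compat_l; lra).
    assert (G5 : q ^ 3 * - (w * Rabs z) <= q ^ 3 * (w * z)) by (apply Rmult_le_compat_l; lra).
    assert (G6 : 0 <= K3coef * (q ^ 2 * l)) by (apply Rmult_le_pos; lra).
    unfold tgt in Hth_lo. rewrite Hsq in Hth_lo. apply Rabs_le. lra. }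
  assert (Hn1n : INR n1 <= INR n) by (apply le_INR; unfold n1; lia).
  (* Chernoff with parameter q^(-3) = n^(-1/2) and deviation q^3 l: the exponent is -l plus the
     constant 12 B^2. *)
  assert (Hoff : forall b, Eit (E3' Pstar) n1 (off_range m s theta b)
                <= 2 * (exp (12 * B ^ 2) * / INR n)).
  { intros b.
    apply Rle_trans with (1 := off_range_prob n1 m n Hnn s theta b (/ q ^ 3) (q ^ 3 * l)
      ltac:(left; apply Rinv_0_lt_compat; lra)
      ltac:(apply Rmult_le_reg_l with (q ^ 3); [lra|];
            rewrite <- Rmult_assoc, Rinv_r, Rmult_1_l, Rmult_1_r; lra)
      ltac:(apply Rle_trans with (2 * (q ^ 3 * l)); [lra|];
            apply Rle_trans with (rr * q ^ 4 * l * s * Rabs (cd b));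
            [replace (rr * q ^ 4 * l * s * Rabs (cd b))
               with (rr * Rabs (cd b) * (q ^ 3 * l) * (s * q)) by ring;
             rewrite Hsq1, Rmult_1_r; apply Rmult_le_compat_r; [apply Rmult_le_pos; lra|apply Hrr2]
            |apply Rmult_le_compat_r; [apply Rabs_pos|];
             apply Rmult_le_compat_r; [lra|fold x; lra]])).
    apply Rmult_le_compat_l; [lra|]. rewrite <- Hexpn, <- exp_plus. apply exp_mono.
    assert (Hi : / q ^ 3 * (q ^ 3 * l) = l) by (field; lra). rewrite Hi.
    assert (Hj : INR n * (3 * (/ q ^ 3 * (2 * B)) ^ 2) = 12 * B ^ 2).
    { rewrite Hn6. field. lra. }
    assert (INR n1 * (3 * (/ q ^ 3 * (2 * B)) ^ 2) <= INR n * (3 * (/ q ^ 3 * (2 * B)) ^ 2)).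
    { apply Rmult_le_compat_r; [|exact Hn1n]. apply Rmult_le_pos; [lra|apply pow2_ge_0]. }
    lra. }
  assert (Htilt' : forall t, -1 <= t <= 1 -> is_dist N (tilt Pstar v (s * t)) /\
     forall y, (y < N)%nat -> Pstar y / 2 <= tilt Pstar v (s * t) y).
  { intros t Ht. apply Htilt; [lra|exact Ht]. }
  assert (Hzeta : forall k r, (r < S n)%nat -> Eit (E3' (Pmode n s r)) m (fun d =>
     ind_le (sumL d (isel' k (Pmode n s r))) (INR m * MI N L (Wsel W1 W2 k) (Pmode n s r) - D))
     <= / INR n).
  { intros k r Hr.
    apply Rle_trans with (1 := walk_lower_tail k (Pmode n s r) m (/ q ^ 2) D
      (Pmode_dist n Hn1 s Htilt' r Hr) (Pmode_half n Hn1 s Htilt' r Hr)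
      ltac:(left; apply Rinv_0_lt_compat; lra)
      ltac:(apply Rmult_le_reg_l with (q ^ 2); [lra|];
            rewrite <- Rmult_assoc, Rinv_r, Rmult_1_l, Rmult_1_r; lra)).
    rewrite <- Hexpn. apply exp_mono.
    assert (Hi : / q ^ 2 * D = dcoef * l) by (unfold D; field; lra). rewrite Hi.
    assert (Hj : 2 * rr * q ^ 4 * l * (3 * (/ q ^ 2 * (2 * B)) ^ 2) = (dcoef - 1) * l).
    { unfold dcoef. field. lra. }
    assert (INR m * (3 * (/ q ^ 2 * (2 * B)) ^ 2)
            <= 2 * rr * q ^ 4 * l * (3 * (/ q ^ 2 * (2 * B)) ^ 2)).
    { apply Rmult_le_compat_r; [|exact Hm2']. apply Rmult_le_pos; [lra|apply pow2_ge_0]. }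
    lra. }
  set (phi0 := gauss_pdf (Rabs z + 1)).
  assert (Hphi : 0 < phi0) by apply gauss_pdf_pos.
  assert (HrV : 0 < rr * V) by (apply Rmult_lt_0_compat; lra).
  assert (Hr2 : 0 < sqrt (rr * V)) by (apply sqrt_lt_R0, HrV).
  assert (Hclt0 : 0 <= clt_coef).
  { unfold clt_coef. apply Rdiv_le_0_compat; [|lra]. assert (0 <= (2 * B) ^ 3) by (apply pow_le; lra).
    pose proof (pow2_ge_0 V). lra. }
  assert (HmV1 : 1 <= INR m * V).
  { assert (1 <= rr * V * q).
    { apply Rmult_le_compat_l with (r := rr * V) in C3; [rewrite Rinv_r in C3; lra|lra]. }
    assert (rr * V * q <= rr * V * (q ^ 4 * l)) by (apply Rmult_le_compat_l; lra).
    assert (x * V <= INR m * V) by (apply Rmult_le_compat_r; lra).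
    replace (x * V) with (rr * V * (q ^ 4 * l)) in * by (unfold x; ring). lra. }
  (* The argument moves by l / q and gains phi0 l / q; the smoothing time is at least rr V q^4, so
     the central limit error is of order q^(-2); h makes the last term at most 1 / n. *)
  assert (Hbel : Eit (E3' Pstar) n1 (below m theta)
     <= 2 * eps - phi0 * (l / q) + clt_coef / sqrt (rr * V) / q ^ 2 + / INR n).
  { set (h := hcoef * (q ^ 2 * l)).
    assert (Hh0 : 0 <= h) by (apply Rmult_le_pos; lra).
    apply Rle_trans with (1 := below_prob n1 m n Hnn Hmpos theta V h HV HmV1 Hh0 Ht0 Ht2).
    apply Rplus_le_compat; [apply Rplus_le_compat|].
    - assert (Hlq1 : 0 <= l / q <= 1).
      { split; [apply Rdiv_le_0_compat; lra|]. apply Rle_div_l; lra. }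
      pose proof (Qtail_decrease z (l / q) Hlq1) as HQ. rewrite Hz in HQ. fold phi0 in HQ.
      apply Rle_trans with (Qtail (z + l / q)); [|lra].
      apply Qtail_antitone. rewrite Hsq. apply Rle_div_r; [apply Rmult_lt_0_compat; lra|].
      replace ((z + l / q) * (q ^ 3 * w)) with (q ^ 3 * w * z + w * (q ^ 2 * l)) by (field; lra).
      unfold h. rewrite HK3 in Hth_up. lra.
    - fold clt_coef. unfold Rdiv. rewrite Rmult_assoc. apply Rmult_le_compat_l; [exact Hclt0|].
      rewrite <- Rinv_mult. apply Rinv_le_contravar; [apply Rmult_lt_0_compat; lra|].
      apply Rle_trans with (sqrt (rr * V * q ^ 4)).
      + right. rewrite (sqrt_mult (rr * V) (q ^ 4)) by lra. f_equal.
        replace (q ^ 4) with (q ^ 2 * q ^ 2) by ring. symmetry. apply sqrt_square. lra.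
      + apply sqrt_le_1_alt. apply Rle_trans with (x * V); [|apply Rmult_le_compat_r; lra].
        unfold x. replace (rr * q ^ 4 * l * V) with (rr * V * q ^ 4 * l) by ring.
        rewrite <- (Rmult_1_r (rr * V * q ^ 4)) at 1. apply Rmult_le_compat_l; [apply Rmult_le_pos; lra|lra].
    - rewrite <- Hexpn. unfold gexp. apply exp_mono.
      replace ((h / sqrt (INR m * V)) ^ 2) with (h ^ 2 / (INR m * V)).
      2:{ rewrite <- (sqrt_sqrt (INR m * V)) at 1 by lra. field.
          apply Rgt_not_eq, sqrt_lt_R0; lra. }
      assert (2 * l <= h ^ 2 / (INR m * V)); [|lra].
      apply (Rle_div_r (2 * l)); [lra|].
      apply Rle_trans with (2 * l * (2 * rr * q ^ 4 * l * V)).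
      + apply Rmult_le_compat_l; [lra|]. apply Rmult_le_compat_r; lra.
      + replace (2 * l * (2 * rr * q ^ 4 * l * V)) with (4 * rr * V * (q ^ 2 * l) ^ 2) by ring.
        unfold h. rewrite (Rpow_mult_distr hcoef). apply Rmult_le_compat_r; [apply pow2_ge_0|].
        replace (hcoef ^ 2) with (hcoef * hcoef) by ring.
        apply Rle_trans with (hcoef * 1); [unfold hcoef; lra|apply Rmult_le_compat_l; lra]. }
  assert (Hbel0 : 0 <= Eit (E3' Pstar) n1 (below m theta)).
  { apply (E_nonneg (Eit_expectation (E3_expectation N L W1 W2 HW1 HW2 Pstar HPd) n1)).
    intros; apply ind_le_bounds. }
  assert (Hinvn : 0 < / INR n) by (apply Rinv_0_lt_compat; lra).
  assert (Hmw : forall k b, miss_walk N L W1 W2 n1 m Pstar (Pmode n s) gam (modes m s theta near) k b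
     <= 2 * (exp (12 * B ^ 2) * / INR n)
        + (if Bool.bool_dec k b then 0 else Eit (E3' Pstar) n1 (below m theta)) + / INR n).
  { intros k b.
    apply Rle_trans with (1 := miss_walk_bound n1 m n Hn1 Hmpos s Hs Htilt' theta gam D (/ INR n) cmax
      Hcmax ltac:(unfold theta; lra) near Hnear Hnear' k b
      (if Bool.bool_dec k b then 0 else Eit (E3' Pstar) n1 (below m theta))
      ltac:(lra) ltac:(destruct Bool.bool_dec; lra) (Hzeta k)
      ltac:(intros Hkb; destruct Bool.bool_dec; [contradiction|apply Rle_refl])).
    pose proof (Hoff b). lra. }
  (* The reserve 18 / n covers 2 / n and 16 / n from the coding theorem; here eps - 18 / n is seen
     to be nonnegative, as that theorem requires. *)
  assert (HnE : 18 * / INR n <= eps).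
  { apply Rmult_le_reg_r with (INR n); [lra|]. rewrite Rmult_assoc, Rinv_l by lra.
    apply Rmult_le_compat_r with (r := eps) in C10; [|lra].
    unfold Rdiv in C10. rewrite Rmult_assoc, Rinv_l in C10 by lra.
    assert (q * eps <= INR n * eps) by (apply Rmult_le_compat_r; lra). lra. }
  (* Everything is doubled: 39 = 36 + 2 + 1 comes from the reserve, the second-phase failure and the
     smoothing term in [Hbel], and 4 exp (12 B^2) from leaving the range. The gain wins because l /
     q exceeds multiples of q^(-2). *)
  assert (Hmain : clt_coef / sqrt (rr * V) / q ^ 2 + (39 + 4 * exp (12 * B ^ 2)) * / INR n
     <= phi0 * (l / q)).
  { assert (HC : clt_coef / sqrt (rr * V) + 39 + 4 * exp (12 * B ^ 2) <= phi0 * q).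
    { fold phi0 in C11. apply Rmult_le_compat_r with (r := phi0) in C11; [|lra].
      unfold Rdiv at 1 in C11. rewrite Rmult_assoc, Rinv_l in C11 by lra. lra. }
    assert (I2 : / INR n <= / q ^ 2) by (rewrite Hn6; apply Rinv_le_contravar; lra).
    pose proof (exp_pos (12 * B ^ 2)).
    apply Rle_trans with ((clt_coef / sqrt (rr * V) + 39 + 4 * exp (12 * B ^ 2)) * / q ^ 2).
    - assert ((39 + 4 * exp (12 * B ^ 2)) * / INR n <= (39 + 4 * exp (12 * B ^ 2)) * / q ^ 2)
        by (apply Rmult_le_compat_l; lra). unfold Rdiv in *. lra.
    - apply Rle_trans with (phi0 * q * / q ^ 2).
      + apply Rmult_le_compat_r; [left; apply Rinv_0_lt_compat; lra|exact HC].
      + replace (phi0 * q * / q ^ 2) with (phi0 * (1 / q)) by (field; lra).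
        apply Rmult_le_compat_l; [lra|]. apply Rmult_le_compat_r; [left; exact Hs|lra]. }
  (* Of the two values of the coin only the one that serves the other decoder pays for [below], so
     the probability 2 eps is halved. *)
  assert (Hmiss : forall k, (miss_walk N L W1 W2 n1 m Pstar (Pmode n s) gam (modes m s theta near) k true
     + miss_walk N L W1 W2 n1 m Pstar (Pmode n s) gam (modes m s theta near) k false) / 2
     <= eps - 18 * / INR n).
  { intros k. pose proof (Hmw k true) as T1. pose proof (Hmw k false) as T2.
    destruct k; destruct Bool.bool_dec in T1; destruct Bool.bool_dec in T2; try congruence; lra. }
  rewrite Hnn.
  apply FLF_code_mono with (2 := coding_theorem N L W1 W2 HW1 HW2 n1 m (S n) Pstar (Pmode n s) gam
    (modes m s theta near) HPd (Pmode_dist n Hn1 s Htilt') (fun b c => Hnear _) Hgam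
    (eps - 18 * / INR n) M HMpos ltac:(lra) ltac:(lia) Hmiss).
  assert (T1 : 2 / sqrt (INR M) <= 2 * / INR n).
  { apply Rmult_le_compat_l; [lra|]. apply Rinv_le_contravar; [lra|].
    rewrite <- (sqrt_square (INR n)) by lra. apply sqrt_le_1_alt. lra. }
  assert (T2 : 8 * INR M * INR (S n) / gam <= 16 * / INR n).
  { unfold gam. rewrite S_INR.
    replace (8 * INR M * (INR n + 1) / (INR M * INR n ^ 3))
      with (8 * (INR n + 1) * / INR n * / INR n * / INR n) by (field; lra).
    apply Rmult_le_compat_r; [lra|].
    assert (/ INR n <= 1) by (rewrite <- Rinv_1; apply Rinv_le_contravar; lra).
    assert ((INR n + 1) * / INR n = 1 + / INR n) by (field; lra).
    replace (8 * (INR n + 1) * / INR n * / INR n) with (8 * ((INR n + 1) * / INR n) * / INR n) by ring.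
    apply Rle_trans with (8 * 2 * 1); [apply Rmult_le_compat; lra|lra]. }
  lra.
Qed.

Lemma achievability : exists K1 n0, forall n : nat, (n0 <= n)%nat ->
  exists M, FLF_code N L W1 W2 n M eps /\
    INR n * cap - sqrt (INR n * V) * z - K1 * Rpower (INR n) (1 / 3) * ln (INR n) <= ln (INR M).
Proof.
  set (bounds := 2 * rr :: / rr :: / (rr * V) :: 4 * rr * cmax :: / s0 :: 2 * B :: 2 * K1coef
    :: (sqrt V * Rabs z + K1coef + 2) / cap :: 18 / eps
    :: (clt_coef / sqrt (rr * V) + 39 + 4 * exp (12 * B ^ 2)) / gauss_pdf (Rabs z + 1) :: nil).
  (* The sum of absolute values is a common upper bound for all lower limits imposed on q. *)
  set (q0 := sumL bounds Rabs).
  assert (Hq0 : forall x, In x bounds -> x <= q0).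
  { unfold q0. induction bounds as [|y b IH]; intros x Hx; [destruct Hx|].
    change (sumL (y :: b) Rabs) with (Rabs y + sumL b Rabs).
    assert (Hb : 0 <= sumL b Rabs).
    { clear. unfold sumL. induction b; simpl; [lra|]. pose proof (Rabs_pos a). lra. }
    destruct Hx as [->|Hx].
    - pose proof (Rle_abs x). lra.
    - specialize (IH x Hx). pose proof (Rabs_pos y). lra. }
  assert (Hq00 : 0 <= q0).
  { apply Rle_trans with (2 * rr); [lra|]. apply Hq0. left; reflexivity. }
  assert (Hz0 : 0 <= sqrt V * Rabs z) by (apply Rmult_le_pos; [apply sqrt_pos|apply Rabs_pos]).
  (* 144 gives l <= q, since q = exp (l/12)^2 >= (1 + l/12)^2; 6 q0 gives q >= 1 + l/6 >= q0; the
     last term is the condition relating l and z. *)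
  set (l0 := 144 + 6 * q0 + 2 * (sqrt V * Rabs z)).
  destruct (nat_ceil (exp l0) (Rlt_le _ _ (exp_pos l0))) as [n0 [Hn0 _]].
  exists K1coef, n0. intros n Hn.
  assert (HnR : exp l0 < INR n) by (apply Rlt_le_trans with (1 := Hn0), le_INR, Hn).
  assert (Hnpos : 0 < INR n) by (pose proof (exp_pos l0); lra).
  set (l := ln (INR n)).
  assert (Hl : l0 <= l) by (unfold l; rewrite <- (ln_exp l0); apply ln_le; [apply exp_pos|lra]).
  assert (Hexp : exp l = INR n) by (apply exp_ln, Hnpos).
  set (q := exp (l / 6)).
  assert (Hqq : 1 + l / 6 <= q) by apply exp_ineq1_le.
  assert (Hqb : forall x, In x bounds -> x <= q).
  { intros x Hx. apply Rle_trans with q0; [apply Hq0, Hx|]. unfold l0 in *. lra. }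
  destruct (achievability_at n q l) as [M [HM1 HM2]];
    try (apply Hqb; unfold bounds; simpl; tauto).
  - rewrite <- Hexp. unfold q. rewrite exp_pow. f_equal. simpl. field.
  - exact Hexp.
  - unfold l0 in *; lra.
  - replace (l / 6) with (l / 12 + l / 12) in q by field. unfold q.
    replace (l / 6) with (l / 12 + l / 12) by field. rewrite exp_plus.
    pose proof (exp_ineq1_le (l / 12)). unfold l0 in *.
    apply Rle_trans with ((1 + l / 12) * (1 + l / 12)); [nra|]. apply Rmult_le_compat; lra.
  - unfold l0 in *; lra.
  - exists M. split; [exact HM1|].
    replace (Rpower (INR n) (1 / 3)) with (q ^ 2); [exact HM2|].
    unfold Rpower, q. fold l. rewrite exp_pow. f_equal. simpl. field.
Qed.

End Asymptotics.

End Scheme.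

Lemma dist_le_one (n x : nat) (P : nat -> R) : is_dist n P -> (x < n)%nat -> P x <= 1.
Proof. intros [H0 H1] Hx. rewrite <- H1. apply sumR_ge_term; assumption. Qed.

(** The entries of Q - P lie in [-1,1], so half the smallest probability of P is a safe size for the
    tilt. *)
Lemma tilt_small_dist (N : nat) (P Q : nat -> R) : is_dist N P -> is_dist N Q ->
  (forall x, (x < N)%nat -> 0 < P x) ->
  exists s0, 0 < s0 /\ forall s t, 0 < s <= s0 -> -1 <= t <= 1 ->
    is_dist N (tilt P (fun x => Q x - P x) (s * t)) /\
    forall x, (x < N)%nat -> P x / 2 <= tilt P (fun x => Q x - P x) (s * t) x.
Proof.
  intros HP HQ Hpos. destruct (pos_lower_bound N P) as [p [Hp Hpm]].
  exists (p / 2). split; [lra|]. intros s t Hs Ht.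
  assert (Hh : forall x, (x < N)%nat -> P x / 2 <= tilt P (fun x => Q x - P x) (s * t) x).
  { intros x Hx. specialize (Hpm x Hx (Hpos x Hx)). unfold tilt.
    pose proof (dist_le_one N x P HP Hx). pose proof (dist_le_one N x Q HQ Hx).
    pose proof (proj1 HP x Hx). pose proof (proj1 HQ x Hx).
    assert (Hst : Rabs (s * t * (Q x - P x)) <= s * 1 * 1).
    { rewrite !Rabs_mult, (Rabs_pos_eq s) by lra.
      apply Rmult_le_compat; [apply Rmult_le_pos; [lra|apply Rabs_pos]|apply Rabs_pos| |].
      - apply Rmult_le_compat_l; [lra|]. apply Rabs_le; lra.
      - apply Rabs_le; lra. }
    apply Rabs_le_between in Hst. lra. }
  split; [split|exact Hh].
  - intros x Hx. pose proof (Hh x Hx). pose proof (Hpos x Hx). lra.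
  - unfold tilt. rewrite sumR_plus, sumR_scal, sumR_minus, (proj2 HP), (proj2 HQ). ring.
Qed.

Theorem theorem4
  (N L : nat) (HN : (1 <= N)%nat) (HL : (1 <= L)%nat)
  (W1 W2 : nat -> nat -> R)
  (HW1 : is_channel N L W1) (HW2 : is_channel N L W2)
  (Pstar : nat -> R)
  (HPd : is_dist N Pstar)
  (HPmax : forall P, is_dist N P -> minI N L W1 W2 P <= minI N L W1 W2 Pstar)
  (HPuniq : forall P, is_dist N P -> minI N L W1 W2 P = minI N L W1 W2 Pstar ->
              forall x, (x < N)%nat -> P x = Pstar x)
  (HPpos : forall x, (x < N)%nat -> 0 < Pstar x)
  (HV1 : 0 < Vdisp N L W1 Pstar) (HV2 : 0 < Vdisp N L W2 Pstar)
  (HC1 : exists P, is_dist N P /\ MI N L W1 P > minI N L W1 W2 Pstar)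
  (HC2 : exists P, is_dist N P /\ MI N L W2 P > minI N L W1 W2 Pstar)
  (eta : R) (Heta01 : 0 < eta < 1) (Heta : eta_prop N L W1 W2 Pstar eta)
  (Heta_uniq : forall eta', eta_prop N L W1 W2 Pstar eta' -> eta' = eta) :
  let C := minI N L W1 W2 Pstar in
  let V := eta ^ 2 * Vdisp N L W1 Pstar + (1 - eta) ^ 2 * Vdisp N L W2 Pstar in
  forall eps : R, 0 < eps < / 2 ->
  forall z : R, Q_value z (2 * eps) ->
  exists K1 K2 : R, exists n0 : nat, forall n : nat, (n0 <= n)%nat ->
    (exists M : nat, FLF_code N L W1 W2 n M eps /\
       ln (INR M) >= INR n * C - sqrt (INR n * V) * z
                     - K1 * Rpower (INR n) (1 / 3) * ln (INR n)) /\
    (forall M : nat, FLF_code N L W1 W2 n M eps ->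
       ln (INR M) <= INR n * C + K2 * sqrt (INR n)).
Proof.
  intros C V eps Heps z HQ. apply Qtail_of_Q_value in HQ.
  destruct (MI_balanced N L W1 W2 HW1 HW2 Pstar HPd HPmax HC1 HC2) as [EI1 EI2].
  assert (Hcap : forall k, MI N L (Wsel W1 W2 k) Pstar = C) by (intros [|]; assumption).
  pose proof (maximin_pos N L W1 W2 HW1 HW2 Pstar HPd HPmax HC1 HC2) as HCpos. fold C in HCpos.
  destruct HC1 as [P [HP HgtP]]. pose proof (ex_intro (fun P => _) P (conj HP HgtP)) as HC1'.
  set (v := fun x => P x - Pstar x).
  assert (Hv0 : sumR N v = 0) by (unfold v; rewrite sumR_minus, (proj2 HP), (proj2 HPd); ring).
  set (cd := fun k => dI N L (Wsel W1 W2 k) Pstar v).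
  assert (Hcd0 : eta * cd true + (1 - eta) * cd false = 0) by (apply Heta, Hv0).
  (* The derivative towards P is the cross term minus C, and the cross term is at least the
     information of P, which exceeds C. The relation with [eta] then makes the other derivative
     negative. *)
  assert (Hcd1 : 0 < cd true).
  { pose proof (MI_le_cross N L W1 HW1 P Pstar HP HPd (fun x Hx _ => HPpos x Hx)) as H.
    assert (E : cd true = Ex N P (fun x => KL L W1 x (PW N Pstar W1)) - MI N L W1 Pstar).
    { unfold cd, dI, Ex, MI, v. simpl Wsel. rewrite <- sumR_minus. apply sumR_ext. intros; ring. }
    lra. }
  assert (Hcd2 : cd false < 0) by nra.
  assert (Hcdnz : forall k, cd k <> 0) by (intros [|]; lra).
  destruct (idens_bounded N L W1 HW1 Pstar HPpos) as [B1 [HB1 HBd1]].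
  destruct (idens_bounded N L W2 HW2 Pstar HPpos) as [B2 [HB2 HBd2]].
  assert (HB : forall k Q, is_dist N Q -> (forall x, (x < N)%nat -> Pstar x / 2 <= Q x) ->
    forall x y, (x < N)%nat -> (y < L)%nat -> 0 < Wsel W1 W2 k y x ->
      Rabs (idens N Q (Wsel W1 W2 k) x y) <= B1 + B2).
  { intros [|] Q HQd Hh x y Hx Hy Hw; simpl Wsel in *.
    - specialize (HBd1 Q HQd Hh x y Hx Hy Hw). lra.
    - specialize (HBd2 Q HQd Hh x y Hx Hy Hw). lra. }
  set (kap := Rabs (chi2 N L W1 Pstar v) + Rabs (chi2 N L W2 Pstar v)).
  assert (Hk1 := Rabs_pos (chi2 N L W1 Pstar v)). assert (Hk2 := Rabs_pos (chi2 N L W2 Pstar v)).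
  assert (Hkap : forall k, chi2 N L (Wsel W1 W2 k) Pstar v <= kap).
  { pose proof (Rle_abs (chi2 N L W1 Pstar v)). pose proof (Rle_abs (chi2 N L W2 Pstar v)).
    intros [|]; simpl Wsel; unfold kap; lra. }
  destruct (tilt_small_dist N Pstar P HPd HP HPpos) as [s0 [Hs0 Htilt]].
  assert (HV : 0 < V).
  { unfold V. assert (0 < eta ^ 2) by (apply pow_lt; lra).
    assert (0 < (1 - eta) ^ 2) by (apply pow_lt; lra).
    apply Rplus_lt_0_compat; apply Rmult_lt_0_compat; assumption. }
  set (cmin := Rmin (Rabs (cd true)) (Rabs (cd false))).
  assert (Hcmin : 0 < cmin) by (apply Rmin_glb_lt; apply Rabs_pos_lt, Hcdnz).
  assert (Hrr : 0 < 2 / cmin) by (apply Rdiv_lt_0_compat; lra).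
  assert (Hrr2 : forall k, 2 <= 2 / cmin * Rabs (cd k)).
  { intros k. apply Rle_trans with (2 / cmin * cmin); [right; field; lra|].
    apply Rmult_le_compat_l; [lra|]. destruct k; [apply Rmin_l|apply Rmin_r]. }
  assert (Hcmax : forall k, Rabs (cd k) <= Rmax (Rabs (cd true)) (Rabs (cd false)))
    by (intros [|]; [apply Rmax_l|apply Rmax_r]).
  destruct (achievability N L W1 W2 HW1 HW2 Pstar HPd HPpos C Hcap eta Heta01 v Hv0 cd
    (fun k => eq_refl) Hcd0 Hcdnz (B1 + B2) ltac:(lra) HB kap Hkap ltac:(unfold kap; lra)
    HCpos V HV (E3_tau N L W1 W2 HW1 HW2 Pstar HPd HPmax HC1' HC2 eta Heta)
    (E3_tau_sqr N L W1 W2 HW1 HW2 Pstar HPd HPmax HC1' HC2 eta Heta)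
    s0 Hs0 Htilt eps z Heps HQ (2 / cmin) _ Hrr Hrr2 Hcmax) as [K1 [n0 Hach]].
  destruct (converse N L W1 W2 HW1 HW2 Pstar HPd HPpos eta C Heta01
    (Eo_tau N L W1 W2 HW1 HW2 Pstar HPd HPmax HC1' HC2 eta Heta) eps (proj2 Heps)) as [K2 Hconv].
  (* The successor guarantees n >= 1, which the converse needs to absorb its constant into sqrt
     n. *)
  exists K1, K2, (S n0). intros n Hn. split.
  - destruct (Hach n ltac:(lia)) as [M [HM1 HM2]]. exists M. split; [exact HM1|lra].
  - intros M HM. apply Hconv; [lia|exact HM].
Qed.
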